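(* Let $d\ge1$, $\gamma\in(0,\sqrt{2d})$, $\tau\in(0,D_{\gamma,d})$ and $1<p\le2\le q<\infty$, where $D_{\gamma,d}=d-\gamma^2$ if $0<\gamma<\sqrt{2d}/2$ and $D_{\gamma,d}=(\sqrt{2d}-\gamma)^2$ if $\sqrt{2d}/2\le\gamma<\sqrt{2d}$. Let $X_j$, $\mathscr{D}_k$ and $\varphi_{\boldsymbol{I}}$ be as in the context, put $\mathring{X}_k=X_k-1$, and for $k\ge1$, $\boldsymbol{I}\in\mathscr{D}_k$ and $\boldsymbol{n}\in\mathbb{Z}^d$ define $$\mathfrak{D}^\varphi_{\boldsymbol{I}}(\boldsymbol{n})=\langle\boldsymbol{n}\rangle^{\tau/2}\int_{\mathbb{T}^d}\varphi_{\boldsymbol{I}}(\boldsymbol{z})\Big[\prod_{j=1}^{k-1}X_j(\boldsymbol{z})\Big]\mathring{X}_k(\boldsymbol{z})\,\boldsymbol{z}^{\boldsymbol{n}}\,\boldsymbol{m}(\mathrm{d}\boldsymbol{z}).$$ Then there is a constant $C>0$, independent of $k$ and $\boldsymbol{I}$, such that for each $k\ge1$ and $\boldsymbol{I}\in\mathscr{D}_k$, $$\mathbb{E}\big[\|\mathfrak{D}^\varphi_{\boldsymbol{I}}\|_{\ell^q}^p\big]\le C\,k^{4dp}\,2^{k(-dp+dp/q+\tau p/2)}\sup_{\boldsymbol{z}\in\mathbb{T}^d}\Big[\prod_{j=1}^k\mathbb{E}[|X_j(\boldsymbol{z})|^p]\Big].$$ Here $\|\mathfrak{D}^\varphi_{\boldsymbol{I}}\|_{\ell^q}$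 is the $\ell^q(\mathbb{Z}^d)$-norm of $(\mathfrak{D}^\varphi_{\boldsymbol{I}}(\boldsymbol{n}))_{\boldsymbol{n}\in\mathbb{Z}^d}$.
   Context: Torus: $\mathbb{T}^d=\{\boldsymbol{z}\in\mathbb{C}^d:|z_i|=1\}$ with coordinatewise multiplication, coordinatewise conjugate $\bar{\boldsymbol{z}}$, normalized Haar measure $\boldsymbol{m}$; $\mathcal{E}(\boldsymbol{t})=(e^{2\pi i t_1},\dots,e^{2\pi i t_d})$; $\boldsymbol{z}^{\boldsymbol{n}}=\prod_i z_i^{n_i}$; $\langle\boldsymbol{n}\rangle=(1+|\boldsymbol{n}|^2)^{1/2}$ with $|\cdot|$ Euclidean. $D^{\boldsymbol{\alpha}}$ denotes partial derivatives on $\mathbb{T}^d$ with respect to the angular coordinates $\boldsymbol{t}$ of $\boldsymbol{z}=\mathcal{E}(\boldsymbol{t})$. Construction of the processes. Fix a $C^\infty$ function $\Phi:\mathbb{R}^d\to\mathbb{R}$ that is non-negative, positive definite, isotropic ($\Phi(\boldsymbol{t})$ depends only on $\|\boldsymbol{t}\|$), supported in the closed unit ball, with $\Phi(\boldsymbol{0})=1$ and $\sup_{\boldsymbol{t}\ne\boldsymbol{0}}|\Phi(\boldsymbol{t})-\Phi(\boldsymbol{0})|/\|\boldsymbol{t}\|^2<\infty$. For $j\ge1$ let $\mathcal{L}_j(\boldsymbol{t})=\int_1^2\Phi(2^ju\boldsymbol{t})\,\frac{\mathrm{d}u}{u}$ on $\mathbb{R}^d$, and $\mathcal{H}_j(\mathcal{E}(\boldsymbol{t}))=\mathcal{L}_j(\boldsymbol{t})$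 for $\boldsymbol{t}\in[-1/2,1/2)^d$. Let $(\xi_j)_{j\ge1}$ be independent centered Gaussian processes on $\mathbb{T}^d$ with continuous paths and $\mathbb{E}[\xi_j(\boldsymbol{z})\xi_j(\boldsymbol{w})]=\mathcal{H}_j(\boldsymbol{z}\bar{\boldsymbol{w}})$. Fix a non-negative isotropic $Q\in C^\infty(\mathbb{R}^d)$ supported in the closed unit ball with $\int_{\mathbb{R}^d}Q=1$; let $\varepsilon_j=j^{-2}2^{-j}$, $Q_j(\boldsymbol{t})=\varepsilon_j^{-d}Q(\boldsymbol{t}/\varepsilon_j)$, and $P_j(\mathcal{E}(\boldsymbol{t}))=Q_j(\boldsymbol{t})$ for $\boldsymbol{t}\in[-1/2,1/2)^d$. Set $\psi_j(\boldsymbol{z})=\int_{\mathbb{T}^d}P_j(\boldsymbol{w})\xi_j(\boldsymbol{z}\bar{\boldsymbol{w}})\,\boldsymbol{m}(\mathrm{d}\boldsymbol{w})$ and $X_j(\boldsymbol{z})=\exp\big(\gamma\psi_j(\boldsymbol{z})-\tfrac{\gamma^2}{2}\mathbb{E}[\psi_j(\boldsymbol{z})^2]\big)$. Dyadic cubes and partition of unity. $\mathscr{D}_k=\{[0,2^{-k})^d+2^{-k}\boldsymbol{h}:\boldsymbol{h}\in\{-2^{k-1},\dots,2^{k-1}-1\}^d\}$ are the $k$-th generation dyadic cubes in $[-1/2,1/2)^d$, and $\boldsymbol{c_I}$ is the center of $\boldsymbol{I}$. $(\varphi_k)_{k\ge1}$ is a fixed sequence in $C^\infty(\mathbb{T}^d)$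 with $\sum_{\boldsymbol{I}\in\mathscr{D}_k}\varphi_k(\mathcal{E}(\boldsymbol{t}-\boldsymbol{c_I}))=1$ for all $\boldsymbol{t}$, $\operatorname{supp}\varphi_k\subset\mathcal{E}([-2^{-k},2^{-k}]^d)$, and $\|D^{\boldsymbol{\alpha}}\varphi_k\|_{L^\infty}\le C(|\boldsymbol{\alpha}|)2^{k|\boldsymbol{\alpha}|}$ for every $\boldsymbol{\alpha}\in\mathbb{N}^d$ with $C(|\boldsymbol{\alpha}|)$ independent of $k$. $\varphi_{\boldsymbol{I}}(\mathcal{E}(\boldsymbol{t}))=\varphi_k(\mathcal{E}(\boldsymbol{t}-\boldsymbol{c_I}))$ for $\boldsymbol{I}\in\mathscr{D}_k$. *)

(* Defs.v *)
From HB Require Import structures.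
From mathcomp Require Import all_boot all_order all_algebra.
From mathcomp Require Import complex.
From mathcomp Require Import all_classical all_reals all_analysis.
Set Implicit Arguments.
Unset Strict Implicit.
Unset Printing Implicit Defensive.
Import Order.TTheory GRing.Theory Num.Theory.
Import numFieldNormedType.Exports.
Local Open Scope complex_scope.
Local Open Scope classical_set_scope.
Local Open Scope ring_scope.

Local Notation Re := (@complex.Re _).
Local Notation Im := (@complex.Im _).
Local Notation normc := (@Normc.normc _).

(* The n-fold power of a sigma-finite measure, on n-tuples. *)
Section product_tuple.
Context {disp : measure_display} {T : measurableType disp} {R : realType}.
Variable mu : {sigma_finite_measure set T -> \bar R}.

Section cons.
Variables (n : nat) (nu : {sigma_finite_measure set (n.-tuple T) -> \bar R}).

Let cons_pair (x : T * n.-tuple T) : n.+1.-tuple T := [tuple of x.1 :: x.2].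

Let measurable_cons_pair : measurable_fun [set: T * n.-tuple T] cons_pair.
Proof. exact: measurable_cons. Qed.

Definition cons_measure : set (n.+1.-tuple T) -> \bar R :=
  pushforward (mu \x nu)%E cons_pair.

Let cons_measure0 : cons_measure set0 = 0%E.
Proof. by rewrite /cons_measure /pushforward preimage_set0 measure0. Qed.

Let cons_measure_ge0 A : (0 <= cons_measure A)%E.
Proof. exact: measure_ge0. Qed.

Let cons_measure_sigma_additive : semi_sigma_additive cons_measure.
Proof.
move=> F mF tF mUF; rewrite /cons_measure /pushforward preimage_bigcup.
apply: measure_semi_sigma_additive.
- by move=> k; rewrite -[X in measurable X]setTI; exact: measurable_cons_pair.
- apply/trivIsetP => /= i j _ _ ij; rewrite -preimage_setI.
  by move/trivIsetP : tF => /(_ _ _ _ _ ij) ->//; rewrite preimage_set0.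
- rewrite -preimage_bigcup -[X in measurable X]setTI.
  exact: measurable_cons_pair.
Qed.

HB.instance Definition _ := isMeasure.Build _ _ _ cons_measure
  cons_measure0 cons_measure_ge0 cons_measure_sigma_additive.

Let cons_measure_sigma_finite : sigma_finite [set: n.+1.-tuple T] cons_measure.
Proof.
have /sigma_finiteP[F [FT ndF Foo]] := sigma_finiteT mu.
have /sigma_finiteP[G [GT ndG Goo]] := sigma_finiteT nu.
exists (fun k => (fun t : n.+1.-tuple T =>
    (tnth t ord0, [tuple of behead t])) @^-1` (F k `*` G k)).
  apply/seteqP; split => // t _.
  have : [set: T] (tnth t ord0) by [].
  have : [set: n.-tuple T] [tuple of behead t] by [].
  rewrite FT GT => -[l _ Gl] [m _ Fm].
  exists (maxn m l) => //=; split => /=.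
    by move: Fm; exact/subsetPset/ndF/leq_maxl.
  by move: Gl; exact/subsetPset/ndG/leq_maxr.
move=> k; have [mF Fk] := Foo k; have [mG Gk] := Goo k; split.
  rewrite -[X in measurable X]setTI.
  suff mg : measurable_fun setT (fun t : n.+1.-tuple T =>
      (tnth t ord0, [tuple of behead t])) by apply: mg => //; exact: measurableX.
  apply: measurable_fun_pair; first exact: measurable_tnth.
  exact: measurable_behead.
rewrite /cons_measure /pushforward -comp_preimage.
rewrite (_ : _ \o cons_pair = id); last first.
  apply/funext => -[x t]; rewrite /cons_pair/=; congr pair.
  by apply/val_inj.
by rewrite preimage_id/= product_measure1E// lte_mul_pinfty// ge0_fin_numE.
Qed.

HB.instance Definition _ := Measure_isSigmaFinite.Build _ _ _ cons_measure
  cons_measure_sigma_finite.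

End cons.

Fixpoint power_measure (n : nat) :
    {sigma_finite_measure set (n.-tuple T) -> \bar R} :=
  match n return {sigma_finite_measure set (n.-tuple T) -> \bar R} with
  | 0 => [the {sigma_finite_measure set (0.-tuple T) -> \bar R} of \d_ [tuple]]
  | m.+1 => cons_measure (power_measure m)
  end.

End product_tuple.

Section euclidean_space.
Context {R : realType} {d : nat}.
Implicit Types (f : 'rV[R]_d -> R) (t : 'rV[R]_d).

Definition lebesgue_power :
    {sigma_finite_measure set (d.-tuple (measurableTypeR R)) -> \bar R} :=
  power_measure (@lebesgue_measure R) d.

Definition vec_of_tuple (s : d.-tuple (measurableTypeR R)) : 'rV[R]_d :=
  \row_i tnth s i.

(* \int_D f(t) dt for the Lebesgue measure on R^d *)
Definition Rd_integral (D : set 'rV[R]_d) f : R :=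
  \int[lebesgue_power]_(s in vec_of_tuple @^-1` D) f (vec_of_tuple s).

(* The library norm of a row vector is the sup norm, hence this definition. *)
Definition enorm t : R := Num.sqrt (\sum_i t 0 i ^+ 2).

Definition pderiv (i : 'I_d) f : 'rV[R]_d -> R := 'D_(delta_mx 0 i) f.

Definition smooth f : Prop :=
  forall s : seq 'I_d, let g := foldr pderiv f s in
    continuous g /\ forall i t, derivable g t (delta_mx 0 i).

Definition multi_deriv (alpha : 'I_d -> nat) f : 'rV[R]_d -> R :=
  foldr (fun i => iter (alpha i) (pderiv i)) f (enum 'I_d).

Definition isotropic f : Prop :=
  forall s t, enorm s = enorm t -> f s = f t.

Definition supported_in_unit_ball f : Prop :=
  closure [set t | f t != 0] `<=` [set t | enorm t <= 1].

(* In R[i], 0 <= z means that z is a nonnegative real. *)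
Definition positive_definite f : Prop :=
  forall (n : nat) (t : 'I_n -> 'rV[R]_d) (c : 'I_n -> R[i]),
    0 <= \sum_i \sum_j c i * (c j)^* * (f (t i - t j))%:C.

End euclidean_space.

Section torus.
Variables (R : realType) (d : nat).

Definition on_torus (z : 'rV[R[i]]_d) : bool := [forall i, `|z 0 i| == 1].

Definition torus : Type := {z : 'rV[R[i]]_d | on_torus z}.

HB.instance Definition _ := Choice.on torus.

Definition torus_real_coord (z : torus) : 'rV[R]_d * 'rV[R]_d :=
  (map_mx Re (val z), map_mx Im (val z)).

(* The topology induced by C^d = R^d x R^d *)
HB.instance Definition _ :=
  Topological.copy torus (initial_topology torus_real_coord).

End torus.

Section torus_operations.
Context {R : realType} {d : nat}.
Local Notation T := (torus R d).

Lemma torusP (z : T) i : `|val z 0 i| = 1.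
Proof. by have /forallP/(_ i)/eqP := valP z. Qed.

Fact tmul_subproof (z w : T) :
  on_torus (\row_i (val z 0 i * val w 0 i)).
Proof. by apply/forallP => i; rewrite mxE normrM !torusP mulr1. Qed.

Definition tmul (z w : T) : T :=
  exist (@on_torus R d) _ (tmul_subproof z w).

Fact tconj_subproof (z : T) : on_torus (\row_i (val z 0 i)^*).
Proof. by apply/forallP => i; rewrite mxE normcJ torusP. Qed.

Definition tconj (z : T) : T :=
  exist (@on_torus R d) _ (tconj_subproof z).

Fact texp_subproof (t : 'rV[R]_d) :
  on_torus (\row_i (cos (2 * pi * t 0 i) +i* sin (2 * pi * t 0 i))).
Proof.
by apply/forallP => i; rewrite mxE normc_def/= cos2Dsin2 sqrtr1.
Qed.

(* The map t |-> (exp (2 pi i t_1), ..., exp (2 pi i t_d)) *)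
Definition texp (t : 'rV[R]_d) : T :=
  exist (@on_torus R d) _ (texp_subproof t).

Definition cube : set 'rV[R]_d :=
  [set t | forall i, - 2^-1 <= t 0 i < 2^-1].

(* The inverse of the bijection texp : cube -> torus *)
Definition tlog (z : T) : 'rV[R]_d := xget 0 [set t | cube t /\ texp t = z].

Definition monomial (z : T) (n : 'rV[int]_d) : R[i] :=
  \prod_i val z 0 i ^ n 0 i.

(* Integration against the normalized Haar measure, which is the image under
   texp of the Lebesgue measure on cube. *)
Definition torus_integral (f : T -> R) : R := Rd_integral cube (f \o texp).

Definition torus_cintegral (f : T -> R[i]) : R[i] :=
  torus_integral (Re \o f) +i* torus_integral (Im \o f).

End torus_operations.

Section probability_notions.
Context {disp : measure_display} {Omega : measurableType disp} {R : realType}.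
Variable P : probability Omega R.

(* normal_prob m 0 is not the point mass at m, hence the first case. *)
Definition gaussian (Y : Omega -> R) : Prop :=
  (exists m : R, forall A : set (measurableTypeR R), measurable A ->
     P (Y @^-1` A) = \d_m A) \/
  (exists m s : R, 0 < s /\ forall A : set (measurableTypeR R), measurable A ->
     P (Y @^-1` A) = normal_prob m s A).

Definition gaussian_process (I : Type) (Y : I -> {RV P >-> R}) : Prop :=
  forall (n : nat) (x : 'I_n -> I) (a : 'I_n -> R),
    gaussian (fun o => \sum_i a i * Y (x i) o).

Definition sigma_generated (I : Type) (Y : I -> {RV P >-> R}) :
    set (set Omega) :=
  <<s \bigcup_(x in [set: I])
        preimage_set_system [set: Omega] (Y x) (@measurable _ (measurableTypeR R)) >>.

(* Mutual independence of the processes Y j, j in D *)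
Definition independent_processes (I : Type) (D : set nat)
    (Y : nat -> I -> {RV P >-> R}) : Prop :=
  forall J : seq nat, uniq J -> (forall j, j \in J -> D j) ->
  forall A : nat -> set Omega,
    (forall j, j \in J -> sigma_generated (Y j) (A j)) ->
  P (\big[setI/setT]_(j <- J) A j) = (\prod_(j <- J) P (A j))%E.

End probability_notions.

Section construction.
Context {R : realType} {d : nat}.
Local Notation T := (torus R d).

Record admissible_Phi (Phi : 'rV[R]_d -> R) : Prop := {
  Phi_smooth : smooth Phi;
  Phi_ge0 : forall t, 0 <= Phi t;
  Phi_posdef : positive_definite Phi;
  Phi_isotropic : isotropic Phi;
  Phi_support : supported_in_unit_ball Phi;
  Phi_at0 : Phi 0 = 1;
  Phi_quadratic : exists K : R, forall t, t != 0 ->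
    `|Phi t - Phi 0| / enorm t ^+ 2 <= K
}.

Record admissible_Q (Q : 'rV[R]_d -> R) : Prop := {
  Q_smooth : smooth Q;
  Q_ge0 : forall t, 0 <= Q t;
  Q_isotropic : isotropic Q;
  Q_support : supported_in_unit_ball Q;
  Q_integral : Rd_integral setT Q = 1
}.

Definition calL (Phi : 'rV[R]_d -> R) (j : nat) (t : 'rV[R]_d) : R :=
  \int[lebesgue_measure]_(u in `[1, 2]) (Phi ((2 ^+ j * u) *: t) / u).

Definition calH (Phi : 'rV[R]_d -> R) (j : nat) (z : T) : R :=
  calL Phi j (tlog z).

Definition eps (j : nat) : R := j%:R ^- 2 * 2 ^- j.

Definition mollifier (Q : 'rV[R]_d -> R) (j : nat) (z : T) : R :=
  eps j ^- d * Q ((eps j)^-1 *: tlog z).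

Section fields.
Context {disp : measure_display} {Omega : measurableType disp}.
Variable P : probability Omega R.
Implicit Type xi : nat -> T -> {RV P >-> R}.

(* Only the indices j >= 1 are constrained; xi 0 is irrelevant. *)
Record gaussian_fields (Phi : 'rV[R]_d -> R) xi : Prop := {
  fields_independent : independent_processes [set j | (0 < j)%N] xi;
  fields_gaussian : forall j, (0 < j)%N -> gaussian_process (xi j);
  fields_continuous : forall j, (0 < j)%N ->
    forall o, continuous (fun z => xi j z o);
  fields_centered : forall j, (0 < j)%N -> forall z, 'E_P[xi j z]%E = 0%E;
  fields_covariance : forall j, (0 < j)%N -> forall z w,
    'E_P[fun o => (xi j z o * xi j w o)%R]%E = (calH Phi j (tmul z (tconj w)))%:E
}.

Definition psi (Q : 'rV[R]_d -> R) xi (j : nat) (z : T) (o : Omega) : R :=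
  torus_integral (fun w => mollifier Q j w * xi j (tmul z (tconj w)) o).

Definition X_ (gamma : R) (Q : 'rV[R]_d -> R) xi (j : nat) (z : T)
    (o : Omega) : R :=
  expR (gamma * psi Q xi j z o
        - gamma ^+ 2 / 2 * fine 'E_P[fun o => (psi Q xi j z o ^+ 2)%R]%E).

End fields.

(* I : dyadic d k stands for the cube [0, 2^-k)^d + 2^-k h with
   h_i = I i - 2^(k-1), for k >= 1. *)
Definition dyadic (k : nat) : finType := {ffun 'I_d -> 'I_(2 ^ k)}.

Definition dyadic_cube (k : nat) (I : dyadic k) : set 'rV[R]_d :=
  [set t | forall i, let a : R := 2 ^- k * ((I i)%:R - 2 ^+ k.-1) in
                     a <= t 0 i < a + 2 ^- k].

Definition center (k : nat) (I : dyadic k) : 'rV[R]_d :=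
  \row_i (2 ^- k * ((I i)%:R - 2 ^+ k.-1 + 2^-1)).

Record partition_of_unity (phi : nat -> T -> R[i]) : Prop := {
  pou_smooth : forall k, (0 < k)%N ->
    smooth (Re \o phi k \o texp) /\ smooth (Im \o phi k \o texp);
  pou_sum : forall k, (0 < k)%N -> forall t,
    \sum_(I : dyadic k) phi k (texp (t - center I)) = 1;
  pou_support : forall k, (0 < k)%N ->
    closure [set z | phi k z != 0] `<=`
    texp @` [set t : 'rV[R]_d | forall i, - 2 ^- k <= t 0 i <= 2 ^- k];
  pou_bound : exists C : nat -> R, forall k, (0 < k)%N ->
    forall (alpha : 'I_d -> nat) t, let n := (\sum_i alpha i)%N in
      normc (multi_deriv alpha (Re \o phi k \o texp) t
             +i* multi_deriv alpha (Im \o phi k \o texp) t)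
      <= C n * 2 ^+ (k * n)
}.

Definition phi_cube (phi : nat -> T -> R[i]) (k : nat) (I : dyadic k)
    (z : T) : R[i] :=
  phi k (texp (tlog z - center I)).

Definition japanese (n : 'rV[int]_d) : R :=
  Num.sqrt (1 + \sum_i (n 0 i)%:~R ^+ 2).

Definition D_exponent (gamma : R) : R :=
  if gamma < Num.sqrt (2 * d%:R) / 2 then d%:R - gamma ^+ 2
  else (Num.sqrt (2 * d%:R) - gamma) ^+ 2.

(* The coefficient at n of the sequence attached to the cube I, for one
   realization x of the factors X_j. *)
Definition frakD (tau : R) (phi : nat -> T -> R[i]) (x : nat -> T -> R)
    (k : nat) (I : dyadic k) (n : 'rV[int]_d) : R[i] :=
  (japanese n `^ (tau / 2))%:C *
  torus_cintegral (fun z => phi_cube phi I z *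
    ((\prod_(1 <= j < k) x j z) * (x k z - 1))%:C * monomial z n).

Definition lq_norm (q : R) (a : 'rV[int]_d -> R[i]) : \bar R :=
  ((\esum_(n in [set: 'rV[int]_d]) (normc (a n) `^ q)%:E) `^ q^-1)%E.

End construction.
Arguments dyadic : clear implicits.

(* Main.v *)
Require Import Defs.
From mathcomp Require Import all_boot all_order all_algebra.
From mathcomp Require Import complex finmap.
From mathcomp Require Import all_classical all_reals all_analysis.
From mathcomp Require Import measurable_realfun.
From mathcomp Require Import ring lra.

(** Write the coefficient at n as the Fourier coefficient of
    f = phi_I * X_1 ... X_(k-1) * (X_k - 1). Every factor of f varies on a scale
    no finer than 1/M with M = k^2 2^k = 1/eps_k: the bump phi_I because its
    derivatives of order b are O(2^(kb)), and X_j because psi_j is a convolution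
    with a kernel of width eps_j >= eps_k. Hence N = 3d integrations by parts in
    the coordinate direction i where |n_i| is largest gain (M/|n_i|)^N.

    The derivatives are organised by the seminorm
    jnorm i M N f t = sum_(b <= N) |d_i^b f (t)| / (b! M^b), which is
    submultiplicative (Leibniz), so that the product over j factorises. For an
    exponential it is controlled by the jet of the exponent (jnorm_exp), and the
    derivatives of psi_j are dominated by eps_j^-b times the local average of
    |xi_j| over a box of side 2 eps_j (smoothed_jet_bound). With
    r_j = eps_k / eps_j <= 2^(j-k) this yields
      jnorm i M N X_j <= X_j (1 + K r_j avg_j)^N      (chaos_jnorm),
    and the product of these bounds over j <= k is called growth. It follows
    that the coefficient at n is at most a constant times
      <n>^(tau/2) min(1, M/max_i |n_i|)^(3d) Y,
    where Y (named mass) is the integral of growth over a cover of supp phi_I.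
    Since tau/2 <= d, this is at most a constant times
    M^(tau/2) Y prod_i min(1, M/|n_i|)^2, and the sum over n of the last product
    is O(M^d). Therefore the l^q norm is at most a constant times
    M^(tau/2 + d/q) Y, for every realization (lq_norm_mass).

    It remains to bound E[Y^p]. By Hoelder and Tonelli it is at most
    |cover|^(p-1) times the integral over this cover of E[growth^p], and
    independence of the levels factorises E[growth^p]. As E[X_j^p] is bounded
    below and avg_j has exponential moments (Jensen and the Gaussian moment
    generating function), the level j < k contributes at most
    E[X_j^p] (1 + C r_j), see factor_moment. The product of the corrections stays
    bounded because sum_j r_j <= 1, so E[growth^p] is at most a constant times
    prod_(j <= k) E[X_j^p] (growth_moment). Finally |cover| = O(2^(-kd)),
    and the powers of k^2 in M^(p (tau/2 + d/q)) are absorbed in k^(4dp). *)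
Import Order.TTheory GRing.Theory Num.Theory.
Import numFieldNormedType.Exports.
Local Open Scope complex_scope.
Local Open Scope classical_set_scope.
Local Open Scope ring_scope.
Set Implicit Arguments.
Unset Strict Implicit.
Unset Printing Implicit Defensive.

(** * Random functions at measurable points *)

Section measurability.
Context {R : realType} {d : nat}.

Lemma cvg_rV (u : nat -> 'rV[R]_d) (x : 'rV[R]_d) :
  (forall i, (fun n => u n 0 i) @ \oo --> x 0 i) -> u @ \oo --> x.
Proof.
move=> ux; apply/cvgrPdist_le => /= e e0.
have H (i : 'I_d) : \forall n \near \oo, `|x 0 i - u n 0 i| <= e.
  by have /cvgrPdist_le/(_ _ e0) := ux i.
have /filter_forall {}H := H.
near=> n.
have Hn : forall i, `|x 0 i - u n 0 i| <= e by near: n; exact: H.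
rewrite /Num.norm/= mx_normrE; apply: bigmax_le; first exact: ltW.
by move=> [a b] _ /=; rewrite (ord1 a) !mxE; exact: Hn.
Unshelve. all: by end_near. Qed.

(** The dyadic grid point below x at resolution 2^-n: it takes countably many
    values, which is what reduces measurability to countable unions. *)
Definition grid_floor (n : nat) (x : 'rV[R]_d) : 'rV[R]_d :=
  \row_i ((Num.floor (2 ^+ n * x 0 i))%:~R / 2 ^+ n).

Lemma grid_floor_cvg (x : 'rV[R]_d) : grid_floor ^~ x @ \oo --> x.
Proof.
apply: cvg_rV => i; apply/cvgrPdist_le => /= e e0.
have : (fun n => (2^-1 : R) ^+ n) @ \oo --> 0.
  by apply: cvg_expr; rewrite ger0_norm ?invr_ge0 ?invf_lt1 ?ltr1n.
move=> /cvgrPdist_le/(_ _ e0); apply: filterS => n.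
rewrite sub0r normrN ger0_norm ?exprn_ge0 ?invr_ge0// => He; rewrite mxE.
have p2 : (0 : R) < 2 ^+ n by rewrite exprn_gt0.
have /andP[f1 f2] := floor_itv (2 ^+ n * x 0 i).
rewrite (_ : _ - _ = (2 ^+ n * x 0 i - (Num.floor (2 ^+ n * x 0 i))%:~R) / 2 ^+ n);
  last by field; rewrite gt_eqF.
rewrite normrM ger0_norm ?subr_ge0// (ger0_norm (ltW _)) ?invr_gt0//.
apply: le_trans He; rewrite exprVn ler_piMl ?invr_ge0 ?(ltW p2)//.
by rewrite lerBlDl; apply: ltW; rewrite -[X in _ + X]/(1%:~R) -intrD.
Qed.

(** Approximating w by its grid points, g (grid_floor n (w a)) a is measurable
    because w is then countably valued, and it converges to g (w a) a since g is
    continuous in its first argument. This is how all joint measurability in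
    (t, o) of fields with continuous paths is obtained. *)
Lemma measurable_fun_caratheodory {d'} {A : measurableType d'}
    (w : A -> 'rV[R]_d) (g : 'rV[R]_d -> A -> R) :
  (forall i, measurable_fun setT (fun a => w a 0 i)) ->
  (forall x, measurable_fun setT (g x)) ->
  (forall a, continuous (g ^~ a)) ->
  measurable_fun setT (fun a => g (w a) a).
Proof.
move=> mw mg cg.
apply: (@measurable_fun_cvg _ _ _ _ (fun n a => g (grid_floor n (w a)) a)); last first.
  move=> a _; apply: (cvg_comp (grid_floor ^~ (w a)) (g ^~ a)).
    exact: grid_floor_cvg.
  exact: cg.
move=> n _ Y mY; rewrite setTI.
pose fl a : 'rV[int]_d := \row_i Num.floor (2 ^+ n * w a 0 i).
pose gr (m : 'rV[int]_d) : 'rV[R]_d := \row_i ((m 0 i)%:~R / 2 ^+ n).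
have gfE a : grid_floor n (w a) = gr (fl a) by apply/rowP => i; rewrite !mxE.
rewrite (_ : _ @^-1` _ = \bigcup_(m : 'rV[int]_d) ([set a | fl a = m] `&` g (gr m) @^-1` Y)).
  apply: countable_bigcupT_measurable; first exact: countableP.
  move=> m; apply: measurableI; last first.
    by rewrite -[X in measurable X]setTI; exact: mg.
  rewrite (_ : [set a | _] = \bigcap_(i in [set: 'I_d])
      [set a | (m 0 i)%:~R <= 2 ^+ n * w a 0 i < (m 0 i + 1)%:~R]).
    apply: fin_bigcap_measurable => // i _.
    have mf : measurable_fun setT (fun a => 2 ^+ n * w a 0 i).
      exact: measurable_funM.
    rewrite (_ : [set a | _] = setT `&` (fun a => 2 ^+ n * w a 0 i) @^-1`
         `[(m 0 i)%:~R, (m 0 i + 1)%:~R[); first exact: mf.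
    by rewrite setTI; apply/seteqP; split => a /=; rewrite in_itv.
  apply/seteqP; split => a /=.
    by move=> <- i _ /=; rewrite mxE; exact: floor_itv.
  move=> H; apply/rowP => i; rewrite mxE.
  by have /= := H i Logic.I; move=> /floor_def.
apply/seteqP; split => a /=.
  by rewrite gfE => Ya; exists (fl a).
by case=> m _ [/= <-]; rewrite gfE.
Qed.

Lemma measurable_continuous_vec (g : 'rV[R]_d -> R) : continuous g ->
  measurable_fun setT (g \o @vec_of_tuple R d).
Proof.
move=> cg; apply: (@measurable_fun_caratheodory _ _ (@vec_of_tuple R d) (fun x _ => g x)) => //.
by move=> i; under eq_fun do rewrite mxE; exact: measurable_tnth.
Qed.

Lemma measurable_vec_coord {d'} {A : measurableType d'} (f : A -> d.-tuple (measurableTypeR R)) i :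
  measurable_fun setT f -> measurable_fun setT (fun a => vec_of_tuple (f a) 0 i).
Proof.
move=> mf; under eq_fun do rewrite mxE.
exact: (measurableT_comp (measurable_tnth i) mf).
Qed.

End measurability.

(** * Translations and boxes for the Lebesgue measure *)

Section power_integral.
Context {R : realType}.
Local Notation leb := (@lebesgue_measure R).
Local Notation RR := (measurableTypeR R).

Lemma ge0_integral_power_cons (n : nat) (f : n.+1.-tuple RR -> \bar R) :
  measurable_fun setT f -> (forall s, 0 <= f s)%E ->
  (\int[@lebesgue_power R n.+1]_s f s =
   \int[leb]_x \int[@lebesgue_power R n]_s f [tuple of x :: s])%E.
Proof.
move=> mf f0.
have mc : measurable_fun setT (fun x : RR * n.-tuple RR => [tuple of x.1 :: x.2]).
  exact: measurable_cons.
rewrite /lebesgue_power /= /cons_measure.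
rewrite (ge0_integral_pushforward mc)//=.
rewrite fubini_tonelli1//=.
exact: measurableT_comp.
Qed.

Lemma lebesgue_shift (x : R) (f : RR -> \bar R) : measurable_fun setT f ->
  (forall s, 0 <= f s)%E ->
  (\int[leb]_y f (y + x)%R = \int[leb]_y f y)%E.
Proof.
move=> mf f0.
pose sh (y : RR) : RR := y + x.
have ms : measurable_fun setT sh by exact: measurable_funD.
transitivity (\int[pushforward leb sh]_y f y)%E.
  by rewrite (ge0_integral_pushforward ms).
apply: eq_measure_integral => A mA _.
apply/esym/lebesgue_measure_unique => // _ [[a b] /= ab <-].
rewrite /pushforward.
rewrite (_ : _ @^-1` _ = `]a - x, b - x]%classic); last first.
  by apply/seteqP; split => y /=; rewrite !in_itv/= ltrBlDr lerBrDr.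
by rewrite lebesgue_measure_itv/= lebesgue_measure_itv/= !lte_fin ltrD2r -!EFinB opprB addrA subrK.
Qed.
End power_integral.

Section power_shift.
Context {R : realType}.
Local Notation leb := (@lebesgue_measure R).
Local Notation RR := (measurableTypeR R).

Definition tshift n (w : 'I_n -> R) (s : n.-tuple RR) : n.-tuple RR :=
  [tuple (tnth s i + w i : RR) | i < n].

Lemma measurable_tshift n (w : 'I_n -> R) : measurable_fun setT (tshift w).
Proof.
apply/measurable_fun_tnthP => i.
rewrite (_ : _ \o _ = (fun s : n.-tuple RR => (tnth s i + w i : RR))); last first.
  by apply/funext => s /=; rewrite tnth_mktuple.
by apply: measurable_funD => //; exact: measurable_tnth.
Qed.

Lemma tshift_cons n (w : 'I_n.+1 -> R) x (s : n.-tuple RR) :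
  tshift w [tuple of x :: s] =
  [tuple of (x + w ord0 : RR) :: tshift (fun i => w (lift ord0 i)) s].
Proof.
apply: eq_from_tnth => i; rewrite tnth_mktuple.
by case: (unliftP ord0 i) => [j|] ->; rewrite ?tnthS ?tnth0// tnth_mktuple.
Qed.

Lemma ge0_integral_power_shift n (w : 'I_n -> R) (f : n.-tuple RR -> \bar R) :
  measurable_fun setT f -> (forall s, 0 <= f s)%E ->
  (\int[@lebesgue_power R n]_s f (tshift w s) =
   \int[@lebesgue_power R n]_s f s)%E.
Proof.
elim: n w f => [|n IH] w f mf f0.
  by apply: eq_integral => s _; rewrite (tuple0 s) (tuple0 (tshift w [tuple])).
have mc : measurable_fun setT (fun x : RR * n.-tuple RR => [tuple of x.1 :: x.2]).
  exact: measurable_cons.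
rewrite !ge0_integral_power_cons//; last first.
  by apply: measurableT_comp => //; exact: measurable_tshift.
transitivity (\int[leb]_x \int[@lebesgue_power R n]_s f [tuple of (x + w ord0 : RR)%R :: s])%E.
  apply: eq_integral => x _.
  under eq_integral do rewrite tshift_cons.
  rewrite (IH (fun i => w (lift ord0 i)) (fun s => f [tuple of (x + w ord0 : RR)%R :: s]))//.
  apply: measurableT_comp => //; apply: measurable_cons => //.
rewrite (lebesgue_shift (w ord0) (f := fun x => \int[@lebesgue_power R n]_s f [tuple of x :: s])%E)//.
  exact: (measurable_fun_fubini_tonelli_F (fun x : RR * n.-tuple RR => f [tuple of x.1 :: x.2]) (measurableT_comp mf mc)).
by move=> x; exact: integral_ge0.
Qed.

Definition tbox n (a b : 'I_n -> R) : set (n.-tuple RR) :=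
  [set s | forall i, a i <= tnth s i <= b i].

Lemma measurable_tbox n (a b : 'I_n -> R) : measurable (tbox a b).
Proof.
rewrite (_ : tbox a b = \bigcap_(i in [set: 'I_n]) (setT `&` (fun s => tnth s i) @^-1` `[a i, b i])).
  apply: fin_bigcap_measurable => // i _.
  by apply: measurable_tnth.
apply/seteqP; split => s /=; first by move=> H i _; split => //; rewrite /= in_itv/=; exact: H.
by move=> H i; have [_ /=] := H i Logic.I; rewrite in_itv.
Qed.

Lemma lebesgue_power_tbox n (a b : 'I_n -> R) : (forall i, a i <= b i) ->
  lebesgue_power (tbox a b) = (\prod_i (b i - a i))%:E.
Proof.
elim: n a b => [|n IH] a b ab.
  rewrite big_ord0 /= diracE mem_set//.
  by case.
have mc : measurable_fun setT (fun x : RR * n.-tuple RR => [tuple of x.1 :: x.2]).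
  exact: measurable_cons.
rewrite /= /cons_measure /pushforward.
rewrite (_ : _ @^-1` _ = `[a ord0, b ord0] `*`
   tbox (fun i => a (lift ord0 i)) (fun i => b (lift ord0 i))); last first.
  apply/seteqP; split => -[x s] /=.
    move=> H; split.
      by have := H ord0; rewrite /= in_itv.
    by move=> i; have := H (lift ord0 i); rewrite tnthS.
  rewrite in_itv => -[/= H1 H2] i.
  by case: (unliftP ord0 i) => [j|] ->; rewrite ?tnthS ?tnth0.
rewrite product_measure1E//; last exact: measurable_tbox.
rewrite IH; last by move=> i; exact: ab.
have L : (leb `[a ord0, b ord0]%classic = (b ord0 - a ord0)%:E)%E.
  rewrite lebesgue_measure_itv/= lte_fin; case: ltP => [_|ba]; first by rewrite EFinB.
  by congr EFin; apply/esym/eqP; rewrite subr_eq0 eq_le ba ab.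
rewrite big_ord_recl EFinM; congr (_ * _)%E; exact: L.
Qed.

End power_shift.

(** * Angular coordinates on the torus *)

Section angles.
Context {R : realType}.

Lemma cos_sinDz (x : R) (m : int) :
  cos (2 * pi * (x + m%:~R)) = cos (2 * pi * x) /\
  sin (2 * pi * (x + m%:~R)) = sin (2 * pi * x).
Proof.
have H (n : nat) (y : R) : cos (2 * pi * (y + n%:R)) = cos (2 * pi * y) /\
    sin (2 * pi * (y + n%:R)) = sin (2 * pi * y).
  elim: n y => [|n IH] y; first by rewrite addr0.
  have [<- <-] := IH y.
  rewrite -[n.+1%:R]natr1 (_ : 2 * pi * (y + (n%:R + 1)) = 2 * pi * (y + n%:R) + pi *+ 2).
    by rewrite cosD2pi sinD2pi.
  by rewrite -mulr_natl; ring.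
case: m => n; first exact: H.
rewrite NegzE mulrNz; have [<- <-] := H n.+1 (x - n.+1%:R).
by rewrite subrK.
Qed.

Lemma cos_eq1_int (x : R) : cos (2 * pi * x) = 1 -> exists m : int, x = m%:~R.
Proof.
move=> cx; exists (Num.floor x).
have /andP[f1 f2] := floor_itv x.
set m := Num.floor x in f1 f2 *.
have {cx}: cos (2 * pi * (x - m%:~R)) = 1.
  by rewrite -mulrNz (cos_sinDz x (- m)).1.
move: f1 f2; rewrite intrD1 -subr_ge0 -ltrBlDl.
set y := x - _ => y0 y1 cy.
apply/eqP; rewrite -subr_eq0 -/y.
have pi0 := pi_gt0 R.
have I (z : R) : 0 <= z -> z <= 2^-1 -> 2 * pi * z \in `[0, pi].
  move=> z0 z1; rewrite in_itv/= mulr_ge0 ?mulr_ge0 ?pi_ge0//=.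
  by rewrite -mulrA mulrCA ler_piMr ?pi_ge0// -ler_pdivlMl ?mulr1.
have K (z : R) : 0 <= z -> z <= 2^-1 -> cos (2 * pi * z) = 1 -> z = 0.
  move=> z0 z1 cz; have : 2 * pi * z = 0.
    apply: cos_inj; [exact: I| |by rewrite cos0].
    by rewrite in_itv/= lexx pi_ge0.
  by move/eqP; rewrite !mulf_eq0 pnatr_eq0 (gt_eqF pi0) => /eqP.
have [y2|y2] := leP y 2^-1; first exact/eqP/K.
have : 1 - y = 0.
  apply: K; [by rewrite subr_ge0 ltW|lra|].
  rewrite mulrBr (_ : 2 * pi * 1 = - (- (pi *+ 2))); last by rewrite opprK mulr1 mulr_natl.
  by rewrite -opprD cosN addrC -cosD2pi subrK.
by move/eqP; rewrite subr_eq0 => /eqP y3; move: y1; rewrite -y3 ltxx.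
Qed.

End angles.

Section torus_coordinates.
Context {R : realType} {d : nat}.
Local Notation E := 'rV[R]_d.
Local Notation T := (torus R d).

Definition intvec (m : 'rV[int]_d) : E := map_mx intr m.

Definition periodic_fun {X : Type} (f : E -> X) := forall t m, f (t + intvec m) = f t.

Lemma intvecN m : intvec (- m) = - intvec m.
Proof. by apply/rowP => i; rewrite !mxE mulrNz. Qed.

Lemma texp_periodic : periodic_fun (@texp R d).
Proof.
move=> t m; apply/val_inj => /=; apply/rowP => i; rewrite !mxE.
by have [-> ->] := cos_sinDz (t 0 i) (m 0 i).
Qed.

(** Two angles with the same cosine and sine differ by an integer number of
    turns, since the cosine of their difference is 1. *)
Lemma texp_eq (s t : E) : texp s = texp t -> exists m, s = t + intvec m.
Proof.
move=> st.
have H i : exists m : int, s 0 i = t 0 i + m%:~R.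
  have /(congr1 (fun z : T => val z 0 i)) := st.
  rewrite /= !mxE => -[c1 c2].
  have : cos (2 * pi * (s 0 i - t 0 i)) = 1.
    by rewrite mulrBr cosB c1 c2 -!expr2 cos2Dsin2.
  by move=> /cos_eq1_int[m mE]; exists m; rewrite -mE addrC subrK.
have [m mP] := choice H.
by exists (\row_i m i); apply/rowP => i; rewrite !mxE mP.
Qed.

Definition reduce (t : E) : 'rV[int]_d := \row_i - Num.floor (t 0 i + 2^-1).

Lemma cube_reduce (t : E) : cube (t + intvec (reduce t)).
Proof.
move=> i; rewrite !mxE mulrNz.
have /andP[f1 f2] := floor_itv (t 0 i + 2^-1).
by move: f1 f2; rewrite intrD1 => f1 f2; apply/andP; split; lra.
Qed.

(** This determines every periodic function at tlog z. *)
Lemma tlog_texp (t : E) : exists m, tlog (texp t) = t + intvec m.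
Proof.
have [] := @xgetPex _ 0 [set u | cube u /\ texp u = texp t].
  by exists (t + intvec (reduce t)); split; [exact: cube_reduce|rewrite texp_periodic].
by move=> _ /texp_eq[m E1]; exists m; exact: E1.
Qed.

Lemma cube_uniq (t : E) m : cube t -> cube (t + intvec m) -> m = 0.
Proof.
move=> ct ctm; apply/rowP => i; rewrite mxE.
have /andP[a b] := ct i; have := ctm i; rewrite !mxE => /andP[a' b'].
have : `|(m 0 i)%:~R| < 1 :> R by rewrite ltr_norml; apply/andP; split; lra.
by rewrite -intr_norm -[X in _ < X]/(1%:~R) ltr_int; case: (m 0 i) => [[|n]|n].
Qed.

Lemma tlog_texp_cube (t : E) : cube t -> tlog (texp t) = t.
Proof.
move=> ct.
have [] := @xgetPex _ 0 [set u | cube u /\ texp u = texp t].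
  by exists t.
move=> c1 /texp_eq[m E1]; rewrite E1 in c1.
rewrite [LHS]E1 (cube_uniq ct c1) (_ : intvec 0 = 0) ?addr0//.
by apply/rowP => i; rewrite !mxE.
Qed.

Lemma tmul_conj_texp (s t : E) : tmul (texp s) (tconj (texp t)) = texp (s - t).
Proof.
apply/val_inj/rowP => i; rewrite /= !mxE /=.
rewrite mulrBr cosB sinB; apply/eqP; rewrite eq_complex/=.
by apply/andP; split; apply/eqP; ring.
Qed.

Lemma continuous_row (f : R -> R) : continuous f ->
  continuous (fun t : E => (\row_i f (t 0 i)) : E).
Proof.
move=> cf t; apply/(@cvgrPdist_le _ _ _ (nbhs t)) => e e0.
have H (i : 'I_d) : \forall u \near nbhs (t : E), `|f (t 0 i) - f ((u : E) 0 i)| <= e.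
  have : (f \o (fun u : E => u 0 i)) u @[u --> t] --> f (t 0 i).
    apply: (@continuous_comp _ _ _ (fun u : E => u 0 i) f t); first exact: coord_continuous.
    exact: (cf (t 0 i)).
  by move=> /cvgrPdist_le/(_ _ e0).
have /filter_forall {}H := H.
near=> u.
have Hn : forall i, `|f (t 0 i) - f (u 0 i)| <= e by near: u; exact: H.
rewrite /Num.norm/= mx_normrE; apply: bigmax_le; first exact: ltW.
by move=> [a b] _ /=; rewrite (ord1 a) !mxE; exact: Hn.
Unshelve. all: by end_near. Qed.

Lemma continuous_texp : continuous (@texp R d).
Proof.
apply: (@continuous_comp_initial (torus R d) _ _ (@torus_real_coord R d) (@texp R d)).
move=> t.
have H1 : (fun u : E => map_mx (@complex.Re R) (val (texp u))) u @[u --> t] --> map_mx (@complex.Re R) (val (texp t)).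
  rewrite (_ : (fun u : E => _) = fun u : E => \row_i cos (2 * pi * u 0 i)); last first.
    by apply/funext => u; apply/rowP => i; rewrite !mxE.
  rewrite (_ : map_mx _ _ = \row_i cos (2 * pi * t 0 i)); last first.
    by apply/rowP => i; rewrite !mxE.
  apply: (@continuous_row (fun x => cos (2 * pi * x))) => x.
  apply: (@continuous_comp _ _ _ (fun x : R => 2 * pi * x) (@cos R)); last exact: continuous_cos.
  exact: mulrl_continuous.
have H2 : (fun u : E => map_mx (@complex.Im R) (val (texp u))) u @[u --> t] --> map_mx (@complex.Im R) (val (texp t)).
  rewrite (_ : (fun u : E => _) = fun u : E => \row_i sin (2 * pi * u 0 i)); last first.
    by apply/funext => u; apply/rowP => i; rewrite !mxE.
  rewrite (_ : map_mx _ _ = \row_i sin (2 * pi * t 0 i)); last first.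
    by apply/rowP => i; rewrite !mxE.
  apply: (@continuous_row (fun x => sin (2 * pi * x))) => x.
  apply: (@continuous_comp _ _ _ (fun x : R => 2 * pi * x) (@sin R)); last exact: continuous_sin.
  exact: mulrl_continuous.
exact: (cvg_pair H1 H2).
Qed.

Definition phase (n : 'rV[int]_d) (t : E) : R := 2 * pi * \sum_i (n 0 i)%:~R * t 0 i.

Lemma monomial_texp (n : 'rV[int]_d) t :
  monomial (texp t) n = cos (phase n t) +i* sin (phase n t).
Proof.
have cis_exp (x : R) (m : int) : (cos x +i* sin x) ^ m = cos (m%:~R * x) +i* sin (m%:~R * x).
  have H (k : nat) : (cos x +i* sin x) ^+ k = cos (k%:R * x) +i* sin (k%:R * x).
    elim: k => [|k IH]; first by rewrite expr0 mul0r cos0 sin0.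
    rewrite exprS IH -[k.+1%:R]natr1 mulrDl mul1r cosD sinD; apply/eqP.
    by rewrite eq_complex /=; apply/andP; split; apply/eqP; ring.
  case: m => k; first exact: H.
  rewrite NegzE -exprnN H mulrNz mulNr cosN sinN; apply/eqP; rewrite eq_complex/=.
  by rewrite cos2Dsin2 !divr1 !eqxx.
rewrite /monomial /phase.
rewrite (eq_bigr (fun i => cos ((n 0 i)%:~R * (2 * pi * t 0 i)) +i*
    sin ((n 0 i)%:~R * (2 * pi * t 0 i)))); last first.
  by move=> i _; rewrite /= mxE cis_exp.
rewrite mulr_sumr.
elim/big_ind2 : _; first by rewrite cos0 sin0.
  move=> x1 y1 x2 y2 -> ->; rewrite cosD sinD; apply/eqP; rewrite eq_complex/=.
  by apply/andP; split; apply/eqP; ring.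
by move=> i _; rewrite (_ : (n 0 i)%:~R * (2 * pi * t 0 i) = 2 * pi * ((n 0 i)%:~R * t 0 i)) //; ring.
Qed.

End torus_coordinates.

(** * Taylor coefficients along a coordinate direction *)

Section directional_jets.
Context {R : realType} {d : nat}.
Local Notation E := 'rV[R]_d.
Variable i : 'I_d.
Local Notation e := (delta_mx 0 i : E).
Implicit Types f g S : E -> R.

Definition dn (b : nat) f : E -> R := iter b (pderiv i) f.

(** The b-th Taylor coefficient in the direction i: with this normalisation the
    Leibniz rule has no binomial coefficients. *)
Definition tc (b : nat) f (t : E) : R := dn b f t / b`!%:R.

Lemma dnS b f : dn b.+1 f = pderiv i (dn b f). Proof. by []. Qed.

Lemma dn_tc b f t : dn b f t = b`!%:R * tc b f t.
Proof. by rewrite /tc mulrC divfK// pnatr_eq0 -lt0n fact_gt0. Qed.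

Lemma fact_neq0 b : b`!%:R != 0 :> R.
Proof. by rewrite pnatr_eq0 -lt0n fact_gt0. Qed.

Lemma succ_fact_cancel b (x : R) : b`!%:R^-1 * x = b.+1%:R * (x / (b.+1)`!%:R).
Proof.
rewrite factS natrM; have := fact_neq0 b.
have : b.+1%:R != 0 :> R by rewrite pnatr_eq0.
by move: (b.+1%:R) (b`!%:R) => B F B0 F0; field; apply/andP.
Qed.

Lemma is_derive_tc b f t : derivable (dn b f) t e ->
  is_derive t e (tc b f) (b.+1%:R * tc b.+1 f t).
Proof.
move=> df; have := derivableP df.
move=> /(is_deriveZ (b`!%:R^-1)).
rewrite (_ : _ \*: _ = tc b f); last by apply/funext => x; rewrite /tc /= mulrC.
move=> H; apply: (is_derive_eq H).
exact: succ_fact_cancel.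
Qed.

Lemma sum_shift_leibniz (A B : nat -> R) b :
  \sum_(c < b.+1) (c.+1%:R * A c.+1 * B (b - c)%N + A c * ((b - c).+1%:R * B (b - c).+1))
  = b.+1%:R * \sum_(c < b.+2) A c * B (b.+1 - c)%N.
Proof.
rewrite big_split/= mulr_sumr.
transitivity (\sum_(c < b.+2) c%:R * A c * B (b.+1 - c)%N +
  \sum_(c < b.+2) (b.+1 - c)%:R * (A c * B (b.+1 - c)%N)); last first.
  rewrite -big_split/=; apply: eq_bigr => c _.
  rewrite -mulrA -mulrDl -natrD subnKC//.
  by rewrite -ltnS.
congr (_ + _).
  rewrite [RHS]big_ord_recl mul0r mul0r add0r.
  by apply: eq_bigr => c _; rewrite lift0 subSS.
rewrite [RHS]big_ord_recr/= subnn mul0r addr0.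
by apply: eq_bigr => c _; rewrite subSn 1?mulrCA// -ltnS.
Qed.

(** The hypotheses stop at order n, so that the rule can be used inside the
    induction that proves that an exponential is differentiable to all orders. *)
Lemma leibniz n f g :
  (forall b t, (b < n)%N -> derivable (dn b f) t e) ->
  (forall b t, (b < n)%N -> derivable (dn b g) t e) ->
  (forall b t, (b <= n)%N ->
    tc b (f \* g) t = \sum_(c < b.+1) tc c f t * tc (b - c) g t) /\
  (forall b t, (b < n)%N -> derivable (dn b (f \* g)) t e).
Proof.
move=> df dg.
have H b : (b <= n)%N ->
   forall t, tc b (f \* g) t = \sum_(c < b.+1) tc c f t * tc (b - c) g t.
  elim: b => [|b IH] bn t.
    by rewrite big_ord1 /tc fact0 !divr1.
  have bn' := ltnW bn.
  have E1 : tc b (f \* g) = \sum_(c < b.+1) (fun t => tc c f t * tc (b - c) g t).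
    by apply/funext => u; rewrite IH// fct_sumE.
  have D1 : is_derive t e (tc b (f \* g))
      (\sum_(c < b.+1) (c.+1%:R * tc c.+1 f t * tc (b - c)%N g t
         + tc c f t * ((b - c).+1%:R * tc (b - c).+1 g t))).
    rewrite E1; apply: is_derive_sum => c.
    have cb : (c <= b)%N by rewrite -ltnS.
    have Hf := is_derive_tc (df c t (leq_ltn_trans cb bn)).
    have Hg := is_derive_tc (dg (b - c)%N t (leq_ltn_trans (leq_subr _ _) bn)).
    have := @is_deriveM _ _ _ _ _ _ _ _ Hf Hg.
    move/is_derive_eq; apply.
    by rewrite /GRing.scale/= addrC; congr (_ + _); rewrite mulrC.
  have E2 : dn b (f \* g) = b`!%:R \*: tc b (f \* g).
    by apply/funext => u; rewrite dn_tc.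
  rewrite {1}/tc dnS /pderiv E2 deriveZ; last by case: D1.
  rewrite (@derive_val _ _ _ _ _ _ _ D1).
  rewrite (sum_shift_leibniz (fun c => tc c f t) (fun c => tc c g t)).
  set x := \sum_(c < _) _; rewrite /GRing.scale/= factS natrM.
  have := fact_neq0 b; have : b.+1%:R != 0 :> R by rewrite pnatr_eq0.
  by move: (b.+1%:R) (b`!%:R) => B F B0 F0; field; apply/andP.
split=> [b t bn|b t bn]; first exact: H.
have E2 : dn b (f \* g) = b`!%:R \*: \sum_(c < b.+1) (fun t => tc c f t * tc (b - c) g t).
  by apply/funext => u; rewrite dn_tc H ?(ltnW bn)// [RHS]/= fct_sumE.
rewrite E2; apply: derivableZ; apply: derivable_sum => c.
have cb : (c <= b)%N by rewrite -ltnS.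
have [Hf _] := is_derive_tc (df c t (leq_ltn_trans cb bn)).
have [Hg _] := is_derive_tc (dg (b - c)%N t (leq_ltn_trans (leq_subr _ _) bn)).
exact: derivableM.
Qed.

Definition nice f := [/\ exists K, forall t, `|f t| <= K,
  measurable_fun setT (f \o @vec_of_tuple R d) & periodic_fun f].

(** The regularity that is stable under sums, products and exponentials and
    that allows repeated integration by parts on the torus. *)
Definition tame f := forall b,
  (forall t, derivable (dn b f) t e) /\ nice (dn b f).

Lemma nice_ext f g : f =1 g -> nice f -> nice g.
Proof. by move=> /funext ->. Qed.

Lemma niceD f g : nice f -> nice g -> nice (f \+ g).
Proof.
move=> [[K fK] mf pf] [[L gL] mg pg]; split.
- by exists (K + L) => t; rewrite (le_trans (ler_normD _ _))// lerD.
- exact: measurable_funD.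
- by move=> t m /=; rewrite pf pg.
Qed.

Lemma niceM f g : nice f -> nice g -> nice (f \* g).
Proof.
move=> [[K fK] mf pf] [[L gL] mg pg]; split.
- by exists (K * L) => t; rewrite normrM ler_pM.
- exact: measurable_funM.
- by move=> t m /=; rewrite pf pg.
Qed.

Lemma nice_cst k : nice (cst k).
Proof. by split; [exists `|k| | exact: measurable_cst |]. Qed.

Lemma nice_sum n (h : 'I_n -> E -> R) : (forall c, nice (h c)) ->
  nice (fun t => \sum_(c < n) h c t).
Proof.
elim: n h => [|n IH] h nh.
  by apply: (nice_ext _ (nice_cst 0)) => t; rewrite big_ord0.
apply: (nice_ext _ (niceD (IH _ (fun c => nh (widen_ord (leqnSn n) c))) (nh ord_max))) => t.
by rewrite big_ord_recr.
Qed.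

Lemma nice_tc b f : nice (dn b f) <-> nice (tc b f).
Proof.
split=> H.
  by apply: (nice_ext _ (niceM (nice_cst (b`!%:R^-1)) H)) => t /=; rewrite /tc mulrC.
by apply: (nice_ext _ (niceM (nice_cst (b`!%:R)) H)) => t /=; rewrite dn_tc.
Qed.

Lemma tameM f g : tame f -> tame g -> tame (f \* g).
Proof.
move=> tf tg b.
have [H1 H2] := @leibniz b.+1 f g (fun b t _ => (tf b).1 t) (fun b t _ => (tg b).1 t).
split=> [t|]; first exact: H2.
apply/nice_tc; apply: (@nice_ext (fun t => \sum_(c < b.+1) tc c f t * tc (b - c) g t)).
  by move=> t; rewrite H1.
by apply: nice_sum => c; apply: niceM; apply/nice_tc; [apply: (tf c).2|apply: (tg (b - c)%N).2].
Qed.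

Lemma dn_cst b k : dn b (cst k) = cst (if b is 0 then k else 0).
Proof.
elim: b => [//|b IH]; rewrite dnS IH; apply/funext => t.
by rewrite /pderiv derive_cst.
Qed.

Lemma tame_cst k : tame (cst k).
Proof. by move=> b; rewrite dn_cst; split=> [t|]; [exact: derivable_cst|exact: nice_cst]. Qed.

Lemma dnD b f g : tame f -> tame g -> dn b (f \+ g) = dn b f \+ dn b g.
Proof.
move=> tf tg; elim: b => [//|b IH]; rewrite dnS IH; apply/funext => t.
by rewrite /pderiv deriveD//; [exact: (tf b).1|exact: (tg b).1].
Qed.

Lemma tameD f g : tame f -> tame g -> tame (f \+ g).
Proof.
move=> tf tg b; rewrite dnD//; split=> [t|].
  by apply: derivableD; [exact: (tf b).1|exact: (tg b).1].
by apply: niceD; [exact: (tf b).2|exact: (tg b).2].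
Qed.

Lemma dnZ b k f : tame f -> dn b (k \*: f) = k \*: dn b f.
Proof.
move=> tf; elim: b => [//|b IH]; rewrite dnS IH; apply/funext => t.
by rewrite /pderiv deriveZ//; exact: (tf b).1.
Qed.

Lemma tame_prod (I : Type) (r : seq I) (F : I -> E -> R) :
  (forall j, tame (F j)) -> tame (fun t => \prod_(j <- r) F j t).
Proof.
move=> tF; elim: r => [|j r IH].
  rewrite (_ : (fun _ => _) = cst 1); first exact: tame_cst.
  by apply/funext => t; rewrite big_nil.
rewrite (_ : (fun _ => _) = F j \* (fun t => \prod_(j <- r) F j t)); first exact: tameM.
by apply/funext => t; rewrite big_cons.
Qed.

End directional_jets.

Section exponential_jets.
Context {R : realType} {d : nat}.
Local Notation E := 'rV[R]_d.
Variable i : 'I_d.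
Local Notation e := (delta_mx 0 i : E).
Implicit Types f g S : E -> R.
Local Notation dn := (@dn R d i).
Local Notation tc := (@tc R d i).
Local Notation tame := (@tame R d i).

Lemma is_derive_exp_dir S t ds : is_derive t e S ds ->
  is_derive t e (expR \o S) (ds * expR (S t)).
Proof.
move=> [dS Sds].
have dS1 := (derivable1P _ _ _).1 dS.
have eS : S (0 *: e + t) = S t by rewrite scale0r add0r.
have dc : derivable ((fun h => S (h *: e + t)) : R -> R) 0 1 := dS1.
have de : derivable (@expR R) ((fun h => S (h *: e + t)) 0) 1 by exact: derivable_expR.
have E1 f : 'D_e f t = (fun h : R => f (h *: e + t))^`()%classic 0.
  rewrite derive1E /derive; set g1 := fun h => h^-1 *: _; set g2 := fun h => h^-1 *: _.
  suff -> : g1 = g2 by [].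
  by rewrite funeqE /g1 /g2 => h /=; rewrite addr0 scale0r add0r [_%:A]mulr1.
apply: DeriveDef.
  apply/derivable1P/derivable1_diffP.
  apply: (@differentiable_comp _ _ _ _ (fun h : R => S (h *: e + t)) (@expR R)); exact/derivable1_diffP.
rewrite E1 (derive1_comp dc de) -Sds (E1 S) mulrC; congr (_ * _).
by rewrite derive1E derive_val eS.
Qed.

Lemma dnSr b f : dn b.+1 f = dn b (pderiv i f).
Proof. exact: iterSr. Qed.

Lemma tc_pderiv b f t : tc b (pderiv i f) t = b.+1%:R * tc b.+1 f t.
Proof. by rewrite /tc -dnSr -succ_fact_cancel mulrC. Qed.

(** Taylor coefficients of an exponential, from g' = S' g and the Leibniz rule
    applied to this product. *)
Lemma exp_jet S : tame S ->
  (forall b t, derivable (dn b (expR \o S)) t e) /\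
  (forall b t, b.+1%:R * tc b.+1 (expR \o S) t =
     \sum_(c < b.+1) (c.+1%:R * tc c.+1 S t) * tc (b - c) (expR \o S) t).
Proof.
move=> tS; set g := expR \o S.
have dg : pderiv i g = pderiv i S \* g.
  apply/funext => t /=.
  have := is_derive_exp_dir (derivableP ((tS 0%N).1 t)).
  by move=> H; rewrite /pderiv (@derive_val _ _ _ _ _ _ _ H).
have dS' b t : derivable (dn b (pderiv i S)) t e by rewrite -dnSr; exact: (tS b.+1).1.
have H n : forall b t, (b < n.+1)%N -> derivable (dn b g) t e.
  elim: n => [|n IH] [|b] t // bn.
  - by have [] := is_derive_exp_dir (derivableP ((tS 0%N).1 t)).
  - by have [] := is_derive_exp_dir (derivableP ((tS 0%N).1 t)).
  - rewrite dnSr dg.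
    by apply: (leibniz (fun b t _ => dS' b t) IH).2.
split=> [b t|b t]; first exact: (H b).
rewrite -tc_pderiv dg (leibniz (n := b) (fun b t _ => dS' b t) (fun c t _ => H c c t (ltnSn c))).1//.
by apply: eq_bigr => c _; rewrite tc_pderiv.
Qed.

Lemma tame_exp S : tame S -> tame (expR \o S).
Proof.
move=> tS; have [dg tcg] := exp_jet tS.
have H n : forall b, (b < n.+1)%N -> nice (dn b (expR \o S)).
  elim: n => [|n IH] [|b] // bn.
  - have [_ [[K SK] mS pS]] := tS 0%N; split.
    + exists (expR K) => t /=; rewrite ger0_norm ?expR_ge0// ler_expR.
      by rewrite (le_trans (ler_norm _))//; exact: SK.
    + by apply: measurableT_comp.
    + by move=> t m; congr expR; exact: pS.
  - exact: IH.
  - apply/nice_tc.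
    apply: (@nice_ext _ _ (fun t => b.+1%:R^-1 *
      \sum_(c < b.+1) (c.+1%:R * tc c.+1 S t) * tc (b - c) (expR \o S) t)).
      by move=> t; rewrite -tcg mulKf// pnatr_eq0.
    apply: (niceM (nice_cst _)); apply: nice_sum => c.
    apply: niceM; first by apply: (niceM (nice_cst _)); apply/nice_tc; exact: (tS c.+1).2.
    by apply/nice_tc; apply: IH; rewrite ltnS (leq_trans (leq_subr _ _)).
by move=> b; split; [exact: dg|exact: (H b)].
Qed.

(** A Wiener-type norm of the N-jet at t, at the length scale 1/M. *)
Definition jnorm (M : R) (N : nat) f t : R := \sum_(b < N.+1) `|tc b f t| / M ^+ b.

Lemma jnorm_ge0 M N f t : 0 < M -> 0 <= jnorm M N f t.
Proof. by move=> M0; apply: sumr_ge0 => b _; rewrite divr_ge0// exprn_ge0// ltW. Qed.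

Lemma dn_le_jnorm M N f t : 0 < M -> `|dn N f t| <= N`!%:R * M ^+ N * jnorm M N f t.
Proof.
move=> M0; rewrite dn_tc normrM ger0_norm// -mulrA ler_wpM2l//.
rewrite /jnorm big_ord_recr/= mulrDr [X in _ <= _ + X]mulrCA divff ?mulr1; last first.
  by rewrite expf_neq0 ?gt_eqF.
by rewrite lerDr mulr_ge0 ?exprn_ge0 ?(ltW M0)// sumr_ge0// => b _;
  rewrite divr_ge0// exprn_ge0// ltW.
Qed.

Lemma norm_le_jnorm M N f t : 0 < M -> `|f t| <= jnorm M N f t.
Proof.
move=> M0; rewrite /jnorm big_ord_recl/= expr0 divr1 {1}/tc fact0 divr1 lerDl.
by rewrite sumr_ge0// => b _; rewrite divr_ge0// exprn_ge0// ltW.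
Qed.

Lemma cauchy_product_le (A B : nat -> R) N : (forall b, 0 <= A b) -> (forall b, 0 <= B b) ->
  \sum_(b < N.+1) \sum_(c < b.+1) A c * B (b - c)%N <=
  (\sum_(b < N.+1) A b) * (\sum_(b < N.+1) B b).
Proof.
move=> A0 B0.
rewrite -(big_mkord xpredT (fun b => \sum_(c < b.+1) A c * B (b - c)%N)).
under eq_bigr do rewrite -(big_mkord xpredT (fun c => A c * B (_ - c)%N)).
rewrite (eq_big_nat _ _ (F2 := fun b => \sum_(0 <= c < N.+1 | (c <= b)%N) A c * B (b - c)%N)); last first.
  move=> b /andP[_ bN]; rewrite (big_nat_widen _ _ _ _ _ bN).
  by apply: eq_bigl => c; rewrite ltnS.
rewrite (exchange_big_dep_nat xpredT)//= mulr_suml big_mkord; apply: ler_sum => c _.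
rewrite -mulr_sumr ler_wpM2l//.
rewrite -(big_mkord xpredT B).
have cN : (c <= N.+1)%N by rewrite ltnW.
rewrite (big_cat_nat (n := c)) //= big1_seq ?add0r; last first.
  by move=> b /andP[cb]; rewrite mem_index_iota => /andP[_ bc]; rewrite leqNgt bc in cb.
rewrite big_nat_cond (eq_bigl (fun b => (c <= b < N.+1)%N)); last first.
  by move=> b; case: (c <= b)%N => //; rewrite andbT.
rewrite -big_nat -{1}(add0n c) big_addn.
under eq_bigr do rewrite addnK.
rewrite [leRHS](big_cat_nat (n := (N.+1 - c)%N)) ?leq_subr//=.
by rewrite lerDl sumr_ge0.
Qed.

(** The jet of a product is a truncated Cauchy product. *)
Lemma jnormM M N f g t : 0 < M -> tame f -> tame g ->
  jnorm M N (f \* g) t <= jnorm M N f t * jnorm M N g t.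
Proof.
move=> M0 tf tg.
have M0' b : 0 <= M ^+ b by rewrite exprn_ge0// ltW.
have Mn0 : M != 0 by rewrite gt_eqF.
apply: le_trans (cauchy_product_le _ (A := fun b => `|tc b f t| / M ^+ b)
   (B := fun b => `|tc b g t| / M ^+ b) _ _); try by move=> b; rewrite divr_ge0.
apply: ler_sum => -[b bN] _ /=.
have [-> // _] := @leibniz _ _ i b f g (fun b t _ => (tf b).1 t) (fun b t _ => (tg b).1 t).
rewrite ler_pdivrMr ?exprn_gt0// mulr_suml.
apply: le_trans (ler_norm_sum _ _ _) _; apply: ler_sum => c _.
have cb : (c <= b)%N by rewrite -ltnS.
have -> : M ^+ b = M ^+ c * M ^+ (b - c) by rewrite -exprD subnKC.
rewrite normrM le_eqVlt; apply/orP; left; apply/eqP; field.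
by rewrite !expf_neq0.
Qed.

Lemma jnormD M N f g t : 0 < M -> tame f -> tame g ->
  jnorm M N (f \+ g) t <= jnorm M N f t + jnorm M N g t.
Proof.
move=> M0 tf tg; rewrite /jnorm -big_split/=; apply: ler_sum => b _.
rewrite -mulrDl ler_wpM2r ?invr_ge0 ?exprn_ge0 ?(ltW M0)//.
by rewrite /tc dnD//= mulrDl ler_normD.
Qed.

Lemma jnorm_cst M N k t : jnorm M N (cst k) t = `|k|.
Proof.
rewrite /jnorm big_ord_recl big1 ?addr0; first by rewrite /tc expr0 fact0 !divr1.
by move=> b _; rewrite /tc dn_cst mul0r normr0 mul0r.
Qed.

Lemma jnorm_prod M N (I : Type) (r : seq I) (F : I -> E -> R) t : 0 < M ->
  (forall j, tame (F j)) ->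
  jnorm M N (fun t => \prod_(j <- r) F j t) t <= \prod_(j <- r) jnorm M N (F j) t.
Proof.
move=> M0 tF; elim: r => [|j r IH].
  rewrite big_nil (_ : (fun _ => _) = cst 1) ?jnorm_cst ?normr1//.
  by apply/funext => u; rewrite big_nil.
rewrite (_ : (fun _ => _) = F j \* (fun t => \prod_(j <- r) F j t)); last first.
  by apply/funext => u; rewrite big_cons.
rewrite big_cons (le_trans (jnormM _ _ M0 _ _))//; first exact: tame_prod.
by rewrite ler_wpM2l// jnorm_ge0.
Qed.

(** By exp_jet the coefficient of order b+1 is a combination of lower ones with
    weights c tc_c(S), so raising the order by one costs at most one factor
    1 + sum_c c |tc_c S| M^-c. *)
Lemma jnorm_exp M N S t : 0 < M -> tame S ->
  jnorm M N (expR \o S) t <=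
  expR (S t) * (1 + \sum_(c < N) c.+1%:R * `|tc c.+1 S t| / M ^+ c.+1) ^+ N.
Proof.
move=> M0 tS; set W := \sum_(c < N) _.
have [_ rec] := exp_jet tS.
have M0' b : 0 <= M ^+ b by rewrite exprn_ge0// ltW.
have Mn0 : M != 0 by rewrite gt_eqF.
pose g := expR \o S.
have W0 : 0 <= W by apply: sumr_ge0 => c _; rewrite divr_ge0// mulr_ge0.
suff H b : (b <= N)%N -> jnorm M b g t <= expR (S t) * (1 + W) ^+ b by exact: H.
elim: b => [_|b IH bN].
  by rewrite /jnorm big_ord1 expr0 divr1 mulr1 /tc fact0 divr1 ger0_norm// expR_ge0.
rewrite /jnorm big_ord_recr/= -/(jnorm M b g t).
have J0 : 0 <= jnorm M b g t by exact: jnorm_ge0.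
apply: (@le_trans _ _ ((1 + W) * jnorm M b g t)); last first.
  by rewrite exprS mulrCA ler_wpM2l ?addr_ge0// IH// ltnW.
rewrite mulrDl mul1r lerD2l.
apply: (@le_trans _ _ (b.+1%:R * `|tc b.+1 g t| / M ^+ b.+1)).
  by rewrite -mulrA ler_peMl ?divr_ge0// ler1n.
rewrite -[b.+1%:R]ger0_norm// -normrM rec ler_pdivrMr ?exprn_gt0//.
apply: le_trans (ler_norm_sum _ _ _) _.
rewrite -mulrA /W [leRHS]mulr_suml.
rewrite -(big_mkord xpredT (fun c => c.+1%:R * `|tc c.+1 S t| / M ^+ c.+1 * (jnorm M b g t * M ^+ b.+1))).
rewrite (big_cat_nat (n := b.+1))//= big_mkord -[leLHS]addr0; apply: lerD; last first.
  apply: sumr_ge0 => c _; apply: mulr_ge0; first by rewrite divr_ge0// mulr_ge0.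
  by rewrite mulr_ge0.
apply: ler_sum => c _; have cb : (c <= b)%N by rewrite -ltnS.
rewrite normrM normrM ger0_norm// -!mulrA ler_wpM2l// ler_wpM2l//.
have -> : M ^+ b.+1 = M ^+ c.+1 * M ^+ (b - c) by rewrite -exprD addSn subnKC.
rewrite [leRHS](_ : _ = jnorm M b g t * M ^+ (b - c)); last first.
  by field; rewrite expf_neq0.
rewrite -ler_pdivrMr ?exprn_gt0//.
have cb' : (b - c < b.+1)%N by rewrite ltnS leq_subr.
rewrite /jnorm (bigD1 (Ordinal cb'))//= lerDl.
by apply: sumr_ge0 => a _; rewrite divr_ge0.
Qed.

End exponential_jets.

(** * Decay of Fourier coefficients *)

Section cube_integrals.
Context {R : realType} {d : nat}.
Local Notation E := 'rV[R]_d.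
Local Notation RR := (measurableTypeR R).
Local Notation Tup := (d.-tuple RR).
Local Notation leb := (@lebesgue_power R d).
Local Notation vec := (@vec_of_tuple R d).
Implicit Types f g : E -> R.

Definition tcube : set Tup := vec @^-1` (@cube R d).

Lemma vec_tshift (w : E) (s : Tup) : vec (tshift (fun j => w 0 j) s) = vec s + w.
Proof. by apply/rowP => j; rewrite !mxE tnth_mktuple. Qed.

Lemma measurable_vec_coord_halfopen (a b : R) j :
  measurable [set s : Tup | a <= vec s 0 j < b].
Proof.
rewrite (_ : mkset _ = setT `&` (fun s : Tup => vec s 0 j) @^-1` `[a, b[).
  by apply: measurable_vec_coord => //; exact: measurable_id.
by apply/seteqP; split => s /=; rewrite in_itv/=; [move=> ?; split|case].
Qed.

Lemma measurable_tcube : measurable tcube.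
Proof.
rewrite (_ : tcube = \bigcap_(i in [set: 'I_d]) [set s : Tup | - 2^-1 <= vec s 0 i < 2^-1]).
  by apply: fin_bigcap_measurable => // i _; exact: measurable_vec_coord_halfopen.
by apply/seteqP; split => s /= H; [move=> i _; exact: H|move=> i; exact: H].
Qed.

Lemma lebesgue_tcube_le1 : (leb tcube <= 1)%E.
Proof.
apply: (@le_trans _ _ (leb (tbox (fun _ => - 2^-1) (fun _ => 2^-1)))).
  apply: le_measure; rewrite ?inE//; [exact: measurable_tcube|exact: measurable_tbox|].
  by move=> s /= H i; have := H i; rewrite mxE => /andP[-> /ltW].
rewrite lebesgue_power_tbox; last by move=> _; lra.
rewrite big1 ?lee_fin// => i _; lra.
Qed.

Lemma bounded_integrable_tcube f K : (forall t, `|f t| <= K) ->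
  measurable_fun setT (f \o vec) -> leb.-integrable tcube (EFin \o (f \o vec)).
Proof.
move=> fK mf; apply: (@le_integrable _ _ _ _ _ _ _ (cst K%:E)) => //.
- exact: measurable_tcube.
- by apply/measurable_EFinP; exact: measurable_funTS.
- by move=> s _ /=; rewrite lee_fin (le_trans (fK _))// ler_norm.
- apply/integrableP; split; first exact: measurable_cst.
  rewrite integral_cst//=; last exact: measurable_tcube.
  by rewrite lte_mul_pinfty// (le_lt_trans lebesgue_tcube_le1)// ltry.
Qed.

Lemma nice_integrable f : nice f -> leb.-integrable tcube (EFin \o (f \o vec)).
Proof. by move=> [[K fK] mf _]; exact: (bounded_integrable_tcube fK). Qed.

Lemma measurable_vec_shift f (w : E) : measurable_fun setT (f \o vec) ->
  measurable_fun setT (fun s : Tup => f (vec s + w)).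
Proof.
move=> mf; rewrite (_ : (fun _ => _) = (f \o vec) \o tshift (fun j => w 0 j)).
  by apply: measurableT_comp => //; exact: measurable_tshift.
by apply/funext => s /=; rewrite vec_tshift.
Qed.

Lemma ge0_integral_vec_shift (w : E) f : measurable_fun setT (f \o vec) ->
  (forall t, 0 <= f t) ->
  (\int[leb]_s (f (vec s + w))%:E = \int[leb]_s (f (vec s))%:E)%E.
Proof.
move=> mf f0.
rewrite -(@ge0_integral_power_shift R d (fun j => w 0 j) (fun s => (f (vec s))%:E)).
- by apply: eq_integral => s _; rewrite vec_tshift.
- exact/measurable_EFinP.
- by move=> s; rewrite lee_fin.
Qed.

Section shift.
Variable i : 'I_d.
Local Notation e := (delta_mx 0 i : E).

Let icube (t : E) : bool := [forall j, - 2^-1 <= t 0 j < 2^-1].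

Let icubeP t : reflect (cube t) (icube t).
Proof. exact: forallP. Qed.

Let icube_shift h t : icube (t + h *: e) =
  (- 2^-1 <= t 0 i + h < 2^-1) && [forall j, (j != i) ==> (- 2^-1 <= t 0 j < 2^-1)].
Proof.
apply/forallP/andP => [H|[H1 /forallP H2] j].
  split; first by have := H i; rewrite !mxE !eqxx mulr1.
  apply/forallP => j; apply/implyP => ji; have := H j.
  by rewrite !mxE eqxx (negPf ji) mulr0 addr0.
rewrite !mxE eqxx; have [->|ji] := eqVneq j i; first by rewrite mulr1.
by rewrite mulr0 addr0; have /implyP := H2 j; apply.
Qed.

(** The part of the cube pushed out through the face t_i = 1/2 comes back,
    by periodicity, through the face t_i = -1/2. *)
Lemma ge0_integral_cube_shift f h : 0 < h < 1 ->
  measurable_fun setT (f \o vec) -> (forall t, 0 <= f t) -> periodic_fun f ->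
  (\int[leb]_(s in tcube) (f (vec s + h *: e))%:E =
   \int[leb]_(s in tcube) (f (vec s))%:E)%E.
Proof.
move=> /andP[h0 h1] mf f0 pf.
(* F1 lives on the image of the part of the cube that stays inside after the
   shift, and F2 on the image of the rest, brought back by one period. *)
pose F1 t := (icube t && (- 2^-1 + h <= t 0 i))%:R * f t.
pose F2 t := (icube t && (t 0 i < - 2^-1 + h))%:R * f t.
have F10 t : 0 <= F1 t by rewrite mulr_ge0.
have F20 t : 0 <= F2 t by rewrite mulr_ge0.
have fe t : f (t - e) = f t.
  rewrite -(pf t (- delta_mx 0 i)) intvecN; congr (f (_ - _)).
  by apply/rowP => j; rewrite !mxE; case: (_ && _).
have mco : measurable_fun setT (fun s : Tup => vec s 0 i).
  by apply: measurable_vec_coord; exact: measurable_id.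
have mC : measurable_fun setT (fun s : Tup => icube (vec s)).
  apply: (@measurable_fun_bool _ _ _ _ true).
  rewrite setTI (_ : _ @^-1` _ = tcube); first exact: measurable_tcube.
  by apply/seteqP; split => s /=; [move/icubeP|move/icubeP].
have mF1 : measurable_fun setT (F1 \o vec).
  apply: measurable_funM => //.
  apply: (@measurableT_comp _ _ _ _ _ _ (fun b : bool => b%:R : R)) => //.
  apply: measurable_and => //.
  exact: measurable_fun_ler.
have mF2 : measurable_fun setT (F2 \o vec).
  apply: measurable_funM => //.
  apply: (@measurableT_comp _ _ _ _ _ _ (fun b : bool => b%:R : R)) => //.
  apply: measurable_and => //.
  exact: measurable_fun_ltr.
transitivity (\int[leb]_s ((F1 (vec s + h *: e))%:E + (F2 (vec s + (h - 1) *: e))%:E))%E.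
  rewrite integral_mkcond; apply: eq_integral => s _.
  rewrite patchE -EFinD.
  have -> : (s \in tcube) = icube (vec s) by apply/idP/icubeP; rewrite inE.
  move: (vec s) => t.
  have fh : f (t + (h - 1) *: e) = f (t + h *: e).
    by rewrite scalerBl scale1r addrA fe.
  rewrite /F1 /F2 fh !icube_shift.
  have := icube_shift 0 t; rewrite scale0r !addr0 => ->.
  set Q := [forall j, _]; rewrite !mxE !eqxx !mulr1.
  have [tQ|] := boolP Q; last by rewrite !andbF !mul0r addr0.
  rewrite !andbT.
  have -> : (- 2^-1 <= t 0 i + h < 2^-1) && (- 2^-1 + h <= t 0 i + h) =
      (- 2^-1 <= t 0 i) && (t 0 i + h < 2^-1).
    by apply/idP/idP => [/andP[/andP[? ?] ?]|/andP[? ?]]; repeat (apply/andP; split); lra.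
  have -> : (- 2^-1 <= t 0 i + (h - 1) < 2^-1) && (t 0 i + (h - 1) < - 2^-1 + h) =
      (2^-1 <= t 0 i + h) && (t 0 i < 2^-1).
    by apply/idP/idP => [/andP[/andP[? ?] ?]|/andP[? ?]]; repeat (apply/andP; split); lra.
  have [A4|A4] := ltP (t 0 i + h) 2^-1; rewrite /= ?andbT ?andbF /= mul0r ?addr0 ?add0r.
    have -> : t 0 i < 2^-1 by lra.
    by case: leP => _; rewrite /= ?mul1r ?mul0r.
  have -> : - 2^-1 <= t 0 i by lra.
  by case: ltP => _; rewrite /= ?mul1r ?mul0r.
rewrite ge0_integralD//=; last 4 first.
- by move=> s _; rewrite lee_fin.
- by apply/measurable_EFinP; exact: (measurable_vec_shift (f := F1)).
- by move=> s _; rewrite lee_fin.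
- by apply/measurable_EFinP; exact: (measurable_vec_shift (f := F2)).
rewrite (ge0_integral_vec_shift _ (f := F1))// (ge0_integral_vec_shift _ (f := F2))//.
rewrite -ge0_integralD//=; last 4 first.
- by move=> s _; rewrite lee_fin.
- exact/measurable_EFinP.
- by move=> s _; rewrite lee_fin.
- exact/measurable_EFinP.
rewrite [RHS]integral_mkcond; apply: eq_integral => s _.
rewrite patchE -EFinD.
have -> : (s \in tcube) = icube (vec s) by apply/idP/icubeP; rewrite inE.
rewrite /F1 /F2; case: (icube _); rewrite /= ?mul0r ?addr0//.
by case: leP; rewrite ?mul0r ?mul1r ?addr0 ?add0r.
Qed.

Lemma integral_cube_shift f h : 0 < h < 1 -> nice f ->
  Rd_integral (@cube R d) (fun t => f (t + h *: e)) = Rd_integral (@cube R d) f.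
Proof.
move=> h01 nf; have [[K fK] mf pf] := nf.
have H := @ge0_integral_cube_shift (fun t => f t + K) h h01.
have iK : leb.-integrable tcube (EFin \o (cst K \o vec)) by exact: nice_integrable (nice_cst K).
have if1 : leb.-integrable tcube (EFin \o (f \o vec)) by exact: nice_integrable.
have if2 : leb.-integrable tcube (EFin \o ((fun t => f (t + h *: e)) \o vec)).
  apply: (bounded_integrable_tcube (K := K)) => //.
  exact: measurable_vec_shift.
have : (\int[leb]_(s in tcube) ((f (vec s + h *: e))%:E + K%:E) =
   \int[leb]_(s in tcube) ((f (vec s))%:E + K%:E))%E.
  apply: H.
  - by apply: measurable_funD => //; exact: measurable_cst.
  - by move=> t; have := fK t; rewrite ler_norml => /andP[+ _]; lra.
  - by move=> t m /=; rewrite pf.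
rewrite !integralD//=; try exact: measurable_tcube.
move=> H1; rewrite /Rd_integral /Rintegral; congr fine.
have KF : (\int[leb]_(s in tcube) K%:E)%E \is a fin_num.
  by apply: (integrable_fin_num _ iK); exact: measurable_tcube.
by move: H1 => /(congr1 (fun x => x - \int[leb]_(s in tcube) K%:E)%E); rewrite !addeK.
Qed.

Lemma is_derive_line f a (s : E) : derivable f (a *: e + s) e ->
  is_derive a 1 (fun h : R => f (h *: e + s)) (pderiv i f (a *: e + s)).
Proof.
have E1 : (fun h : R => h^-1 *: (f (h *: e + (a *: e + s)) - f (a *: e + s))) =
   (fun h : R => h^-1 *: (((fun h : R => f (h *: e + s)) \o shift a) (h *: 1) - f (a *: e + s))).
  by apply/funext => h /=; rewrite [_ *: 1]mulr1 scalerDl addrA.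
by move=> df; apply: DeriveDef; rewrite /derivable /pderiv /derive -E1.
Qed.

(** The integral of f (t + h e_i) over the cube does not depend on h;
    differentiate under the integral sign. *)
Lemma integral_cube_pderiv f : tame i f -> Rd_integral (@cube R d) (pderiv i f) = 0.
Proof.
move=> tf; have [df nf] := tf 0%N.
have [_ nf1] := tf 1%N; have [[K fK] mf1 pf1] := nf1.
have [[K0 fK0] mf0 _] := nf.
have Kge0 : 0 <= K := le_trans (normr_ge0 _) (fK 0).
have h12 : (0 < 2^-1 :> R) && (2^-1 < 1 :> R) by apply/andP; split; lra.
rewrite -[LHS](integral_cube_shift h12 nf1).
pose G (x : R) (s : Tup) := f (x *: e + vec s).
have dG (x : R) s : is_derive x 1 (G ^~ s) (pderiv i f (x *: e + vec s)).
  exact: is_derive_line.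
have I12 : `]0, 1[%classic (2^-1 : R) by rewrite /= in_itv.
have G1 x s : ((G ^~ s)^`()%classic x) = pderiv i f (x *: e + vec s).
  by rewrite derive1E (@derive_val _ _ _ _ _ _ _ (dG _ _)).
have iG (x : R) : `]0, 1[%classic x -> leb.-integrable tcube (EFin \o G x).
  move=> _; apply: (bounded_integrable_tcube (f := fun t => f (x *: e + t)) (K := K0)) => //.
  under eq_fun do rewrite /= addrC; exact: (measurable_vec_shift (f := f)).
have ddG (x : R) s : `]0, 1[%classic x -> tcube s -> derivable (G ^~ s) x 1.
  by move=> _ _; have [] := dG x s.
have bG (x : R) s : `]0, 1[%classic x -> tcube s -> `|partial1of2 G x s| <= K.
  by move=> _ _; rewrite /partial1of2 G1; exact: fK.
have iK : leb.-integrable tcube (EFin \o (fun=> K)) := nice_integrable (nice_cst K).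
have D := @differentiation_under_integral R _ _ leb G tcube measurable_tcube (2^-1) 0 1 I12
  iG ddG (fun=> K) (fun=> Kge0) iK bG.
have E1 : (fun x' => \int[leb]_(y in tcube) G x' y) =
   (fun x => Rd_integral (@cube R d) (fun t => f (t + x *: e))).
  by apply/funext => x; apply: eq_Rintegral => s _; rewrite /G addrC.
transitivity ((fun x' => \int[leb]_(y in tcube) G x' y)^`()%classic (2^-1)).
  rewrite D; apply: eq_Rintegral => s _.
  by rewrite /partial1of2 G1 addrC.
rewrite E1 derive1E.
rewrite (@near_eq_derive _ _ _ _ (cst (Rd_integral (@cube R d) f))) ?derive_cst//.
have : \forall x \near (2^-1 : R), x \in `]0, 1[ by exact: near_in_itvoo.
by apply: filterS => x; rewrite in_itv/= => x01; rewrite integral_cube_shift.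
Qed.

End shift.
End cube_integrals.

Section fourier_decay.
Context {R : realType} {d : nat}.
Local Notation E := 'rV[R]_d.
Local Notation leb := (@lebesgue_power R d).
Local Notation vec := (@vec_of_tuple R d).
Variables (i : 'I_d) (n : 'rV[int]_d).
Local Notation e := (delta_mx 0 i : E).
Implicit Types f g : E -> R.

Let lam : R := 2 * pi * (n 0 i)%:~R.

(** Real combinations of the real and imaginary parts of z^n: differentiation
    along e_i rotates (a, b) and multiplies it by 2 pi n_i. *)
Definition wave (a b : R) (t : E) : R := a * cos (phase n t) + b * sin (phase n t).

Lemma phase_line h (t : E) : phase n (h *: e + t) = phase n t + lam * h.
Proof.
rewrite /phase /lam -!mulrA -mulrDr -mulrDr; congr (_ * (_ * _)).
rewrite (bigD1 i)//= [X in _ = X + _](bigD1 i)//= !mxE !eqxx mulr1.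
rewrite (eq_bigr (fun j => (n 0 j)%:~R * t 0 j)); first by ring.
by move=> j ji; rewrite !mxE eqxx (negPf ji) mulr0 add0r.
Qed.

Lemma phase_periodic (t : E) m : exists k : int, phase n (t + intvec m) = 2 * pi * (phase n t / (2 * pi) + k%:~R).
Proof.
exists (\sum_j n 0 j * m 0 j).
have pi0 : pi != 0 :> R by rewrite gt_eqF// pi_gt0.
rewrite mulrDr mulrC divfK ?mulf_neq0// [phase n t]/phase -mulrDr; congr (_ * _).
rewrite (raddf_sum (intr : int -> R)) -big_split/=; apply: eq_bigr => j _.
by rewrite !mxE mulrDr intrM.
Qed.

Lemma continuous_phase : continuous (phase (R := R) n).
Proof.
move=> t; apply: (@continuous_comp _ _ _ (fun t : E => \sum_j (n 0 j)%:~R * t 0 j) (fun x : R => 2 * pi * x)).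
  rewrite (_ : (fun _ => _) = \sum_j (fun t : E => (n 0 j)%:~R * t 0 j)); last first.
    by apply/funext => u; rewrite fct_sumE.
  apply: (@big_ind _ (fun f : E -> R => {for t, continuous f})).
  - exact: cst_continuous.
  - by move=> f g cf cg; exact: continuousD.
  - move=> j _; apply: (@continuous_comp _ _ _ (fun u : E => u 0 j) (fun x : R => (n 0 j)%:~R * x)).
      exact: coord_continuous.
    exact: mulrl_continuous.
exact: mulrl_continuous.
Qed.

Lemma nice_wave a b : nice (wave a b).
Proof.
have c1 (x : R) : `|cos x| <= 1 by rewrite ler_norml cos_geN1 cos_le1.
have s1 (x : R) : `|sin x| <= 1 by rewrite ler_norml sin_geN1 sin_le1.
split.
- exists (`|a| + `|b|) => t; rewrite (le_trans (ler_normD _ _))// !normrM.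
  by apply: lerD; rewrite ler_piMr.
- apply: measurable_continuous_vec => t.
  apply: (@continuous_comp _ _ _ (phase (R := R) n) (fun x : R => a * cos x + b * sin x)).
    exact: continuous_phase.
  apply: continuousD; apply: continuousM; try exact: cst_continuous.
    exact: continuous_cos.
  exact: continuous_sin.
- move=> t m; rewrite /wave; have [k ->] := phase_periodic t m.
  have [-> ->] := cos_sinDz (phase n t / (2 * pi)) k.
  have -> // : 2 * pi * (phase n t / (2 * pi)) = phase n t.
  by rewrite mulrC divfK ?mulf_neq0// gt_eqF// pi_gt0.
Qed.

Lemma is_derive_wave a b (t : E) : is_derive t e (wave a b) (wave (lam * b) (- lam * a) t).
Proof.
have H (F F' : R -> R) : (forall x : R, is_derive x 1 F (F' x)) ->
   is_derive t e (F \o phase n) (lam * F' (phase n t)).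
  move=> dF.
  have dl : is_derive (0 : R) 1 (fun h : R => phase n t + lam * h) lam.
    have d1 := is_derive_cst (phase n t) (0 : R) (1 : R).
    have d2 := @is_deriveZ _ _ _ _ lam _ _ _ (is_derive_id (0 : R) (1 : R)).
    apply: (is_derive_eq (is_deriveD d1 d2)).
    by rewrite add0r /GRing.scale/= mulr1.
  have E1 : (fun h : R => (F \o phase n) (h *: e + t)) = F \o (fun h : R => phase n t + lam * h).
    by apply/funext => h /=; rewrite phase_line.
  have dc : derivable (F \o (fun h : R => phase n t + lam * h)) 0 1.
    by apply/derivable1_diffP/differentiable_comp; apply/derivable1_diffP;
      [case: dl|case: (dF (phase n t + lam * 0))].
  apply: DeriveDef; first by apply/derivable1P; rewrite E1.
  rewrite (_ : 'D_e _ t = (fun h : R => (F \o phase n) (h *: e + t))^`()%classic 0).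
    rewrite E1 derive1_comp; [|by case: dl|by case: (dF (phase n t + lam * 0))].
    rewrite !derive1E (@derive_val _ _ _ _ _ _ _ dl) (@derive_val _ _ _ _ _ _ _ (dF _)).
    by rewrite mulr0 addr0 mulrC.
  rewrite derive1E /derive; set g1 := fun h => h^-1 *: _; set g2 := fun h => h^-1 *: _.
  suff -> : g1 = g2 by [].
  by rewrite funeqE /g1 /g2 => h /=; rewrite addr0 scale0r add0r [_%:A]mulr1.
have dc := H _ _ (@is_derive_cos R).
have ds := H _ _ (@is_derive_sin R).
have -> : wave a b = a \*: (cos \o phase n) + b \*: (sin \o phase n) by [].
apply: (is_derive_eq (is_deriveD (is_deriveZ a dc) (is_deriveZ b ds))).
by rewrite /wave /GRing.scale/=; ring.
Qed.

Lemma tame_wave a b : tame i (wave a b).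
Proof.
move=> k; have [a' [b' ->]] : exists a' b', dn i k (wave a b) = wave a' b'.
  elim: k => [|k [a' [b' IH]]]; first by exists a, b.
  exists (lam * b'), (- lam * a'); rewrite dnS IH; apply/funext => t.
  by rewrite /pderiv (@derive_val _ _ _ _ _ _ _ (is_derive_wave _ _ _)).
split=> [t|]; first by case: (is_derive_wave a' b' t).
exact: nice_wave.
Qed.

Definition wcoef f a b : R := Rd_integral (@cube R d) (f \* wave a b).

Lemma Rd_integral_cubeD f g : nice f -> nice g ->
  Rd_integral (@cube R d) (f \+ g) = Rd_integral (@cube R d) f + Rd_integral (@cube R d) g.
Proof.
move=> nf ng; apply: RintegralD => //; first exact: measurable_tcube.
  exact: nice_integrable.
exact: nice_integrable.
Qed.

Lemma nice_tame f : tame i f -> nice f. Proof. by move=> /(_ 0%N)[]. Qed.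

Lemma tame_pderiv f : tame i f -> tame i (pderiv i f).
Proof. by move=> tf b; have := tf b.+1; rewrite dnSr. Qed.

(** Integration by parts, from the vanishing integral of the derivative of
    f times a wave. *)
Lemma wcoef_pderiv f a b : tame i f ->
  wcoef (pderiv i f) a b = wcoef f (- lam * b) (lam * a).
Proof.
move=> tf; have tw := tame_wave a b.
have := integral_cube_pderiv (tameM tf tw).
rewrite (_ : pderiv i (f \* wave a b) =
  (pderiv i f \* wave a b) \+ (f \* wave (lam * b) (- lam * a))); last first.
  apply/funext => t; rewrite /pderiv deriveM; [|exact: (tf 0%N).1|exact: (tw 0%N).1].
  rewrite (@derive_val _ _ _ _ _ _ _ (is_derive_wave _ _ _)) /= addrC.
  by rewrite /GRing.scale/= [X in X + _]mulrC.
rewrite Rd_integral_cubeD; last 2 first.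
- apply: niceM; [exact/nice_tame/tame_pderiv|exact: nice_wave].
- by apply: niceM; [exact: nice_tame|exact: nice_wave].
move/eqP; rewrite addr_eq0 => /eqP; rewrite /wcoef => ->.
have -> : f \* wave (- lam * b) (lam * a) = (cst (-1)) \* (f \* wave (lam * b) (- lam * a)).
  by apply/funext => t /=; rewrite /wave; ring.
rewrite [RHS](RintegralZl (-1)); [by rewrite mulN1r|exact: measurable_tcube|].
by apply: nice_integrable; apply: niceM; [exact: nice_tame|exact: nice_wave].
Qed.

Lemma wcoef_scale f l a b : nice f -> wcoef f (l * a) (l * b) = l * wcoef f a b.
Proof.
move=> nf; rewrite /wcoef.
have -> : f \* wave (l * a) (l * b) = (cst l) \* (f \* wave a b).
  by apply/funext => t /=; rewrite /wave; ring.
rewrite [LHS](RintegralZl l) //; first exact: measurable_tcube.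
by apply: nice_integrable; apply: niceM => //; exact: nice_wave.
Qed.

Lemma wcoef_dn N f : tame i f ->
  `|lam| ^+ N * (`|wcoef f 1 0| + `|wcoef f 0 1|) =
  `|wcoef (dn i N f) 1 0| + `|wcoef (dn i N f) 0 1|.
Proof.
elim: N f => [|N IH] f tf; first by rewrite mul1r.
have nf := nice_tame tf.
rewrite dnSr -IH; last exact: tame_pderiv.
rewrite !wcoef_pderiv// !mulr0 !mulr1.
have -> : wcoef f 0 lam = lam * wcoef f 0 1 by rewrite -wcoef_scale// mulr0 mulr1.
have -> : wcoef f (- lam) 0 = - lam * wcoef f 1 0 by rewrite -wcoef_scale// mulr0 mulr1.
by rewrite (normrM (- lam)) (normrM lam) normrN exprSr; ring.
Qed.

Lemma wcoef_le f a b : nice f -> `|a| + `|b| <= 1 ->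
  `|wcoef f a b| <= Rd_integral (@cube R d) (fun t => `|f t|).
Proof.
move=> nf ab; have [[K fK] mf _] := nf.
have ifw : leb.-integrable tcube (EFin \o ((f \* wave a b) \o vec)).
  by apply: nice_integrable; apply: niceM => //; exact: nice_wave.
apply: le_trans (le_normr_Rintegral measurable_tcube ifw) _.
apply: le_Rintegral; first exact: measurable_tcube.
- have [_ mw _] := nice_wave a b.
  have [[L wL] _ _] := niceM nf (nice_wave a b).
  apply: (bounded_integrable_tcube (f := fun t => `|(f \* wave a b) t|) (K := L)).
    by move=> t; rewrite normr_id.
  by apply: measurableT_comp => //; apply: measurable_funM.
- apply: (bounded_integrable_tcube (f := fun t => `|f t|) (K := K)).
    by move=> t; rewrite normr_id.
  by apply: measurableT_comp.
- move=> s _ /=; rewrite normrM ler_piMr// /wave.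
  rewrite (le_trans (ler_normD _ _))// !normrM (le_trans _ ab)// lerD// ler_piMr//.
  by rewrite ler_norml cos_geN1 cos_le1.
  by rewrite ler_norml sin_geN1 sin_le1.
Qed.

(** The factor 2 pi per derivative is dropped. *)
Lemma fourier_decay N f : tame i f ->
  `|(n 0 i)%:~R| ^+ N * (`|wcoef f 1 0| + `|wcoef f 0 1|) <=
  2 * Rd_integral (@cube R d) (fun t => `|dn i N f t|).
Proof.
move=> tf; apply: (@le_trans _ _ (`|lam| ^+ N * (`|wcoef f 1 0| + `|wcoef f 0 1|))).
  rewrite ler_wpM2r ?addr_ge0// lerXn2r ?nnegrE// /lam normrM ler_peMl//.
  rewrite ger0_norm ?mulr_ge0 ?pi_ge0//.
  have := pi_ge2 R; lra.
rewrite wcoef_dn// mulr_natl mulr2n.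
by apply: lerD; apply: wcoef_le; rewrite ?normr0 ?normr1 ?addr0 ?add0r//; exact: (tf N).2.
Qed.

End fourier_decay.

(** * Convolution with a compactly supported kernel *)

Section parameter_integrals.
Context {R : realType} {d : nat}.
Local Notation E := 'rV[R]_d.
Local Notation RR := (measurableTypeR R).
Local Notation Tup := (d.-tuple RR).
Local Notation leb := (@lebesgue_power R d).
Local Notation vec := (@vec_of_tuple R d).

(** The positive and negative parts are integrated separately, by Tonelli. *)
Lemma measurable_Rintegral_param {d'} {A : measurableType d'} (B : set Tup) (F : A * Tup -> R) :
  measurable B -> measurable_fun setT F ->
  measurable_fun setT (fun a => \int[leb]_(s in B) F (a, s)).
Proof.
move=> mB mF.
pose G := (fun x : A * Tup => (F x)%:E) \_ (setT `*` B).
have mG : measurable_fun setT G.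
  apply/(measurable_restrictT _ _).1; first exact: measurableX.
  by apply/measurable_EFinP; exact: measurable_funTS.
have E1 a : (\int[leb]_(s in B) (F (a, s))%:E = \int[leb]_s G (a, s))%E.
  rewrite integral_mkcond; apply: eq_integral => s _; rewrite /G !patchE.
  case: ifPn => h1; case: ifPn => h2 //; exfalso.
    by move: h1 h2; rewrite inE notin_setE => Bs; apply; split.
  by move: h1 h2; rewrite notin_setE inE => nBs -[_ /nBs].
rewrite /Rintegral; apply: (measurableT_comp (fine_measurable measurableT)) => //.
under eq_fun do rewrite E1 integralE.
apply: emeasurable_funB.
- rewrite (_ : (fun _ => _) = fubini_F leb (G^\+)%E); last first.
    by apply/funext => a; apply: eq_integral => s _; rewrite ?funeposE ?funenegE.
  apply: measurable_fun_fubini_tonelli_F; first exact: measurable_funepos.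
  by move=> x; exact: funepos_ge0.
- rewrite (_ : (fun _ => _) = fubini_F leb (G^\-)%E); last first.
    by apply/funext => a; apply: eq_integral => s _; rewrite ?funeposE ?funenegE.
  apply: measurable_fun_fubini_tonelli_F; first exact: measurable_funeneg.
  by move=> x; exact: funeneg_ge0.
Qed.

Lemma real_integral_vec_shift (w : E) (f : E -> R) : measurable_fun setT (f \o vec) ->
  \int[leb]_s f (vec s + w) = \int[leb]_s f (vec s).
Proof.
move=> mf; rewrite /Rintegral; congr fine.
rewrite integralE [RHS]integralE; congr (_ - _)%E.
- rewrite (_ : _ ^\+%E = fun s => (Num.max (f (vec s + w)) 0)%:E); last first.
    by apply/funext => s; rewrite funeposE -EFin_max.
  rewrite (_ : _ ^\+%E = fun s => (Num.max (f (vec s)) 0)%:E); last first.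
    by apply/funext => s; rewrite funeposE -EFin_max.
  apply: (ge0_integral_vec_shift w (f := fun t => Num.max (f t) 0)).
    exact: measurable_maxr.
  by move=> t; rewrite le_max lexx orbT.
- rewrite (_ : _ ^\-%E = fun s => (Num.max (- f (vec s + w)) 0)%:E); last first.
    by apply/funext => s; rewrite funenegE -EFinN -EFin_max.
  rewrite (_ : _ ^\-%E = fun s => (Num.max (- f (vec s)) 0)%:E); last first.
    by apply/funext => s; rewrite funenegE -EFinN -EFin_max.
  apply: (ge0_integral_vec_shift w (f := fun t => Num.max (- f t) 0)).
    by apply: measurable_maxr => //; exact: measurableT_comp.
  by move=> t; rewrite le_max lexx orbT.
Qed.

Lemma compact_box (r : R) : compact [set t : E | forall j, `[- r, r]%classic (t ord0 j)].
Proof. by apply: (@rV_compact R d (fun=> `[- r, r]%classic)) => j; exact: segment_compact. Qed.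

Lemma continuous_bounded_box (f : E -> R) (r : R) : continuous f ->
  exists K, forall t : E, (forall j, `|t 0 j| <= r) -> `|f t| <= K.
Proof.
move=> cf.
have [M [_ HM]] : bounded_set (f @` [set t : E | forall j, `[- r, r]%classic (t ord0 j)]).
  apply: compact_bounded; apply: continuous_compact; last exact: compact_box.
  exact: continuous_subspaceT.
exists (M + 1) => t tr.
apply: (HM (M + 1)) => /=; first by rewrite ltrDl.
by exists t => // j; rewrite /= in_itv/= -ler_norml.
Qed.

Lemma continuous_periodic_nice (f : E -> R) : continuous f -> periodic_fun f -> nice f.
Proof.
move=> cf pf; split => //; last exact: measurable_continuous_vec.
have [K HK] := continuous_bounded_box 1 cf; exists K => t.
rewrite -(pf t (reduce t)); apply: HK => j.
have := cube_reduce t j => /andP[a b]; rewrite ler_norml; apply/andP; split; lra.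
Qed.

(** Off the closure of its support f vanishes near t, so all its derivatives
    vanish at t. *)
Lemma dn_support (i : 'I_d) b (f : E -> R) t : dn i b f t != 0 -> closure [set u | f u != 0] t.
Proof.
move=> H; apply: contrapT => nc; move/negP: H; apply; apply/eqP.
have oC : open (~` closure [set u | f u != 0]) by rewrite openC; exact: closed_closure.
elim: b t nc => [|b IH] t nc.
  by apply: contrapT => /eqP ft; apply: nc; exact: subset_closure.
rewrite dnS /pderiv (@near_eq_derive _ _ _ _ (cst 0)) ?derive_cst//.
have : nbhs t (~` closure [set u | f u != 0]) by exact: open_nbhs_nbhs.
by apply: filterS => u /IH.
Qed.

Lemma enorm_coord (u : E) j : `|u 0 j| <= enorm u.
Proof.
rewrite /enorm -sqrtr_sqr ler_wsqrtr// (bigD1 j)//= lerDl.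
by apply: sumr_ge0 => k _; rewrite sqr_ge0.
Qed.

Lemma dn_smooth (i : 'I_d) b (f : E -> R) : smooth f ->
  continuous (dn i b f) /\ forall t, derivable (dn i b f) t (delta_mx 0 i).
Proof.
move=> sf; have [cf df] := sf (nseq b i).
have -> : dn i b f = foldr pderiv f (nseq b i).
  by elim: b {cf df} => [//|b IH]; rewrite dnS IH.
by split => // t.
Qed.

Lemma derive_scale (i : 'I_d) (f : E -> R) (c : R) (t : E) :
  derivable f (c *: t) (delta_mx 0 i) ->
  is_derive t (delta_mx 0 i) (fun u => f (c *: u)) (c * pderiv i f (c *: t)).
Proof.
set e := (delta_mx 0 i : E) => df.
have E0 : c *: t = 0 *: e + c *: t by rewrite scale0r add0r.
have dF : is_derive (c * 0 : R) 1 (fun h : R => f (h *: e + c *: t)) (pderiv i f (c *: t)).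
  rewrite mulr0 [in pderiv _ _ _]E0; apply: is_derive_line; by rewrite -E0.
have dl : is_derive (0 : R) 1 (fun h : R => c * h) c.
  have d2 := @is_deriveZ _ _ _ _ c _ _ _ (is_derive_id (0 : R) (1 : R)).
  by apply: (is_derive_eq d2); rewrite /GRing.scale/= mulr1.
have E1 : (fun h : R => f (c *: (h *: e + t))) = (fun h : R => f (h *: e + c *: t)) \o (fun h => c * h).
  by apply/funext => h /=; rewrite scalerDr scalerA.
have dc : derivable ((fun h : R => f (h *: e + c *: t)) \o (fun h => c * h)) 0 1.
  apply/derivable1_diffP; apply: differentiable_comp; apply/derivable1_diffP; first by case: dl.
  by case: dF.
apply: DeriveDef; first by apply/derivable1P; rewrite E1.
transitivity ((fun h : R => f (c *: (h *: e + t)))^`()%classic 0).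
  rewrite derive1E /derive; set g1 := fun h => h^-1 *: _; set g2 := fun h => h^-1 *: _.
  suff -> : g1 = g2 by [].
  by rewrite funeqE /g1 /g2 => h /=; rewrite addr0 scale0r add0r [_%:A]mulr1.
rewrite E1 derive1_comp; [|by case: dl|by case: dF].
by rewrite !derive1E (@derive_val _ _ _ _ _ _ _ dl) (@derive_val _ _ _ _ _ _ _ dF) mulrC.
Qed.

Definition test_kernel (i : 'I_d) (r : R) (q : E -> R) := forall b,
  [/\ continuous (dn i b q), forall t, derivable (dn i b q) t (delta_mx 0 i) &
   forall (u : E) j, r < `|u 0 j| -> dn i b q u = 0].

Lemma test_kernel_bounded i r q b : test_kernel i r q ->
  exists2 K, 0 <= K & forall u, `|dn i b q u| <= K.
Proof.
move=> tq; have [cq _ sq] := tq b.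
have [K HK] := continuous_bounded_box r cq.
exists `|K|; first exact: normr_ge0.
move=> u; have [H|/existsNP[j /negP]] := pselect (forall j, `|(u : E) 0 j| <= r).
  by rewrite (le_trans (HK _ H))// ler_norm.
by rewrite -ltNge => /sq ->; rewrite normr0.
Qed.

Lemma smooth_test_kernel i (Q : E -> R) : smooth Q -> supported_in_unit_ball Q ->
  test_kernel i 1 Q.
Proof.
move=> sQ uQ b; have [cQ dQ] := dn_smooth i b sQ; split => // u j uj.
apply: contrapT => /eqP /dn_support /uQ /= ; apply/negP; rewrite -ltNge.
exact: lt_le_trans (enorm_coord u j).
Qed.

Definition rescale (e : R) (Q : E -> R) (u : E) : R := e ^- d * Q (e^-1 *: u).

Lemma dn_rescale i e Q : smooth Q -> forall b, dn i b (rescale e Q) =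
  (fun u => e ^- (d + b) * dn i b Q (e^-1 *: u)).
Proof.
move=> sQ; elim=> [|b IH]; first by rewrite addn0.
rewrite dnS IH; apply/funext => u; have [_ dQ] := dn_smooth i b sQ.
have H := is_deriveZ (e ^- (d + b)) (derive_scale (dQ (e^-1 *: u))).
rewrite /pderiv (@derive_val _ _ _ _ _ _ _ H) /GRing.scale/=.
by rewrite mulrA -!exprVn addnS exprSr.
Qed.

Lemma rescale_test_kernel i e (Q : E -> R) : 0 < e -> smooth Q -> supported_in_unit_ball Q ->
  test_kernel i e (rescale e Q).
Proof.
move=> e0 sQ uQ b; rewrite dn_rescale//.
have [cQ dQ sQ1] := smooth_test_kernel i sQ uQ b; split.
- move=> u; apply: (@continuous_comp _ _ _ (fun u : E => dn i b Q (e^-1 *: u)) (fun x : R => e ^- (d + b) * x)); last exact: mulrl_continuous.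
  apply: (@continuous_comp _ _ _ (fun u : E => e^-1 *: u) (dn i b Q)); last exact: cQ.
  exact: scaler_continuous.
- by move=> t; have [] := is_deriveZ (e ^- (d + b)) (derive_scale (dQ (e^-1 *: t))).
- move=> u j uj; rewrite (sQ1 _ j) ?mulr0// mxE normrM gtr0_norm ?invr_gt0//.
  by rewrite mulrC ltr_pdivlMr// mul1r.
Qed.

Lemma rescale_bound i (Q : E -> R) : smooth Q -> supported_in_unit_ball Q -> forall b,
  exists2 K, 0 <= K & forall e u, 0 < e -> `|dn i b (rescale e Q) u| <= K * e ^- (d + b).
Proof.
move=> sQ uQ b; have [K K0 HK] := test_kernel_bounded b (smooth_test_kernel i sQ uQ).
exists K => // e u e0; rewrite dn_rescale// normrM (@gtr0_norm _ (e ^- _)) ?invr_gt0 ?exprn_gt0// mulrC.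
by rewrite ler_wpM2r// invr_ge0 exprn_ge0// ltW.
Qed.

(** If Q did not vanish at u, then by continuity it would not vanish at
    (1 + h) u for small h > 0, which lies outside the unit ball. *)
Lemma vanish_off_open_cube (Q : E -> R) (u : E) j : continuous Q -> supported_in_unit_ball Q -> 1 <= `|u 0 j| -> Q u = 0.
Proof.
move=> cQ uQ uj; apply: contrapT => /eqP Qu.
have cg : {for (0 : R), continuous (fun h : R => Q (h *: u + u))}.
  apply: (@continuous_comp _ _ _ (fun h : R => h *: u + u) Q); last exact: cQ.
  by apply: (@continuousD _ _ _ (fun h : R => h *: u) (cst u)); [exact: scalel_continuous|exact: cst_continuous].
have nz : \forall h \near (0 : R), Q (h *: u + u) != 0.
  have cg' : Q (h *: u + u) @[h --> (0 : R)] --> Q u.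
    rewrite -[X in _ --> X](_ : Q (0 *: u + u) = Q u); first exact: cg.
    by rewrite scale0r add0r.
  have : nbhs (Q u) [set x | x != 0].
    by apply: open_nbhs_nbhs; split => //; exact: open_neq.
  exact: cg'.
have : \forall h \near (0 : R)^'+, Q (h *: u + u) != 0 by exact: cvg_at_right_filter nz.
move=> nzr.
have [h [h0 hQ]] : exists h : R, 0 < h /\ Q (h *: u + u) != 0.
  near (0 : R)^'+ => h; exists h; split; first by near: h; exact: nbhs_right_gt.
  by near: h.
have /uQ /= : closure [set t | Q t != 0] (h *: u + u) by exact: subset_closure.
apply/negP; rewrite -ltNge (lt_le_trans _ (enorm_coord _ j))//.
rewrite !mxE (_ : _ + _ = (h + 1) * u 0 j); last by ring.
rewrite normrM gtr0_norm ?addr_gt0//.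
apply: (@lt_le_trans _ _ (h + 1)); first by rewrite ltrDr.
by rewrite ler_peMr// addr_ge0// ltW.
Unshelve. all: by end_near. Qed.

End parameter_integrals.

Section convolution.
Context {R : realType} {d : nat}.
Local Notation E := 'rV[R]_d.
Local Notation RR := (measurableTypeR R).
Local Notation Tup := (d.-tuple RR).
Local Notation leb := (@lebesgue_power R d).
Local Notation vec := (@vec_of_tuple R d).

Definition box (r : R) : set Tup := tbox (fun=> - r) (fun=> r).

Lemma measurable_box r : measurable (box r). Proof. exact: measurable_tbox. Qed.

Lemma lebesgue_box r : 0 <= r -> leb (box r) = ((2 * r) ^+ d)%:E.
Proof.
move=> r0; rewrite lebesgue_power_tbox; last by move=> _; lra.
by congr EFin; rewrite prodr_const card_ord; congr (_ ^+ _); ring.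
Qed.

Lemma not_box r s : ~ box r s -> exists j, r < `|vec s 0 j|.
Proof.
move=> /existsNP[j /negP H]; exists j; move: H; rewrite mxE.
by rewrite -ler_norml -ltNge.
Qed.

Lemma box_integrable r (f : Tup -> R) K : 0 <= r -> measurable_fun setT f ->
  (forall s, box r s -> `|f s| <= K) -> leb.-integrable (box r) (EFin \o f).
Proof.
move=> r0 mf fK; apply: (@le_integrable _ _ _ _ _ _ _ (cst K%:E)) => //.
- exact: measurable_box.
- by apply/measurable_EFinP; exact: measurable_funTS.
- by move=> s bs /=; rewrite lee_fin (le_trans (fK _ bs))// ler_norm.
- apply/integrableP; split; first exact: measurable_cst.
  rewrite integral_cst//=; last exact: measurable_box.
  by rewrite lebesgue_box// ltry.
Qed.

Lemma integrable_box_indic r K : 0 <= r -> leb.-integrable setT (fun s => (K * \1_(box r) s)%:E).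
Proof.
move=> r0; under eq_fun do rewrite EFinM.
apply: integrableZl => //; apply/integrableP; split.
  by apply/measurable_EFinP; apply: measurable_indic; exact: measurable_box.
under eq_integral do rewrite gee0_abs ?lee_fin//.
rewrite integral_indic//; last exact: measurable_box.
by rewrite setIT [X in (X < _)%E](lebesgue_box r0) ltry.
Qed.

Lemma box_supported_integrable r (f : Tup -> R) K : 0 <= r -> measurable_fun setT f ->
  (forall s, `|f s| <= K * \1_(box r) s) -> leb.-integrable setT (EFin \o f).
Proof.
move=> r0 mf fK; apply: (le_integrable measurableT _ _ (integrable_box_indic K r0)).
- exact/measurable_EFinP.
- by move=> s _ /=; rewrite lee_fin (le_trans (fK s))// ler_norm.
Qed.

Lemma Rintegral_cst_box r c : 0 <= r -> \int[leb]_(s in box r) (cst c s) = c * (2 * r) ^+ d.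
Proof.
move=> r0; rewrite Rintegral_cst; last exact: measurable_box.
by congr (_ * _); exact: (congr1 fine (lebesgue_box r0)).
Qed.

Definition conv (q eta : E -> R) (t : E) : R := \int[leb]_s (q (vec s) * eta (t - vec s)).

Definition local_avg (r : R) (eta : E -> R) (t : E) : R :=
  (2 * r) ^- d * \int[leb]_(s in box r) `|eta (t - vec s)|.

Section fixed_kernel.
Variables (i : 'I_d) (r : R) (q eta : E -> R).
Hypothesis r0 : 0 < r.
Hypothesis tq : test_kernel i r q.
Hypothesis ceta : continuous eta.
Hypothesis peta : periodic_fun eta.
Local Notation e := (delta_mx 0 i : E).

Let neta : nice eta := continuous_periodic_nice ceta peta.

Lemma measurable_path_shift {d'} {A : measurableType d'} (w : A -> E) :
  (forall j, measurable_fun setT (fun a => w a 0 j)) ->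
  measurable_fun setT (fun a => eta (w a)).
Proof.
by move=> mw; apply: (@measurable_fun_caratheodory _ _ _ A w (fun x _ => eta x)).
Qed.

Let measurable_eta_sub t : measurable_fun setT (fun s : Tup => eta (t - vec s)).
Proof.
apply: (measurable_path_shift (w := fun s => t - vec s)) => j.
under eq_fun do rewrite !mxE; apply: measurable_funB => //.
exact: measurable_tnth.
Qed.

Let dnq0 b u j : r < `|(u : E) 0 j| -> dn i b q u = 0.
Proof. by have [_ _ H] := tq b; exact: H. Qed.

Let measurable_dnq b : measurable_fun setT (dn i b q \o vec).
Proof. by have [H _ _] := tq b; exact: measurable_continuous_vec. Qed.

Lemma conv_integrand_bound b : exists2 K, 0 <= K &
  forall t (x : R) s, -1 < x < 1 ->
    `|dn i b q (vec s + x *: e) * eta (t - vec s)| <= K * \1_(box (r + 1)) s.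
Proof.
have [K K0 HK] := test_kernel_bounded b tq; have [[L HL] _ _] := neta.
have L0 : 0 <= L := le_trans (normr_ge0 _) (HL 0).
exists (K * L); first exact: mulr_ge0.
move=> t x s /andP[x1 x2]; rewrite indicE; case: (boolP (s \in _)) => [_|].
  by rewrite mulr1 normrM ler_pM.
rewrite notin_setE => /not_box[j jr].
rewrite (dnq0 b (j := j)); first by rewrite mul0r normr0 mulr0.
have -> : (vec s + x *: e) 0 j = vec s 0 j + x * (j == i)%:R by rewrite !mxE eqxx.
set c := (_ == _)%:R; have cx : `|x * c| < 1.
  by rewrite /c; case: (_ == _); rewrite ?mulr0 ?normr0// mulr1 ltr_norml x1.
have := lerB_normD (vec s 0 j) (x * c); lra.
Qed.

(** Moving the increment h from the path to the kernel, by translation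
    invariance: only the kernel is smooth. *)
Lemma conv_shift b t (h : R) : conv (dn i b q) eta (h *: e + t) =
  \int[leb]_s (dn i b q (vec s + h *: e) * eta (t - vec s)).
Proof.
pose f u := dn i b q u * eta (h *: e + t - u).
rewrite /conv -(@real_integral_vec_shift _ _ (h *: e) f).
  apply: eq_Rintegral => s _; rewrite /f; congr (_ * eta _).
  by rewrite opprD [X in _ + X]addrC addrACA subrr add0r.
exact: (measurable_funM (measurable_dnq b) (measurable_eta_sub (h *: e + t))).
Qed.

(** Differentiation under the integral sign, after conv_shift. *)
Lemma is_derive_conv b t : is_derive t e (conv (dn i b q) eta) (conv (dn i b.+1 q) eta t).
Proof.
pose G (x : R) (s : Tup) := dn i b q (vec s + x *: e) * eta (t - vec s).
have [K K0 HK] := conv_integrand_bound b.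
have [K' K'0 HK'] := conv_integrand_bound b.+1.
have r10 : 0 <= r + 1 by rewrite addr_ge0// ltW.
have [_ dq _] := tq b.
have dG (x : R) s : is_derive x 1 (G ^~ s) (dn i b.+1 q (vec s + x *: e) * eta (t - vec s)).
  have H := is_derive_line (f := dn i b q) (a := x) (s := vec s) (dq _).
  have H2 := is_deriveZ (eta (t - vec s)) H.
  rewrite (_ : _ \*: _ = G ^~ s) in H2; last by apply/funext => y; rewrite /G /= mulrC (addrC (y *: e)).
  by apply: (is_derive_eq H2); rewrite /GRing.scale/= mulrC (addrC (x *: e)).
have G1 (x : R) s : (G ^~ s)^`()%classic x = dn i b.+1 q (vec s + x *: e) * eta (t - vec s).
  by rewrite derive1E (@derive_val _ _ _ _ _ _ _ (dG _ _)).
have mG (x : R) c : measurable_fun setT (fun s => dn i c q (vec s + x *: e) * eta (t - vec s)).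
  by apply: measurable_funM => //; exact: (measurable_vec_shift (f := dn i c q)).
have iG (x : R) : `]-1, 1[%classic x -> leb.-integrable setT (EFin \o G x).
  rewrite /= in_itv/= => x1; apply: (box_supported_integrable (r := r + 1) (K := K)) => //.
    exact: mG.
  by move=> s; exact: HK.
have ddG (x : R) (s : Tup) : `]-1, 1[%classic x -> setT s -> derivable (G ^~ s) x 1.
  by move=> _ _; have [] := dG x s.
have bG (x : R) s : `]-1, 1[%classic x -> setT s -> `|partial1of2 G x s| <= K' * \1_(box (r + 1)) s.
  by rewrite /= in_itv/= => x1 _; rewrite /partial1of2 G1; exact: HK'.
have g0 s : 0 <= K' * \1_(box (r + 1)) s by rewrite mulr_ge0.
have iK : leb.-integrable setT (EFin \o (fun s => K' * \1_(box (r + 1)) s)) := integrable_box_indic K' r10.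
have I0 : `]-1, 1[%classic (0 : R) by rewrite /= in_itv/=; apply/andP; split; lra.
have E1 : (fun h : R => conv (dn i b q) eta (h *: e + t)) = (fun x => \int[leb]_y G x y).
  by apply/funext => h; rewrite conv_shift.
have D1 := @differentiation_under_integral R _ _ leb G setT measurableT 0 (-1) 1 I0
  iG ddG _ g0 iK bG.
have D2 := @derivable_under_integral R _ _ leb G setT measurableT 0 (-1) 1 I0
  iG ddG _ g0 iK bG.
apply: DeriveDef; first by apply/derivable1P; rewrite E1.
transitivity ((fun h : R => conv (dn i b q) eta (h *: e + t))^`()%classic 0).
  rewrite derive1E /derive; set g1 := fun h => h^-1 *: _; set g2 := fun h => h^-1 *: _.
  suff -> : g1 = g2 by [].
  by rewrite funeqE /g1 /g2 => h /=; rewrite addr0 scale0r add0r [_%:A]mulr1.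
rewrite E1 D1; apply: eq_Rintegral => s _; rewrite /partial1of2 G1.
by rewrite scale0r addr0.
Qed.

Lemma dn_conv b : dn i b (conv q eta) = conv (dn i b q) eta.
Proof.
elim: b => [//|b IH]; rewrite dnS IH; apply/funext => t.
by rewrite /pderiv (@derive_val _ _ _ _ _ _ _ (is_derive_conv _ _)).
Qed.

(** The kernel is supported in the box on which the average is taken. *)
Lemma conv_le b K t : (forall u, `|dn i b q u| <= K) ->
  `|conv (dn i b q) eta t| <= K * (2 * r) ^+ d * local_avg r eta t.
Proof.
move=> HK; have K0 : 0 <= K := le_trans (normr_ge0 _) (HK 0).
have [[L HL] _ _] := neta; have r0' := ltW r0.
have L0 : 0 <= L := le_trans (normr_ge0 _) (HL 0).
have Eb : conv (dn i b q) eta t = \int[leb]_(s in box r) (dn i b q (vec s) * eta (t - vec s)).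
  rewrite /conv /Rintegral; congr fine; rewrite [RHS]integral_mkcond.
  apply: eq_integral => s _; rewrite patchE; case: ifPn => //.
  by rewrite notin_setE => /not_box[j /dnq0 ->]; rewrite mul0r.
have m1 : measurable_fun setT (fun s => dn i b q (vec s) * eta (t - vec s)).
  exact: (measurable_funM (measurable_dnq b) (measurable_eta_sub t)).
have mn : measurable_fun setT (fun s : Tup => `|eta (t - vec s)|).
  exact: (measurableT_comp _ (measurable_eta_sub t)).
have i1 : leb.-integrable (box r) (EFin \o (fun s => dn i b q (vec s) * eta (t - vec s))).
  by apply: (box_integrable (K := K * L)) => // s _; rewrite normrM ler_pM.
rewrite Eb (le_trans (le_normr_Rintegral (measurable_box r) i1))//.
have i2 : leb.-integrable (box r) (EFin \o (fun s => `|eta (t - vec s)|)).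
  by apply: (box_integrable (K := L)) => // s _; rewrite normr_id.
rewrite /local_avg mulrA mulfK; last by rewrite expf_neq0// mulf_neq0 ?gt_eqF.
rewrite -RintegralZl//; last exact: measurable_box.
apply: le_Rintegral; first exact: measurable_box.
- apply: (box_integrable (f := fun s => `|dn i b q (vec s) * eta (t - vec s)|) (K := K * L)) => //.
    exact: measurableT_comp.
  by move=> s _; rewrite normr_id normrM ler_pM.
- apply: (box_integrable (f := fun s => K * `|eta (t - vec s)|) (K := K * L)) => //.
    exact: measurable_funM.
  by move=> s _; rewrite normrM normr_id ger0_norm// ler_wpM2l.
- by move=> s _; rewrite normrM ler_wpM2r.
Qed.

Lemma local_avg_ge0 t : 0 <= local_avg r eta t.
Proof.
rewrite /local_avg mulr_ge0 ?invr_ge0 ?exprn_ge0 ?mulr_ge0 ?(ltW r0)//.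
by apply: Rintegral_ge0 => s _.
Qed.

Lemma local_avg_bounded : exists L, forall t, local_avg r eta t <= L.
Proof.
have [[L HL] _ _] := neta; exists L => t; have r0' := ltW r0.
rewrite /local_avg ler_pdivrMl ?exprn_gt0 ?mulr_gt0//.
have -> : (2 * r) ^+ d * L = \int[leb]_(s in box r) (cst L s).
  by rewrite Rintegral_cst_box// mulrC.
apply: le_Rintegral; first exact: measurable_box.
- apply: (box_integrable (f := fun s => `|eta (t - vec s)|) (K := L)) => //.
    exact: measurableT_comp.
  by move=> s _; rewrite normr_id.
- by apply: (box_integrable (f := cst L) (K := `|L|)).
- by move=> s _ /=.
Qed.

(** Jensen: integrate the tangent line of exp at the mean. *)
Lemma expR_local_avg a t : 0 <= a ->
  expR (a * local_avg r eta t) <=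
  (2 * r) ^- d * \int[leb]_(s in box r) expR (a * `|eta (t - vec s)|).
Proof.
move=> a0; set m := local_avg r eta t; have r0' := ltW r0.
have [[L HL] _ _] := neta.
have mn : measurable_fun setT (fun s : Tup => `|eta (t - vec s)|).
  exact: (measurableT_comp _ (measurable_eta_sub t)).
have vol : 0 < (2 * r) ^+ d by rewrite exprn_gt0 ?mulr_gt0.
have i2 : leb.-integrable (box r) (EFin \o (fun s => `|eta (t - vec s)|)).
  by apply: (box_integrable (K := L)) => // s _; rewrite normr_id.
(* exp (a m) (1 + a x - a m) is the tangent line of exp at a m, evaluated at
   a x; c0 is its constant term. *)
pose c0 := expR (a * m) * (1 - a * m).
have i3 : leb.-integrable (box r) (EFin \o (fun s => expR (a * m) * a * `|eta (t - vec s)|)).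
  apply: (box_integrable (K := expR (a * m) * a * L)) => //; first exact: measurable_funM.
  by move=> s _; rewrite normrM normr_id ger0_norm ?ler_wpM2l ?mulr_ge0 ?expR_ge0.
have i4 : leb.-integrable (box r) (EFin \o (cst c0)) by apply: (box_integrable (K := `|c0|)).
rewrite ler_pdivlMl//.
apply: (@le_trans _ _ (\int[leb]_(s in box r) (cst c0 s + expR (a * m) * a * `|eta (t - vec s)|))).
  rewrite RintegralD//; last exact: measurable_box.
  rewrite RintegralZl//; last exact: measurable_box.
  rewrite Rintegral_cst_box//.
  have -> : \int[leb]_(s in box r) `|eta (t - vec s)| = (2 * r) ^+ d * m.
    by rewrite /m /local_avg mulrA divff ?mul1r// gt_eqF.
  by rewrite /c0 le_eqVlt; apply/orP; left; apply/eqP; ring.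
apply: le_Rintegral; first exact: measurable_box.
- apply: (box_integrable (f := fun s => cst c0 s + expR (a * m) * a * `|eta (t - vec s)|)
    (K := `|c0| + expR (a * m) * a * L)) => //.
    by apply: measurable_funD => //; exact: measurable_funM.
  move=> s _; rewrite (le_trans (ler_normD _ _))// lerD2l.
  by rewrite normrM normr_id ger0_norm ?ler_wpM2l ?mulr_ge0 ?expR_ge0.
- apply: (box_integrable (f := fun s => expR (a * `|eta (t - vec s)|)) (K := expR (a * L))) => //.
    by apply: measurableT_comp => //; exact: measurable_funM.
  by move=> s _; rewrite ger0_norm ?expR_ge0// ler_expR ler_wpM2l.
- move=> s _ /=.
  have := expR_ge1Dx (a * `|eta (t - vec s)| - a * m).
  rewrite -(ler_pM2l (expR_gt0 (a * m))) -expRD [a * m + _]addrC subrK => H.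
  by apply: le_trans H; rewrite /c0; rewrite le_eqVlt; apply/orP; left; apply/eqP; ring.
Qed.

Lemma tame_conv : tame i (conv q eta).
Proof.
move=> b; rewrite dn_conv; split=> [t|].
  by case: (is_derive_conv b t).
have [K K0 HK] := test_kernel_bounded b tq; split.
- have [L HL] := local_avg_bounded; exists (K * (2 * r) ^+ d * L) => t.
  by rewrite (le_trans (conv_le _ HK))// ler_wpM2l// mulr_ge0// exprn_ge0// mulr_ge0// ltW.
- apply: (@measurable_Rintegral_param _ _ _ Tup setT
      (fun x => dn i b q (vec x.2) * eta (vec x.1 - vec x.2))) => //.
  apply: measurable_funM; first exact: (measurableT_comp (measurable_dnq b) measurable_snd).
  apply: (measurable_path_shift (w := fun x : Tup * Tup => vec x.1 - vec x.2)) => j.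
  under eq_fun do rewrite !mxE; apply: measurable_funB.
    by apply: (measurableT_comp (measurable_tnth j)).
  by apply: (measurableT_comp (measurable_tnth j)).
- by move=> t m; apply: eq_Rintegral => s _; rewrite addrAC peta.
Qed.

End fixed_kernel.
End convolution.

(** * Products of independent random variables *)

Section functional_induction.
Context {R : realType} {dT : measure_display} {T : measurableType dT}.
Local Open Scope ereal_scope.
Import HBNNSimple.

(** The standard induction: indicators, positive combinations, monotone limits. *)
Lemma ge0_measurable_ind (Pr : (T -> \bar R) -> Prop) :
  (forall A, measurable A -> Pr (fun x => (\1_A x)%:E)) ->
  (forall (k : R) f, (0 <= k)%R -> measurable_fun setT f -> (forall x, 0 <= f x) ->
     Pr f -> Pr (fun x => k%:E * f x)) ->
  (forall f g, measurable_fun setT f -> (forall x, 0 <= f x) ->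
     measurable_fun setT g -> (forall x, 0 <= g x) -> Pr f -> Pr g -> Pr (fun x => f x + g x)) ->
  (forall h : nat -> T -> \bar R, (forall n, measurable_fun setT (h n)) ->
     (forall n x, 0 <= h n x) -> (forall x, nondecreasing_seq (h ^~ x)) ->
     (forall n, Pr (h n)) -> Pr (fun x => limn (h ^~ x))) ->
  forall f, measurable_fun setT f -> (forall x, 0 <= f x) -> Pr f.
Proof.
move=> Pi PZ PD Plim f mf f0.
pose h n := EFin \o nnsfun_approx measurableT mf n.
have -> : f = (fun x => limn (h ^~ x)).
  by apply/funext => x; apply/esym/cvg_lim => //; exact: cvg_nnsfun_approx.
apply: Plim.
- by move=> n; apply/measurable_EFinP.
- by move=> n x; rewrite lee_fin.
- by move=> x m n mn; rewrite lee_fin; exact/lefP/nd_nnsfun_approx.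
move=> n; rewrite /h; set g := nnsfun_approx _ _ n.
pose s : seq R := finmap.enum_fset (fset_set (g @` setT)).
have s0 i : (0 <= s`_i)%R.
  have [si|si] := ltnP i (size s); last by rewrite nth_default.
  have : s`_i \in fset_set (g @` setT) by exact: mem_nth.
  rewrite in_fset_set// inE => -[x _ <-].
  exact: fun_ge0.
have -> : EFin \o g = (fun x => \sum_(i < size s) (s`_i)%:E * (\1_(g @^-1` [set s`_i]) x)%:E).
  apply/funext => x /=; rewrite fimfunEord -sumEFin.
  by apply: eq_bigr => i _; rewrite EFinM.
move: (size s) => K; elim: K => [|N IH].
  rewrite (_ : (fun _ => _) = (fun x => 0%:E * (\1_(setT : set T) x)%:E)).
    by apply: PZ => //; [exact/measurable_EFinP/measurable_indic|exact: Pi].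
  by apply/funext => x; rewrite big_ord0 mul0e.
rewrite (_ : (fun _ => _) = (fun x => \sum_(i < N) (s`_i)%:E * (\1_(g @^-1` [set s`_i]) x)%:E +
   (s`_N)%:E * (\1_(g @^-1` [set s`_N]) x)%:E)); last first.
  by apply/funext => x; rewrite big_ord_recr.
have mi i : measurable (g @^-1` [set s`_i]) by rewrite -[X in measurable X]setTI; exact: measurable_funP.
have m1 i : measurable_fun setT (fun x => (s`_i)%:E * (\1_(g @^-1` [set s`_i]) x)%:E).
  by apply/measurable_EFinP/measurable_funM => //; exact: measurable_indic.
have p1 i x : 0 <= (s`_i)%:E * (\1_(g @^-1` [set s`_i]) x)%:E by rewrite -EFinM lee_fin mulr_ge0.
apply: PD => //.
- by apply: emeasurable_sum => i; exact: m1.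
- by move=> x; apply: sume_ge0 => i _; exact: p1.
- apply: PZ => //; [exact/measurable_EFinP/measurable_indic|].
  exact: Pi.
Qed.

End functional_induction.

Section density.
Context {R : realType} {dT : measure_display} {T : measurableType dT}.
Local Open Scope ereal_scope.

Lemma ge0_integral_indicM (mu : {measure set T -> \bar R}) A (f : T -> \bar R) : measurable A ->
  \int[mu]_x ((\1_A x)%:E * f x) = \int[mu]_(x in A) f x.
Proof.
move=> mA; rewrite [RHS]integral_mkcond; apply: eq_integral => x _.
by rewrite patchE indicE; case: ifP => _; rewrite ?mul1e ?mul0e.
Qed.

Lemma ge0_integral_density (mu nu : {measure set T -> \bar R}) (f : T -> R) :
  measurable_fun setT f -> (forall x, 0 <= f x)%R ->
  (forall A, measurable A -> nu A = \int[mu]_(x in A) (f x)%:E) ->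
  forall g, measurable_fun setT g -> (forall x, 0 <= g x) ->
    \int[nu]_x g x = \int[mu]_x (g x * (f x)%:E).
Proof.
move=> /measurable_EFinP mf f0' nuE.
have f0 x : 0 <= (f x)%:E by rewrite lee_fin.
apply: ge0_measurable_ind => //.
- by move=> A mA; rewrite integral_indic// setIT nuE// ge0_integral_indicM.
- move=> k g k0 mg g0 gE; rewrite ge0_integralZl//= gE -ge0_integralZl//=.
  + by apply: eq_integral => x _; rewrite muleA.
  + exact: emeasurable_funM.
  + by move=> x _; rewrite mule_ge0.
- move=> g h mg g0 mh h0 gE hE; rewrite ge0_integralD//= gE hE -ge0_integralD//=.
  + by apply: eq_integral => x _; rewrite ge0_muleDl.
  + by move=> x _; rewrite mule_ge0.
  + exact: emeasurable_funM.
  + by move=> x _; rewrite mule_ge0.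
  + exact: emeasurable_funM.
- move=> h mh h0 ndh hE.
  rewrite monotone_convergence//=.
  under eq_fun do rewrite hE.
  rewrite -monotone_convergence//=.
  + apply: eq_integral => x _; rewrite muleC -limeMl//; last exact: ereal_nondecreasing_is_cvgn.
      by congr (limn _); apply/funext => n; rewrite muleC.
  + by move=> n; exact: emeasurable_funM.
  + by move=> n x _; rewrite mule_ge0.
  + by move=> x _ m n mn; rewrite lee_wpmul2r// ndh.
Qed.

Variables (P : {measure set T -> \bar R}) (G : set (set T)).
Hypothesis G_sub : <<s G>> `<=` @measurable _ T.
Local Notation TG := (g_sigma_algebraType G).

Lemma measurable_fun_sub {dU} {U : measurableType dU} (h : T -> U) :
  measurable_fun (T := TG) setT (h : TG -> U) -> measurable_fun (T := T) setT h.
Proof.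
move=> mh _ Y mY; have := mh measurableT _ mY.
by rewrite !setTI => /G_sub.
Qed.

(** The hypothesis says that Z is independent, in the mean, of the
    sub-sigma-algebra generated by G; the conclusion extends it from events to
    nonnegative functions by the standard induction. *)
Lemma ge0_integral_independent (c : R) (Z : T -> R) : (0 <= c)%R ->
  measurable_fun setT Z -> (forall x, 0 <= Z x)%R ->
  (forall A, <<s G>> A -> \int[P]_(x in A) (Z x)%:E = c%:E * P A) ->
  forall h : TG -> \bar R, measurable_fun (T := TG) setT h -> (forall x, 0 <= h x) ->
    \int[P]_x (h x * (Z x)%:E) = c%:E * \int[P]_x (h x).
Proof.
move=> c0 /measurable_EFinP mZ Z0' ZE.
have Z0 x : 0 <= (Z x)%:E by rewrite lee_fin.
apply: ge0_measurable_ind.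
- move=> A mA; have mA' := G_sub mA.
  by rewrite integral_indic// setIT (ge0_integral_indicM P (EFin \o Z) mA') ZE.
- move=> k g k0 /measurable_fun_sub mg g0 gE.
  rewrite ge0_integralZl//= muleCA -gE -ge0_integralZl//=.
  + by apply: eq_integral => x _; rewrite muleA.
  + exact: emeasurable_funM.
  + by move=> x _; rewrite mule_ge0.
- move=> g h /measurable_fun_sub mg g0 /measurable_fun_sub mh h0 gE hE.
  rewrite ge0_integralD//= ge0_muleDr ?integral_ge0// -gE -hE -ge0_integralD//=.
  + by apply: eq_integral => x _; rewrite ge0_muleDl.
  + by move=> x _; rewrite mule_ge0.
  + exact: emeasurable_funM.
  + by move=> x _; rewrite mule_ge0.
  + exact: emeasurable_funM.
- move=> h mh' h0 ndh hE.
  have mh n : measurable_fun (T := T) setT (h n) := measurable_fun_sub (mh' n).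
  rewrite monotone_convergence//=.
  rewrite -limeMl//; last first.
    apply: ereal_nondecreasing_is_cvgn => m n mn; apply: ge0_le_integral => //.
    by move=> x _; exact: ndh.
  under [in RHS]eq_fun do rewrite -hE.
  rewrite -monotone_convergence//=.
  + apply: eq_integral => x _; rewrite muleC -limeMl//; last exact: ereal_nondecreasing_is_cvgn.
      by congr (limn _); apply/funext => n; rewrite muleC.
  + by move=> n; exact: emeasurable_funM.
  + by move=> n x _; rewrite mule_ge0.
  + by move=> x _ m n mn; rewrite lee_wpmul2r// ndh.
Qed.

End density.

Section independence.
Context {R : realType} {disp : measure_display} {Omega : measurableType disp}.
Variables (P : probability Omega R) (I : Type) (D : set nat).
Variable Y : nat -> I -> {RV P >-> R}.

Definition generators (j : nat) : set (set Omega) :=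
  \bigcup_(x in [set: I])
        preimage_set_system [set: Omega] (Y j x) (@measurable _ (measurableTypeR R)).

Lemma sigma_generated_sub j : <<s generators j>> `<=` @measurable _ Omega.
Proof.
apply: smallest_sub; first exact: sigma_algebra_measurable.
move=> A [x _ [B mB <-]]; exact: (measurable_funPT (Y j x)).
Qed.

Local Notation TG j := (g_sigma_algebraType (generators j)).

Hypothesis indep : independent_processes D Y.

Lemma bigI_measurable (l : seq nat) (A : nat -> set Omega) :
  (forall j, j \in l -> measurable (A j)) -> measurable (\big[setI/setT]_(j <- l) A j).
Proof.
elim: l => [|j l IH] mA; first by rewrite big_nil.
rewrite big_cons; apply: measurableI; first by apply: mA; rewrite mem_head.
by apply: IH => k kl; apply: mA; rewrite inE kl orbT.
Qed.

Lemma measurable_prod_mem {d'} {A : measurableType d'} (f : nat -> A -> R) (l : seq nat) :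
  (forall j, j \in l -> measurable_fun setT (f j)) ->
  measurable_fun setT (fun o => \prod_(j <- l) f j o).
Proof.
elim: l => [|j l IH] mf.
  rewrite (_ : (fun _ => _) = cst 1); first exact: measurable_cst.
  by apply/funext => o; rewrite big_nil.
under eq_fun do rewrite big_cons.
apply: measurable_funM; first by apply: mf; rewrite mem_head.
by apply: IH => k kl; apply: mf; rewrite inE kl orbT.
Qed.

(** The definition of independence concerns events; they are traded for functions
    one index at a time. The generality in l2 is needed because, to replace the
    event of index j by f j, one must know the formula for all events of index j. *)
Lemma independent_prod_aux (f : nat -> Omega -> R) (e : nat -> R) (l1 : seq nat) :
  (forall j, j \in l1 -> measurable_fun (T := TG j) setT (f j : TG j -> R)) ->
  (forall j, j \in l1 -> forall o, 0 <= f j o) ->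
  (forall j, j \in l1 -> (\int[P]_o (f j o)%:E = (e j)%:E)%E) ->
  forall (l2 : seq nat) (A : nat -> set Omega), uniq (l1 ++ l2) ->
  (forall j, j \in l1 ++ l2 -> D j) ->
  (forall j, j \in l2 -> <<s generators j>> (A j)) ->
  (\int[P]_(o in \big[setI/setT]_(j <- l2) A j) (\prod_(j <- l1) f j o)%:E =
   (\prod_(j <- l1) e j)%:E * \prod_(j <- l2) P (A j))%E.
Proof.
elim: l1 => [|j l IH] mf f0 fe l2 A ul Dl sA.
  have mB : measurable (\big[setI/setT]_(j <- l2) A j).
    by apply: bigI_measurable => j jl; apply: sigma_generated_sub; exact: sA.
  under eq_integral do rewrite big_nil.
  rewrite big_nil mul1e integral_cst// mul1e.
  exact: indep.
have mB : measurable (\big[setI/setT]_(j <- l2) A j).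
  by apply: bigI_measurable => k kl; apply: sigma_generated_sub; exact: sA.
set B := \big[setI/setT]_(j <- l2) A j in mB *.
have jl : (j \notin l) && (j \notin l2) by move: ul; rewrite /= mem_cat negb_or => /andP[].
have ul' : uniq (l ++ l2) by move: ul => /= /andP[].
have mfl k : k \in l -> measurable_fun setT (f k).
  by move=> kl; apply: (measurable_fun_sub (@sigma_generated_sub k)); apply: mf; rewrite inE kl orbT.
have mf0 k : k \in l -> forall o, 0 <= f k o by move=> kl; apply: f0; rewrite inE kl orbT.
pose Z o := \1_B o * \prod_(k <- l) f k o.
have mZ : measurable_fun setT Z.
  apply: measurable_funM; first exact: measurable_indic.
  exact: measurable_prod_mem.
have Z0 o : 0 <= Z o.
  by rewrite mulr_ge0// big_seq prodr_ge0// => k kl; exact: mf0.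
pose c := \prod_(k <- l) e k * \prod_(k <- l2) fine (P (A k)).
have Pfin k : k \in l2 -> P (A k) = (fine (P (A k)))%:E.
  move=> kl; rewrite fineK// fin_num_measure//.
  by apply: sigma_generated_sub; exact: sA.
have cE : (c%:E = (\prod_(k <- l) e k)%:E * \prod_(k <- l2) P (A k))%E.
  rewrite /c EFinM; congr (_ * _)%E; rewrite -prodEFin big_seq [RHS]big_seq.
  by apply: eq_bigr => k kl; rewrite -Pfin.
have c0 : 0 <= c.
  apply: mulr_ge0; last first.
    by rewrite big_seq; apply: prodr_ge0 => k kl; exact: fine_ge0.
  rewrite big_seq; apply: prodr_ge0 => k kl; rewrite -lee_fin -fe ?inE ?kl ?orbT//.
  by apply: integral_ge0 => o _; rewrite lee_fin mf0.
have main A' : <<s generators j>> A' -> (\int[P]_(o in A') (Z o)%:E = c%:E * P A')%E.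
  move=> sA'.
  have mA' : measurable A' by exact: sigma_generated_sub sA'.
  (* The event A' joins the family as the event of index j. *)
  pose A2 k := if k == j then A' else A k.
  have E2 : \big[setI/setT]_(k <- j :: l2) A2 k = A' `&` B.
    rewrite big_cons /A2 eqxx; congr (_ `&` _); rewrite /B big_seq [RHS]big_seq.
    apply: eq_bigr => k kl; case: eqP => // kj.
    by move: jl; rewrite -kj kl andbF.
  transitivity (\int[P]_(o in A' `&` B) (\prod_(k <- l) f k o)%:E)%E.
    rewrite integral_mkcond [RHS]integral_mkcond; apply: eq_integral => o _.
    rewrite !patchE in_setI /Z indicE; case: (o \in A'); case: (o \in B) => //=.
      by rewrite mul1r.
    by rewrite mul0r.
  rewrite -E2 IH.
  - have E3 : (\prod_(k <- l2) P (A2 k) = \prod_(k <- l2) P (A k))%E.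
      rewrite big_seq [RHS]big_seq; apply: eq_bigr => k kl.
      by rewrite /A2; case: eqP => // kj; move: jl; rewrite -kj kl andbF.
    by rewrite big_cons E3 /A2 eqxx muleCA muleC cE.
  - by move=> k kl; apply: mf; rewrite inE kl orbT.
  - by move=> k kl; exact: mf0.
  - by move=> k kl; apply: fe; rewrite inE kl orbT.
  - by rewrite uniq_catC /= mem_cat negb_or uniq_catC ul' andbT andbC jl.
  - move=> k; rewrite mem_cat inE => kl; apply: Dl.
    by rewrite /= inE mem_cat; move: kl; case/or3P => ->; rewrite ?orbT.
  - move=> k; rewrite inE /A2; case: eqP => [-> //|_ /= kl]; exact: sA.
have H := @ge0_integral_independent R _ Omega P (generators j) (@sigma_generated_sub j)
  c Z c0 mZ Z0 main (EFin \o f j).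
transitivity (\int[P]_o ((f j o)%:E * (Z o)%:E))%E.
  rewrite integral_mkcond; apply: eq_integral => o _.
  rewrite patchE /Z indicE big_cons; case: (o \in B) => //=.
    by rewrite mul1r.
  by rewrite mul0r mule0.
rewrite H.
- by rewrite fe ?mem_head// cE big_cons EFinM muleAC [(_ * (e j)%:E)%E]muleC.
- by apply/measurable_EFinP; apply: mf; rewrite mem_head.
- by move=> o; rewrite lee_fin f0// mem_head.
Qed.

Lemma independent_prod (f : nat -> Omega -> R) (e : nat -> R) (l : seq nat) : uniq l ->
  (forall j, j \in l -> D j) ->
  (forall j, j \in l -> measurable_fun (T := TG j) setT (f j : TG j -> R)) ->
  (forall j, j \in l -> forall o, 0 <= f j o) ->
  (forall j, j \in l -> (\int[P]_o (f j o)%:E = (e j)%:E)%E) ->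
  (\int[P]_o (\prod_(j <- l) f j o)%:E = (\prod_(j <- l) e j)%:E)%E.
Proof.
move=> ul Dl mf f0 fe.
have := @independent_prod_aux f e l mf f0 fe [::] (fun=> set0).
by rewrite cats0 !big_nil mule1; apply.
Qed.

End independence.

(** * Exponential moments of Gaussian variables *)

Section normal_moments.
Context {R : realType}.
Local Notation leb := (@lebesgue_measure R).
Local Notation RR := (measurableTypeR R).

Lemma normal_integral (m s : R) (g : RR -> R) : measurable_fun setT g -> (forall x, 0 <= g x) ->
  (\int[normal_prob m s]_x (g x)%:E = \int[leb]_x (g x * normal_pdf m s x)%:E)%E.
Proof.
move=> mg g0.
rewrite (@ge0_integral_density R _ RR leb (normal_prob m s) (normal_pdf m s)) //.
- exact: measurable_normal_pdf.
- by move=> x; exact: normal_pdf_ge0.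
- by apply/measurable_EFinP.
Qed.

(** Completing the square turns the integrand into a multiple of another normal
    density, which has total mass 1. *)
Lemma normal_scaled_integral (m s m' s' k : R) (g : RR -> R) : 0 <= k ->
  measurable_fun setT g -> (forall x, 0 <= g x) ->
  (forall x, g x * normal_pdf m s x = k * normal_pdf m' s' x) ->
  (\int[normal_prob m s]_x (g x)%:E = k%:E)%E.
Proof.
move=> k0 mg g0 gE; rewrite normal_integral//.
under eq_integral do rewrite gE EFinM.
rewrite ge0_integralZl//=.
- by rewrite [X in (_ * X)%E](integral_normal_pdf m' s') mule1.
- by apply/measurable_EFinP; exact: measurable_normal_pdf.
- by move=> x _; rewrite lee_fin normal_pdf_ge0.
Qed.

Lemma normal_mgf (m s a : R) : s != 0 ->
  (\int[normal_prob m s]_x (expR (a * x))%:E = (expR (a * m + a ^+ 2 * s ^+ 2 / 2))%:E)%E.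
Proof.
move=> s0; apply: (@normal_scaled_integral m s (m + a * s ^+ 2) s).
- exact: expR_ge0.
- by apply: measurableT_comp => //; exact: measurable_funM.
- by move=> x; exact: expR_ge0.
- move=> x; rewrite !normal_pdfE// mulrCA [RHS]mulrCA; congr (_ * _).
  rewrite /normal_fun -!expRD; congr expR.
  rewrite -[s ^+ 2 *+ 2]mulr_natr; field.
  by rewrite s0.
Qed.

(** The exact value is 1 / sqrt 2; the bound 3/4 leaves room in gaussian_mgf. *)
Lemma normal_gauss_moment (s : R) : 0 < s ->
  exists2 k : R, k <= 3 / 4 &
  (\int[normal_prob 0 s]_x (expR (- (x ^+ 2 / (2 * s ^+ 2))))%:E = k%:E)%E.
Proof.
move=> s0; pose s' := s / Num.sqrt 2.
have r20 : 0 < Num.sqrt 2 :> R by rewrite sqrtr_gt0.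
have r2 : Num.sqrt 2 ^+ 2 = 2 :> R by rewrite sqr_sqrtr.
have s'0 : s' != 0 by rewrite mulf_neq0 ?invr_eq0 ?gt_eqF.
have s'2 : s' ^+ 2 = s ^+ 2 / 2 by rewrite /s' expr_div_n r2.
have p0 := pi_gt0 R.
exists (normal_peak s / normal_peak s').
  rewrite /normal_peak s'2 invrK mulrC ler_pdivrMr; last first.
    by rewrite sqrtr_gt0 -mulr_natr !mulr_gt0// exprn_gt0.
  set X := s ^+ 2 * pi *+ 2.
  have -> : s ^+ 2 / 2 * pi *+ 2 = 2^-1 * X by rewrite /X -[LHS]mulr_natr -[in RHS]mulr_natr; field.
  have X0 : 0 <= X by rewrite /X mulrn_wge0// mulr_ge0 ?sqr_ge0 ?pi_ge0.
  have -> : 3 / 4 = Num.sqrt ((3 / 4) ^+ 2) :> R by rewrite sqrtr_sqr ger0_norm// divr_ge0.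
  rewrite -sqrtrM ?sqr_ge0// ler_wsqrtr// ler_wpM2r//.
  by rewrite expr2; lra.
apply: (@normal_scaled_integral 0 s 0 s').
- by rewrite divr_ge0 ?normal_peak_ge0.
- apply: measurableT_comp => //; apply: measurableT_comp => //.
  by apply: measurable_funM => //; exact: measurable_funX.
- by move=> x; exact: expR_ge0.
- move=> x; rewrite (normal_pdfE _ (lt0r_neq0 s0)) (normal_pdfE _ s'0) /= [RHS]mulrA.
  rewrite divfK; last by rewrite gt_eqF// normal_peak_gt0.
  rewrite mulrCA; congr (_ * _); rewrite /normal_fun -expRD; congr expR.
  rewrite s'2 subr0 -[s ^+ 2 *+ 2]mulr_natr -[s ^+ 2 / 2 *+ 2]mulr_natr; field.
  by rewrite gt_eqF.
Qed.

End normal_moments.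

Section gaussian_mgf.
Context {R : realType} {disp : measure_display} {Omega : measurableType disp}.
Variables (P : probability Omega R).
Local Notation RR := (measurableTypeR R).

Lemma integral_law (Y : {RV P >-> R}) (nu : {measure set RR -> \bar R}) (g : R -> R) :
  (forall A : set RR, measurable A -> P (Y @^-1` A) = nu A) ->
  measurable_fun setT (g : RR -> R) -> (forall x, 0 <= g x) ->
  (\int[P]_o (g (Y o))%:E = \int[nu]_(x in (setT : set RR)) (g x)%:E)%E.
Proof.
move=> law mg g0.
have mY : measurable_fun setT (Y : Omega -> RR) by exact: (measurable_funPT Y).
transitivity (\int[pushforward P (Y : Omega -> RR)]_x (g x)%:E)%E.
  rewrite (ge0_integral_pushforward mY)//=.
    exact/measurable_EFinP.
  by move=> x _; rewrite lee_fin.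
by apply: eq_measure_integral => A mA _; exact: law.
Qed.

(** The exponent is twice the exact one, because s is bounded by the variance v
    through a comparison of moments:
    1 - v / (2 s^2) <= E[exp (- Y^2 / (2 s^2))] <= 3/4.
    The mean m vanishes since 1 <= E[exp (b Y)] for b = - m / s^2, by
    1 + x <= exp x and E[Y] = 0. *)
Lemma gaussian_mgf (Y : {RV P >-> R}) (v : R) : gaussian P Y ->
  'E_P[Y]%E = 0%E -> 'E_P[fun o => (Y o * Y o)%R]%E = v%:E ->
  forall a : R, (\int[P]_o (expR (a * Y o))%:E <= (expR (a ^+ 2 * v))%:E)%E.
Proof.
move=> gY EY EY2 a.
have mY : measurable_fun setT Y by exact: (measurable_funPT Y).
have mE (b : R) : measurable_fun setT (fun x : RR => expR (b * x)).
  by apply: measurableT_comp => //; exact: measurable_funM.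
have v0 : 0 <= v.
  rewrite -lee_fin -EY2 unlock; apply: integral_ge0 => o _.
  by rewrite lee_fin -expr2 sqr_ge0.
have EY2' : (\int[P]_o (Y o * Y o)%:E = v%:E)%E by move: EY2; rewrite unlock.
have I2 : P.-integrable setT (fun o => (Y o * Y o)%:E).
  apply/integrableP; split; first by apply/measurable_EFinP; exact: measurable_funM.
  rewrite (_ : (\int[P]_x _)%E = v%:E) ?ltry// -EY2'.
  by apply: eq_integral => o _; rewrite gee0_abs// lee_fin -expr2 sqr_ge0.
have I0 : P.-integrable setT (cst 1%:E : Omega -> \bar R).
  by apply: finite_measure_integrable_cst.
have I1 : P.-integrable setT (EFin \o Y).
  apply: (le_integrable measurableT _ _ (integrableD measurableT I0 I2)).
    exact/measurable_EFinP.
  move=> o _ /=; rewrite lee_fin [leRHS]ger0_norm ?addr_ge0 -?expr2 ?sqr_ge0//.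
  have : 0 <= (`|Y o| - 1) ^+ 2 by rewrite sqr_ge0.
  rewrite -(real_normK (num_real (Y o))); have := normr_ge0 (Y o).
  move: `|Y o| => y; nra.
have E1 (b : R) : (\int[P]_o (expR (b * Y o))%:E < +oo)%E -> (1 <= \int[P]_o (expR (b * Y o))%:E)%E.
  move=> fin.
  have -> : (1 = \int[P]_o (1%:E + b%:E * (Y o)%:E))%E.
    rewrite integralD//=; last exact: integrableZl.
    rewrite integral_cst//= probability_setT integralZl//.
    by move: EY; rewrite unlock => ->; rewrite mule0 adde0 mule1.
  apply: le_integral => //.
  - by apply: integrableD => //; exact: integrableZl.
  - apply/integrableP; split; first by apply/measurable_EFinP; exact: (measurableT_comp (mE b) mY).
    by under eq_integral do rewrite gee0_abs ?lee_fin ?expR_ge0//.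
  - by move=> o _; rewrite -EFinM -EFinD lee_fin expR_ge1Dx.
case: gY => [[m law]|[m [s [s0 law]]]].
  have H (g : R -> R) : measurable_fun setT (g : RR -> R) -> (forall x, 0 <= g x) ->
      (\int[P]_o (g (Y o))%:E = (g m)%:E)%E.
    move=> mg g0; rewrite (@integral_law Y (@dirac _ RR m R) g law mg g0).
    by rewrite integral_dirac// ?diracT ?mul1e//; exact/measurable_EFinP.
  have Eb b : (\int[P]_o (expR (b * Y o))%:E = (expR (b * m))%:E)%E.
    exact: (H (fun x => expR (b * x)) (mE b) (fun x => expR_ge0 _)).
  (* A point mass at m: exp (b m) >= 1 at b = - m forces m = 0. *)
  have m0 : m = 0.
    have := E1 (- m); rewrite Eb ltry lee_fin => /(_ isT).
    rewrite -expR0 ler_expR => h; apply/eqP; rewrite -sqrf_eq0 eq_le sqr_ge0 andbT.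
    by rewrite expr2 -oppr_ge0 -mulNr.
  by rewrite Eb m0 mulr0 lee_fin ler_expR mulr_ge0// sqr_ge0.
have sn : s != 0 by rewrite gt_eqF.
have Eb b : (\int[P]_o (expR (b * Y o))%:E = (expR (b * m + b ^+ 2 * s ^+ 2 / 2))%:E)%E.
  rewrite (@integral_law Y (normal_prob m s) (fun x => expR (b * x)) law (mE b)).
    exact: normal_mgf.
  by move=> x; exact: expR_ge0.
have m0 : m = 0.
  have := E1 (- m / s ^+ 2); rewrite Eb ltry lee_fin => /(_ isT).
  rewrite -[X in X <= _]expR0 ler_expR (_ : - m / s ^+ 2 * m + (- m / s ^+ 2) ^+ 2 * s ^+ 2 / 2 = - (m ^+ 2 / (2 * s ^+ 2))); last first.
    by field; rewrite sn.
  rewrite oppr_ge0 => h; apply/eqP; rewrite -sqrf_eq0 eq_le sqr_ge0 andbT.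
  by move: h; rewrite pmulr_lle0// invr_gt0 mulr_gt0// exprn_gt0.
rewrite Eb lee_fin ler_expR m0 mulr0 add0r -mulrA ler_wpM2l ?sqr_ge0//.
subst m.
(* It remains to see that s^2 / 2 <= v. *)
have [k k34 kE] := normal_gauss_moment s0.
have mG : measurable_fun setT (fun x : RR => expR (- (x ^+ 2 / (2 * s ^+ 2)))).
  apply: measurableT_comp => //; apply: measurableT_comp => //.
  by apply: measurable_funM => //; exact: measurable_funX.
have kP : (\int[P]_o (expR (- (Y o ^+ 2 / (2 * s ^+ 2))))%:E = k%:E)%E.
  rewrite -kE (@integral_law Y (normal_prob 0 s) (fun x => expR (- (x ^+ 2 / (2 * s ^+ 2)))) law mG)//.
have c0 : 0 <= (2 * s ^+ 2)^-1 by rewrite invr_ge0 mulr_ge0// sqr_ge0.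
have p1 o : (0 <= (expR (- (Y o ^+ 2 / (2 * s ^+ 2))))%:E)%E by rewrite lee_fin expR_ge0.
have p2 o : (0 <= (Y o * Y o)%:E)%E by rewrite lee_fin -expr2 sqr_ge0.
have p3 o : (0 <= (2 * s ^+ 2)^-1%:E * (Y o * Y o)%:E)%E by rewrite mule_ge0.
have m1 : measurable_fun setT (fun o => (expR (- (Y o ^+ 2 / (2 * s ^+ 2))))%:E).
  by apply/measurable_EFinP; exact: (measurableT_comp mG mY).
have m2 : measurable_fun setT (fun o => (Y o * Y o)%:E).
  by apply/measurable_EFinP; exact: measurable_funM.
have m3 : measurable_fun setT (fun o => (2 * s ^+ 2)^-1%:E * (Y o * Y o)%:E)%E.
  exact: emeasurable_funM.
have : (1 <= k%:E + (2 * s ^+ 2)^-1%:E * v%:E)%E.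
  rewrite -kP -EY2' -ge0_integralZl//= -ge0_integralD//=.
  have -> : (1 = \int[P]_o (cst 1%:E o : \bar R))%E by rewrite integral_cst//= probability_setT mule1.
  apply: ge0_le_integral => //.
  - exact: emeasurable_funD.
  - move=> o _ /=; rewrite -EFinM -EFinD lee_fin -expr2 [_^-1 * _]mulrC.
    by have := expR_ge1Dx (- (Y o ^+ 2 / (2 * s ^+ 2))); lra.
rewrite -EFinM -EFinD lee_fin => h.
have h2 : 1 / 4 <= v / (2 * s ^+ 2) by rewrite [v / _]mulrC; lra.
move: h2; rewrite ler_pdivlMr ?mulr_gt0 ?exprn_gt0//.
lra.
Qed.

End gaussian_mgf.

(** * The smoothed fields *)

Section random_paths.
Context {R : realType} {d : nat}.
Local Notation E := 'rV[R]_d.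
Local Notation RR := (measurableTypeR R).
Local Notation Tup := (d.-tuple RR).
Local Notation leb := (@lebesgue_power R d).
Local Notation vec := (@vec_of_tuple R d).

Section measurability.
Context {dS dA : measure_display} {S : measurableType dS} {A : measurableType dA}.
Variables (eta : S -> E -> R) (pr : A -> S) (w : A -> E).
Hypothesis meta : forall t, measurable_fun setT (eta ^~ t).
Hypothesis ceta : forall s, continuous (eta s).
Hypothesis mpr : measurable_fun setT pr.
Hypothesis mw : forall j, measurable_fun setT (fun a => w a 0 j).

Lemma measurable_random_path : measurable_fun setT (fun a => eta (pr a) (w a)).
Proof.
apply: (@measurable_fun_caratheodory _ _ _ A w (fun x a => eta (pr a) x)) => //.
by move=> x; exact: (measurableT_comp (meta x) mpr).
Qed.
End measurability.

Section measurability_conv.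
Context {dS dA : measure_display} {S : measurableType dS} {A : measurableType dA}.
Variables (eta : S -> E -> R) (pr : A -> S) (w : A -> E).
Hypothesis meta : forall t, measurable_fun setT (eta ^~ t).
Hypothesis ceta : forall s, continuous (eta s).
Hypothesis mpr : measurable_fun setT pr.
Hypothesis mw : forall j, measurable_fun setT (fun a => w a 0 j).

Lemma measurable_random_path_sub :
  measurable_fun setT (fun x : A * Tup => eta (pr x.1) (w x.1 - vec x.2)).
Proof.
apply: (measurable_random_path (pr := fun x : A * Tup => pr x.1)
  (w := fun x : A * Tup => w x.1 - vec x.2)) => //.
  exact: (measurableT_comp mpr measurable_fst).
move=> j; under eq_fun do rewrite !mxE; apply: measurable_funB.
  exact: (measurableT_comp (mw j) measurable_fst).
by apply: (measurableT_comp (measurable_tnth j)).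
Qed.

Lemma measurable_random_conv (q : E -> R) : measurable_fun setT (q \o vec) ->
  measurable_fun setT (fun a => conv q (eta (pr a)) (w a)).
Proof.
move=> mq; apply: (@measurable_Rintegral_param _ _ _ A setT
  (fun x => q (vec x.2) * eta (pr x.1) (w x.1 - vec x.2))) => //.
apply: measurable_funM; last exact: measurable_random_path_sub.
exact: (measurableT_comp mq measurable_snd).
Qed.

Lemma measurable_random_avg r :
  measurable_fun setT (fun a => local_avg r (eta (pr a)) (w a)).
Proof.
apply: measurable_funM => //.
apply: (@measurable_Rintegral_param _ _ _ A (box r)
  (fun x => `|eta (pr x.1) (w x.1 - vec x.2)|)) => //; first exact: measurable_box.
by apply: measurableT_comp => //; exact: measurable_random_path_sub.
Qed.
End measurability_conv.

End random_paths.

Section torus_fields.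
Context {R : realType} {d : nat}.
Local Notation E := 'rV[R]_d.
Local Notation T := (torus R d).
Local Notation RR := (measurableTypeR R).
Local Notation Tup := (d.-tuple RR).
Local Notation leb := (@lebesgue_power R d).
Local Notation vec := (@vec_of_tuple R d).
Context {disp : measure_display} {Omega : measurableType disp}.
Variables (P : probability Omega R) (Phi Q : E -> R) (xi : nat -> T -> {RV P >-> R}).
Hypothesis aQ : admissible_Q Q.
Hypothesis gf : gaussian_fields Phi xi.

Definition path (j : nat) (o : Omega) (t : E) : R := xi j (texp t) o.

Definition kernel (j : nat) : E -> R := rescale (eps j) Q.

Definition avg (j : nat) (t : E) (o : Omega) : R := local_avg (eps j) (path j o) t.

(** The common variance of all the fields: calL Phi j 0 does not depend on j. *)
Definition var0 : R := calL Phi 0 (0 : E).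

Lemma epsE j : (eps j : R) = (j%:R ^+ 2 * 2 ^+ j)^-1.
Proof. by rewrite /eps -invfM. Qed.

Lemma eps_gt0 j : (0 < j)%N -> (0 : R) < eps j.
Proof. by move=> j0; rewrite epsE invr_gt0 mulr_gt0// exprn_gt0// ltr0n. Qed.

Lemma eps_le_half j : (0 < j)%N -> (eps j : R) <= 2^-1.
Proof.
move=> j0; rewrite epsE lef_pV2 ?posrE ?mulr_gt0 ?exprn_gt0 ?ltr0n//.
have h1 : 1 <= j%:R :> R by rewrite ler1n.
have h2 : 2 <= 2 ^+ j :> R by rewrite -{1}[2]expr1 ler_eXn2l ?ltr1n.
by rewrite -[leLHS]mul1r; apply: ler_pM => //; exact: exprn_ege1.
Qed.

Lemma path_continuous j o : (0 < j)%N -> continuous (path j o).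
Proof.
move=> j0 t; apply: (@continuous_comp _ _ _ (@texp R d) (fun z => xi j z o)).
  exact: continuous_texp.
exact: (fields_continuous gf j0).
Qed.

Lemma path_periodic j o : periodic_fun (path j o).
Proof. by move=> t m; rewrite /path texp_periodic. Qed.

Lemma measurable_path_field j t : measurable_fun setT (fun o => path j o t).
Proof. exact: measurable_funPT. Qed.

Lemma measurable_path_sigma j t :
  measurable_fun (T := g_sigma_algebraType (generators xi j)) setT (fun o => path j o t).
Proof.
move=> _ B mB; rewrite setTI; apply: sub_sigma_algebra.
by exists (texp t) => //; exists B => //; rewrite setTI.
Qed.

(** On the torus the kernel is read through tlog; since eps_j <= 1/2 its support
    fits in the fundamental cube, and the integral is one over R^d. *)
Lemma psi_conv j o t : (0 < j)%N -> psi Q xi j (texp t) o = conv (kernel j) (path j o) t.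
Proof.
move=> j0; have e0 := eps_gt0 j0; have e1 := eps_le_half j0.
rewrite /psi /torus_integral /Rd_integral /conv /Rintegral; congr fine.
rewrite integral_mkcond; apply: eq_integral => s _; rewrite patchE.
case: ifPn => [|]; rewrite ?inE ?notin_setE /= => cs.
  rewrite /mollifier tmul_conj_texp tlog_texp_cube//.
have [j1 hj] : exists k, 2^-1 <= `|vec s 0 k|.
  apply: contrapT => H; apply: cs => k; apply/andP.
  have : `|vec s 0 k| < 2^-1 by rewrite ltNge; apply/negP => h; apply: H; exists k.
  by rewrite ltr_norml => /andP[h1 h2]; split => //; exact: ltW.
rewrite /kernel /rescale (vanish_off_open_cube (u := _) (j := j1)) ?mulr0 ?mul0r//.
- by have [] := (Q_smooth aQ [::]).
- exact: Q_support aQ.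
- rewrite mxE normrM gtr0_norm ?invr_gt0// mulrC ler_pdivlMr// mul1r.
  exact: le_trans e1 hj.
Qed.

Lemma kernel_test j i : (0 < j)%N -> test_kernel i (eps j) (kernel j).
Proof.
move=> j0; apply: rescale_test_kernel; first exact: eps_gt0.
  exact: Q_smooth aQ.
exact: Q_support aQ.
Qed.

Lemma calL0 j : calL Phi j (0 : E) = var0.
Proof. by apply: eq_Rintegral => u _; rewrite !scaler0. Qed.

Lemma path_covariance j t u : (0 < j)%N ->
  ('E_P[fun o => (path j o t * path j o u)%R] = (calH Phi j (texp (t - u)))%:E)%E.
Proof. by move=> j0; rewrite (fields_covariance gf j0) tmul_conj_texp. Qed.

Lemma path_variance j t : (0 < j)%N ->
  ('E_P[fun o => (path j o t * path j o t)%R] = var0%:E)%E.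
Proof.
move=> j0; rewrite path_covariance// subrr /calH tlog_texp_cube ?calL0// => i.
by rewrite mxE; apply/andP; split; lra.
Qed.

(** exp |x| <= exp x + exp (- x), which explains the factor 2. *)
Lemma path_exp_moment j t a : (0 < j)%N -> 
  (\int[P]_o (expR (a * `|path j o t|))%:E <= (2 * expR (a ^+ 2 * var0))%:E)%E.
Proof.
move=> j0.
have gY : gaussian P (xi j (texp t)).
  have := @fields_gaussian _ _ _ _ _ _ _ gf j j0 1%N (fun=> texp t) (fun=> 1).
  rewrite (_ : (fun o : Omega => _) = xi j (texp t))//.
  by apply/funext => o; rewrite big_ord1 mul1r.
have mgf := @gaussian_mgf R _ Omega P (xi j (texp t)) var0 gY
  (fields_centered gf j0 (texp t)) (path_variance t j0).
have mY : measurable_fun setT (xi j (texp t)) := measurable_funPT _.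
have mE b : measurable_fun setT (fun o => (expR (b * path j o t))%:E).
  by apply/measurable_EFinP; apply: measurableT_comp => //; exact: measurable_funM.
have p0 b o : (0 <= (expR (b * path j o t))%:E)%E by rewrite lee_fin expR_ge0.
apply: (@le_trans _ _ (\int[P]_o ((expR (a * path j o t))%:E + (expR (- a * path j o t))%:E))%E).
  apply: ge0_le_integral => //.
  - apply/measurable_EFinP; apply: measurableT_comp => //; apply: measurable_funM => //.
    exact: measurableT_comp.
  - exact: emeasurable_funD.
  - move=> o _; rewrite -EFinD lee_fin.
    have [h|h] := leP 0 (path j o t); first by rewrite ger0_norm// lerDl expR_ge0.
    by rewrite ltr0_norm// mulrN mulNr lerDr expR_ge0.
rewrite ge0_integralD//= mulrDl mul1r EFinD.
by apply: leeD; [exact: mgf|have := mgf (- a); rewrite sqrrN].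
Qed.

(** Jensen on the box, then Tonelli and the moments at a single point. *)
Lemma avg_exp_moment j t a : (0 < j)%N -> 0 <= a ->
  (\int[P]_o (expR (a * avg j t o))%:E <= (2 * expR (a ^+ 2 * var0))%:E)%E.
Proof.
move=> j0 a0; set B := 2 * _; have e0 := eps_gt0 j0.
pose r : R := eps j; pose c : R := (2 * r) ^- d.
have c0 : 0 <= c by rewrite invr_ge0 exprn_ge0// mulr_ge0// ltW.
have B0 : 0 <= B by rewrite mulr_ge0// expR_ge0.
pose F (x : Tup * Omega) := expR (a * `|path j x.2 (t - vec x.1)|).
have mF : measurable_fun setT F.
  apply: measurableT_comp => //; apply: measurable_funM => //; apply: measurableT_comp => //.
  apply: (@measurable_random_path R d _ _ Omega (Tup * Omega)%type (path j) snd
    (fun x => t - vec x.1) (measurable_path_field j) (fun o => @path_continuous j o j0)) => //.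
  move=> k; under eq_fun do rewrite !mxE; apply: measurable_funB => //.
  by apply: (measurableT_comp (measurable_tnth k)).
have F0 x : 0 <= F x by exact: expR_ge0.
pose G (x : Tup * Omega) := (\1_(box r) x.1 * F x)%:E.
have mG : measurable_fun setT G.
  apply/measurable_EFinP/measurable_funM => //.
  have mI : measurable_fun setT (\1_(box r) : Tup -> R).
    by apply: measurable_indic; exact: measurable_box.
  exact: (measurableT_comp mI measurable_fst).
have G0 x : (0 <= G x)%E by rewrite lee_fin mulr_ge0.
have E1 o : ((expR (a * avg j t o))%:E <= c%:E * \int[leb]_s G (s, o))%E.
  have H := @expR_local_avg R d r (path j o) e0 (@path_continuous j o j0) (@path_periodic j o) a t a0.
  apply: (@le_trans _ _ (c * \int[leb]_(s in box r) expR (a * `|path j o (t - vec s)|))%:E).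
    by rewrite lee_fin.
  rewrite EFinM lee_wpmul2l ?lee_fin// /Rintegral.
  have iF : leb.-integrable (box r) (EFin \o (fun s => F (s, o))).
    have [[L HL] _ _] := continuous_periodic_nice (@path_continuous j o j0) (@path_periodic j o).
    apply: (box_integrable (K := expR (a * L))); first exact: ltW.
      exact: (measurableT_comp mF).
    by move=> s _; rewrite ger0_norm// ler_expR ler_wpM2l.
  rewrite fineK; last by apply: (integrable_fin_num _ iF); exact: measurable_box.
  rewrite -(ge0_integral_indicM leb (fun s => (F (s, o))%:E) (measurable_box r)).
  by rewrite le_eqVlt; apply/orP; left; apply/eqP; apply: eq_integral => s _; rewrite /G EFinM.
apply: (@le_trans _ _ (\int[P]_o (c%:E * \int[leb]_s G (s, o)))%E).
  apply: ge0_le_integral => //.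
  - apply/measurable_EFinP; apply: measurableT_comp => //; apply: measurable_funM => //.
    exact: (@measurable_random_avg R d _ _ Omega Omega (path j) id (fun=> t)
      (measurable_path_field j) (fun o => @path_continuous j o j0)).
  - apply: emeasurable_funM => //.
    exact: (@measurable_fun_fubini_tonelli_G _ _ Tup Omega R leb G mG G0).
rewrite ge0_integralZl//=; last 2 first.
- exact: (@measurable_fun_fubini_tonelli_G _ _ Tup Omega R leb G mG G0).
- by move=> o _; exact: integral_ge0.
rewrite -(@fubini_tonelli _ _ Tup Omega R leb P G mG G0).
apply: (@le_trans _ _ (c%:E * \int[leb]_s ((\1_(box r) s)%:E * B%:E))%E).
  rewrite lee_wpmul2l ?lee_fin//; apply: ge0_le_integral => //.
  - by move=> s _; exact: integral_ge0.
  - exact: (@measurable_fun_fubini_tonelli_F _ _ Tup Omega R P G mG G0).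
  - by apply: emeasurable_funM => //; apply/measurable_EFinP/measurable_indic; exact: measurable_box.
  - move=> s _; have mFs : measurable_fun setT (fun o => (F (s, o))%:E).
      by apply/measurable_EFinP; exact: (measurableT_comp mF).
    have -> : (\int[P]_o G (s, o) = (\1_(box r) s)%:E * \int[P]_o (F (s, o))%:E)%E.
      rewrite -ge0_integralZl ?lee_fin//; last by move=> o _; rewrite lee_fin.
    apply: lee_wpmul2l; first by rewrite lee_fin.
    exact: (path_exp_moment (t - vec s) a j0).
rewrite (ge0_integral_indicM leb (fun s => B%:E) (measurable_box r)).
have -> : (\int[leb]_(s in box r) B%:E = (B * (2 * r) ^+ d)%:E)%E.
  rewrite integral_cst//; last exact: measurable_box.
  by rewrite [RHS]EFinM; congr (_ * _)%E; exact: (lebesgue_box (ltW e0)).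
rewrite -EFinM lee_fin mulrCA /c mulVf ?mulr1//.
by rewrite expf_neq0// mulf_neq0 ?gt_eqF.
Qed.

End torus_fields.

Section field_moments.
Context {R : realType} {d : nat}.
Local Notation E := 'rV[R]_d.
Local Notation T := (torus R d).
Local Notation RR := (measurableTypeR R).
Local Notation Tup := (d.-tuple RR).
Local Notation leb := (@lebesgue_power R d).
Local Notation vec := (@vec_of_tuple R d).
Context {disp : measure_display} {Omega : measurableType disp}.
Variables (P : probability Omega R) (Phi Q : E -> R) (xi : nat -> T -> {RV P >-> R}).
Hypothesis aQ : admissible_Q Q.
(* Some direction, that is, a witness of d >= 1. *)
Variable i0 : 'I_d.
Hypothesis gf : gaussian_fields Phi xi.
Local Notation path := (path xi).
Local Notation avg := (avg xi).
Local Notation kernel := (kernel Q).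
Local Notation var0 := (@var0 R d Phi).

(** The smoothed field in angular coordinates, see psi_conv. *)
Definition smoothed (j : nat) (o : Omega) : E -> R := conv (kernel j) (path j o).

Lemma avg_ge0 j t o : (0 < j)%N -> 0 <= avg j t o.
Proof. by move=> j0; apply: local_avg_ge0; exact: eps_gt0. Qed.

(** Derivatives fall on the kernel at scale eps_j: each costs 1 / eps_j, and the
    remaining normalisation eps_j^-d is the one of the average. *)
Lemma smoothed_jet_bound (N : nat) : exists2 K, 0 <= K & forall j i b o t, (0 < j)%N -> (b <= N)%N ->
  `|dn i b (smoothed j o) t| <= K * (eps j) ^- b * avg j t o.
Proof.
have /choice[K0 HK0] : forall ib : 'I_d * nat, exists K, 0 <= K /\
    forall e u, 0 < e -> `|dn ib.1 ib.2 (rescale e Q) u| <= K * e ^- (d + ib.2).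
  move=> [i b]; have [K K0 HK] := rescale_bound i (Q_smooth aQ) (Q_support aQ) b.
  by exists K.
pose K1 := \sum_(i < d) \sum_(b < N.+1) K0 (i, nat_of_ord b).
have K00 i b : 0 <= K0 (i, b) by have [] := HK0 (i, b).
have K10 : 0 <= K1 by apply: sumr_ge0 => i _; apply: sumr_ge0 => b _.
exists (K1 * 2 ^+ d); first by rewrite mulr_ge0// exprn_ge0.
move=> j i b o t j0 bN; have e0 : 0 < eps j :> R := eps_gt0 j0.
have tk := kernel_test aQ i j0.
have cp : continuous (path j o) by exact: (path_continuous gf).
have pp : periodic_fun (path j o) := @path_periodic _ _ _ _ _ xi j o.
rewrite /smoothed (dn_conv e0 tk cp pp).
have HK u : `|dn i b (kernel j) u| <= K1 * (eps j) ^- (d + b).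
  apply: le_trans ((HK0 (i, b)).2 _ _ e0) _.
  rewrite ler_wpM2r ?invr_ge0 ?exprn_ge0 ?(ltW e0)//.
  have bN' : (b < N.+1)%N by [].
  rewrite /K1 (bigD1 i)//= (bigD1 (Ordinal bN'))//= -addrA lerDl addr_ge0//.
    by apply: sumr_ge0.
  by apply: sumr_ge0 => k _; apply: sumr_ge0.
apply: le_trans (conv_le e0 tk cp pp t HK) _.
rewrite -/(avg j t o) (exprMn d 2 (eps j)) (exprD (eps j) d b) le_eqVlt; apply/orP; left; apply/eqP.
have : eps j ^+ d != 0 :> R by rewrite expf_neq0 ?gt_eqF.
have : eps j ^+ b != 0 :> R by rewrite expf_neq0 ?gt_eqF.
move: (eps j ^+ d) (eps j ^+ b) (avg j t o) => x y z y0 x0; field.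
by rewrite x0 y0.
Qed.

Lemma tame_smoothed i j o : (0 < j)%N -> tame i (smoothed j o).
Proof.
move=> j0; apply: (tame_conv (eps_gt0 j0) (kernel_test aQ i j0)).
  exact: (path_continuous gf).
exact: path_periodic.
Qed.

Lemma continuous_kernel j : (0 < j)%N -> continuous (kernel j).
Proof.
move=> j0 u; rewrite /kernel /rescale.
apply: (@continuous_comp _ _ _ (fun u : E => Q ((eps j)^-1 *: u)) (fun x : R => (eps j) ^- d * x));
  last exact: mulrl_continuous.
apply: (@continuous_comp _ _ _ (fun u : E => (eps j)^-1 *: u) Q).
  exact: scaler_continuous.
have [cQ _] := Q_smooth aQ [::]; exact: cQ.
Qed.

Section joint_measurability.
Context {dS dA : measure_display} {S : measurableType dS} {A : measurableType dA}.
Variables (j : nat) (f : S -> Omega) (pr : A -> S) (w : A -> E).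
Hypothesis j0 : (0 < j)%N.
Hypothesis mf : forall t, measurable_fun setT (fun s => path j (f s) t).
Hypothesis mpr : measurable_fun setT pr.
Hypothesis mw : forall k, measurable_fun setT (fun a => w a 0 k).

Lemma measurable_smoothed : measurable_fun setT (fun a => smoothed j (f (pr a)) (w a)).
Proof.
apply: (@measurable_random_conv R d _ _ S A (fun s => path j (f s)) pr w mf
  (fun s => @path_continuous _ _ _ _ _ _ _ gf j (f s) j0)) => //.
by apply: measurable_continuous_vec; exact: continuous_kernel.
Qed.

Lemma measurable_avg : measurable_fun setT (fun a => avg j (w a) (f (pr a))).
Proof.
exact: (@measurable_random_avg R d _ _ S A (fun s => path j (f s)) pr w mf
  (fun s => @path_continuous _ _ _ _ _ _ _ gf j (f s) j0)).
Qed.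

End joint_measurability.

Lemma measurable_smoothed_omega j t : (0 < j)%N -> measurable_fun setT (fun o => smoothed j o t).
Proof.
move=> j0; exact: (@measurable_smoothed _ _ Omega Omega j id id (fun=> t) j0
  (measurable_path_field xi j)).
Qed.

Lemma measurable_avg_omega j t : (0 < j)%N -> measurable_fun setT (fun o => avg j t o).
Proof.
move=> j0; exact: (@measurable_avg _ _ Omega Omega j id id (fun=> t) j0
  (measurable_path_field xi j)).
Qed.

Lemma sqr_le_expR (x : R) : 0 <= x -> x ^+ 2 <= expR (2 * x).
Proof.
move=> x0; rewrite expRM_natl lerXn2r ?nnegrE ?expR_ge0//.
by apply: le_trans (expR_ge1Dx x); rewrite lerDr.
Qed.

Lemma path_square j t : (0 < j)%N -> (\int[P]_o (path j o t * path j o t)%:E = var0%:E)%E.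
Proof. by move=> j0; have := path_variance gf t j0; rewrite unlock. Qed.

Lemma psi_square_bound : exists2 C, 0 <= C & forall j t, (0 < j)%N ->
  (\int[P]_o (smoothed j o t ^+ 2)%:E <= C%:E)%E.
Proof.
have [K K0 HK] := smoothed_jet_bound 0.
exists (K ^+ 2 * (2 * expR (2 ^+ 2 * var0))).
  by rewrite mulr_ge0 ?sqr_ge0// mulr_ge0// expR_ge0.
move=> j t j0.
have mE : measurable_fun setT (fun o => (expR (2 * avg j t o))%:E).
  apply/measurable_EFinP; apply: measurableT_comp => //; apply: measurable_funM => //.
  exact: measurable_avg_omega.
apply: (@le_trans _ _ (\int[P]_o ((K ^+ 2)%:E * (expR (2 * avg j t o))%:E))%E).
  apply: ge0_le_integral => //.
  - by move=> o _; rewrite lee_fin sqr_ge0.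
  - by apply/measurable_EFinP; apply: measurable_funX; exact: measurable_smoothed_omega.
  - exact: emeasurable_funM.
  - move=> o _; rewrite -EFinM lee_fin -real_normK ?num_real//.
    apply: (@le_trans _ _ ((K * avg j t o) ^+ 2)).
      have ka : 0 <= K * avg j t o by apply: mulr_ge0 => //; exact: avg_ge0.
      rewrite lerXn2r ?nnegrE//.
      by have := HK j i0 0%N o t j0 isT; rewrite expr0 invr1 mulr1.
    by rewrite exprMn ler_wpM2l ?sqr_ge0// sqr_le_expR// avg_ge0.
rewrite ge0_integralZl//=; last by rewrite lee_fin sqr_ge0.
rewrite [leRHS]EFinM; apply: lee_wpmul2l; first by rewrite lee_fin sqr_ge0.
exact: (avg_exp_moment gf t j0).
Qed.

Lemma sqr_integrable_prod (Y Z : Omega -> R) (a b : R) :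
  measurable_fun setT Y -> measurable_fun setT Z ->
  (\int[P]_o (Y o * Y o)%:E <= a%:E)%E -> (\int[P]_o (Z o * Z o)%:E <= b%:E)%E ->
  (\int[P]_o `|(Y o * Z o)%:E| <= (a + b)%:E)%E.
Proof.
move=> mY mZ Ya Zb.
have p (U : Omega -> R) o : (0 <= (U o * U o)%:E)%E by rewrite lee_fin -expr2 sqr_ge0.
have m (U : Omega -> R) : measurable_fun setT U -> measurable_fun setT (fun o => (U o * U o)%:E).
  by move=> mU; apply/measurable_EFinP; exact: measurable_funM.
rewrite EFinD; apply: le_trans (leeD Ya Zb).
rewrite -ge0_integralD//=; [|exact: m|exact: m].
apply: ge0_le_integral => //.
- apply: (@measurableT_comp _ _ _ _ _ _ (@abse R) _ (fun o => (Y o * Z o)%:E)) => //.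
  by apply/measurable_EFinP; exact: measurable_funM.
- by apply: emeasurable_funD; exact: m.
- move=> o _; rewrite -EFinD lee_fin normrM -!expr2.
  rewrite -(real_normK (num_real (Y o))) -(real_normK (num_real (Z o))).
  have := normr_ge0 (Y o); have := normr_ge0 (Z o).
  have := sqr_ge0 (`|Y o| - `|Z o|).
  by move: `|Y o| `|Z o| => y z; nra.
Qed.

(** Fubini for the product measure; integrability holds because the field has
    bounded second moments and the kernel is bounded with bounded support. *)
Lemma expectation_conv j t (Z : Omega -> R) (b : R) : (0 < j)%N ->
  measurable_fun setT Z -> (\int[P]_o (Z o * Z o)%:E <= b%:E)%E ->
  (\int[P]_o (smoothed j o t * Z o)%:E =
   \int[leb]_s ((kernel j (vec s))%:E * \int[P]_o (path j o (t - vec s) * Z o)%:E))%E.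
Proof.
move=> j0 mZ Zb; have e0 : 0 < eps j :> R := eps_gt0 j0.
have tk := kernel_test aQ i0 j0.
have [K K0 HK] := test_kernel_bounded 0 tk.
have mk : measurable_fun setT (kernel j \o vec).
  by apply: measurable_continuous_vec; exact: continuous_kernel.
pose F (x : Tup * Omega) := (kernel j (vec x.1) * path j x.2 (t - vec x.1) * Z x.2)%:E.
have mp : measurable_fun setT (fun x : Tup * Omega => path j x.2 (t - vec x.1)).
  apply: (@measurable_random_path R d _ _ Omega (Tup * Omega)%type (path j) snd
    (fun x => t - vec x.1) (measurable_path_field xi j)
    (fun o => @path_continuous _ _ _ _ _ _ _ gf j o j0)) => //.
  move=> k; under eq_fun do rewrite !mxE; apply: measurable_funB => //.
  by apply: (measurableT_comp (measurable_tnth k)).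
have mF : measurable_fun setT F.
  apply/measurable_EFinP; apply: measurable_funM; last exact: (measurableT_comp mZ measurable_snd).
  by apply: measurable_funM => //; exact: (measurableT_comp mk measurable_fst).
have mpZ s : measurable_fun setT (fun o => (path j o (t - vec s) * Z o)%:E).
  by apply/measurable_EFinP; apply: measurable_funM => //; exact: measurable_path_field.
have b1 s : (\int[P]_o `|(path j o (t - vec s) * Z o)%:E| <= (var0 + b)%:E)%E.
  apply: (sqr_integrable_prod (measurable_path_field xi j (t - vec s)) mZ _ Zb).
  by rewrite path_square.
have kb s : `|kernel j (vec s)| <= K * \1_(box (eps j)) s.
  rewrite indicE; case: (boolP (s \in _)) => [_|]; first by rewrite mulr1; exact: (HK (vec s)).
  rewrite notin_setE => /not_box[k jr]; have [_ _ /(_ _ _ jr)] := tk 0%N.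
  by rewrite /dn/= => ->; rewrite normr0 mulr0.
have b0 : 0 <= var0 + b.
  by rewrite -lee_fin; apply: le_trans (b1 [tuple of nseq d 0]); exact: integral_ge0.
have iF : (leb \x P)%E.-integrable setT F.
  apply/integrable12ltyP => //.
  apply: (@le_lt_trans _ _ (\int[leb]_s ((K * (var0 + b) * \1_(box (eps j)) s)%:E))%E).
    apply: ge0_le_integral => //.
    - by move=> s _; exact: integral_ge0.
    - apply: (@measurable_fun_fubini_tonelli_F _ _ Tup Omega R P (abse \o F)).
        exact: measurableT_comp.
      by move=> x; exact: abse_ge0.
    - apply/measurable_EFinP; apply: measurable_funM => //; apply: measurable_indic.
      exact: measurable_box.
    - move=> s _.
      have EF o : (`|F (s, o)| = `|kernel j (vec s)|%:E * `|(path j o (t - vec s) * Z o)%:E|)%E.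
        by rewrite /F /= -EFinM -mulrA normrM.
      under eq_integral do rewrite EF.
      have mab : measurable_fun setT (fun o => `|(path j o (t - vec s) * Z o)%:E|)%E.
        by apply: (@measurableT_comp _ _ _ _ _ _ (@abse R)) => //; exact: mpZ.
      rewrite ge0_integralZl//.
      apply: (@le_trans _ _ ((K * \1_(box (eps j)) s)%:E * (var0 + b)%:E)%E).
        by apply: lee_pmul => //; rewrite ?lee_fin//; exact: integral_ge0.
      by rewrite -EFinM lee_fin mulrAC.
  apply: (integral_fune_lt_pinfty measurableT).
  exact: (integrable_box_indic (K * (var0 + b)) (ltW e0)).
transitivity (\int[P]_o \int[leb]_s F (s, o))%E.
  apply: eq_integral => o _; rewrite /smoothed /conv /F /= /Rintegral.
  have iK : leb.-integrable setT (EFin \o (fun s => kernel j (vec s) * path j o (t - vec s))).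
    have [[L HL] mL _] := continuous_periodic_nice (@path_continuous _ _ _ _ _ _ _ gf j o j0) (@path_periodic _ _ _ _ _ xi j o).
    have L0 : 0 <= L := le_trans (normr_ge0 _) (HL 0).
    apply: (box_supported_integrable (r := eps j) (K := K * L)); first exact: ltW.
      apply: (measurable_funM mk).
      apply: (@measurable_path_shift R d (path j o) (@path_continuous _ _ _ _ _ _ _ gf j o j0) _ Tup (fun s => t - vec s)) => k.
      under eq_fun do rewrite !mxE; apply: measurable_funB => //.
      exact: measurable_tnth.
    by move=> s; rewrite normrM mulrAC ler_pM.
  under [RHS]eq_integral do rewrite mulrC EFinM.
  rewrite integralZl// mulrC EFinM; congr (_ * _)%E.
  by rewrite fineK//; exact: integrable_fin_num.
rewrite -(@Fubini _ _ Tup Omega R leb P F iF).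
apply: eq_integral => s _; rewrite /F /=.
under eq_integral do rewrite -mulrA EFinM.
rewrite integralZl//; apply/integrableP; split => //.
by apply: le_lt_trans (b1 s) _; rewrite ltry.
Qed.

(** The covariance of the field depends only on the difference of the angles, and
    convolution preserves this stationarity. Both points are expanded by
    expectation_conv. *)
Lemma psi_square_const j t : (0 < j)%N ->
  (\int[P]_o (smoothed j o t * smoothed j o t)%:E = \int[P]_o (smoothed j o 0 * smoothed j o 0)%:E)%E.
Proof.
move=> j0; have [C C0 HC] := psi_square_bound.
have HC' u : (\int[P]_o (smoothed j o u * smoothed j o u)%:E <= C%:E)%E.
  by have := HC j u j0; under eq_integral do rewrite expr2.
suff H u : (\int[P]_o (smoothed j o u * smoothed j o u)%:E =
   \int[leb]_s ((kernel j (vec s))%:E * \int[leb]_s' ((kernel j (vec s'))%:E *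
      (calH Phi j (texp (vec s - vec s')))%:E)))%E by rewrite !H.
have mpsi : measurable_fun setT (fun o => smoothed j o u) by exact: measurable_smoothed_omega.
rewrite (expectation_conv u j0 mpsi (HC' u)); apply: eq_integral => s _; congr (_ * _)%E.
under eq_integral do rewrite mulrC.
rewrite (expectation_conv u j0 (measurable_path_field xi j (u - vec s)) (b := var0)); last first.
  by rewrite path_square.
apply: eq_integral => s' _; congr (_ * _)%E.
have := path_covariance gf (u - vec s') (u - vec s) j0; rewrite unlock => ->.
by rewrite opprB addrC addrA addrNK.
Qed.

End field_moments.

(** * One chaos factor and its moments *)

Section chaos_factors.
Context {R : realType} {d : nat}.
Local Notation E := 'rV[R]_d.
Local Notation T := (torus R d).
Local Notation leb := (@lebesgue_power R d).
Local Notation vec := (@vec_of_tuple R d).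
Context {disp : measure_display} {Omega : measurableType disp}.
Variables (P : probability Omega R) (Phi Q : E -> R) (xi : nat -> T -> {RV P >-> R}).
Hypothesis aQ : admissible_Q Q.
Variable i0 : 'I_d.
Hypothesis gf : gaussian_fields Phi xi.
Variables (gamma p : R).
Hypothesis gamma0 : 0 < gamma.
Hypothesis p12 : 1 < p <= 2.
Local Notation avg := (avg xi).
Local Notation smoothed := (smoothed Q xi).
Local Notation var0 := (@var0 R d Phi).

(** Half the variance of gamma psi_j, taken at the origin thanks to stationarity. *)
Definition drift (j : nat) : R :=
  gamma ^+ 2 / 2 * fine (\int[P]_o (smoothed j o 0 * smoothed j o 0)%:E)%E.

Definition chaos (j : nat) (o : Omega) (t : E) : R := expR (gamma * smoothed j o t - drift j).

(** Stationarity makes the normalising constant independent of the point. *)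
Lemma X_chaos j t o : (0 < j)%N -> X_ gamma Q xi j (texp t) o = chaos j o t.
Proof.
move=> j0; rewrite /X_ /chaos (psi_conv xi aQ)//; congr (expR (_ - _ * fine _)).
rewrite -(psi_square_const aQ i0 gf t j0) unlock.
by apply: eq_integral => w _; rewrite (psi_conv xi aQ)// expr2.
Qed.

Lemma drift_bound : exists2 C, 0 <= C & forall j, (0 < j)%N -> 0 <= drift j <= C.
Proof.
have [C C0 HC] := psi_square_bound aQ i0 gf.
exists (gamma ^+ 2 / 2 * C); first by rewrite mulr_ge0// divr_ge0// sqr_ge0.
move=> j j0; have g0 : 0 <= gamma ^+ 2 / 2 by rewrite divr_ge0// sqr_ge0.
have I0 : (0 <= \int[P]_o (smoothed j o 0 * smoothed j o 0)%:E)%E.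
  by apply: integral_ge0 => o _; rewrite lee_fin -expr2 sqr_ge0.
have IC : (\int[P]_o (smoothed j o 0 * smoothed j o 0)%:E <= C%:E)%E.
  by have := HC j 0 j0; under eq_integral do rewrite expr2.
rewrite /drift mulr_ge0 ?fine_ge0//= ler_wpM2l// -lee_fin fineK//.
by rewrite ge0_fin_numE// (le_lt_trans IC)// ltry.
Qed.

Lemma chaos_gt0 j o t : 0 < chaos j o t. Proof. exact: expR_gt0. Qed.

Lemma chaos_powR j o t : chaos j o t `^ p = expR ((gamma * smoothed j o t - drift j) * p).
Proof. by rewrite expRM. Qed.

Lemma measurable_chaos j t : (0 < j)%N -> measurable_fun setT (fun o => chaos j o t).
Proof.
move=> j0; apply: measurableT_comp => //; apply: measurable_funB => //.
by apply: measurable_funM => //; exact: (measurable_smoothed_omega aQ gf).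
Qed.

Lemma measurable_chaos_powR j t : (0 < j)%N ->
  measurable_fun setT (fun o => (chaos j o t `^ p)%:E).
Proof.
move=> j0; apply/measurable_EFinP.
exact: (measurableT_comp (measurable_powR p) (measurable_chaos t j0)).
Qed.

Lemma chaos_le_avg : exists2 K, 0 <= K & forall j o t, (0 < j)%N ->
  `|smoothed j o t| <= K * avg j t o.
Proof.
have [K K0 HK] := smoothed_jet_bound aQ gf 0; exists K => // j o t j0.
by have := HK j i0 0%N o t j0 isT; rewrite expr0 invr1 mulr1.
Qed.

(** With y = log (X_j^p), exp y >= exp (- A) (1 + y + A) for every A; choose for
    A an upper bound of E|y|, which is uniform in j and t. *)
Lemma chaos_moment_lower : exists2 c, 0 < c & forall j t, (0 < j)%N ->
  (c%:E <= \int[P]_o (chaos j o t `^ p)%:E)%E.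
Proof.
have [K K0 HK] := chaos_le_avg; have [C C0 HC] := drift_bound.
have p0 : 0 <= p by move: p12 => /andP[h1 _]; lra.
pose a := p * gamma * K; have a0 : 0 <= a by rewrite !mulr_ge0// ltW.
(* A bounds the expectation of | log (X_j^p) |. *)
pose A := 2 * expR (a ^+ 2 * var0) + p * C.
exists (expR (- A)); first exact: expR_gt0.
move=> j t j0; pose y o := (gamma * smoothed j o t - drift j) * p.
have my : measurable_fun setT y.
  apply: measurable_funM => //; apply: measurable_funB => //.
  by apply: measurable_funM => //; exact: (measurable_smoothed_omega aQ gf).
have mE : measurable_fun setT (fun o => (expR (a * avg j t o))%:E).
  apply/measurable_EFinP; apply: measurableT_comp => //; apply: measurable_funM => //.
  exact: (measurable_avg_omega gf).
have yb o : `|y o| <= expR (a * avg j t o) + p * C.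
  have /andP[d0 dC] := HC j j0.
  rewrite /y normrM (ger0_norm p0) mulrC.
  apply: (@le_trans _ _ (p * (gamma * (K * avg j t o) + C))).
    rewrite ler_wpM2l// (le_trans (ler_normB _ _))// normrM (gtr0_norm gamma0) lerD//.
      by rewrite ler_wpM2l ?(ltW gamma0)// HK.
    by rewrite ger0_norm.
  rewrite mulrDr lerD2r; apply: le_trans (expR_ge1Dx _).
  by rewrite /a !mulrA lerDr.
have mya : measurable_fun setT (fun o => `|(y o)%:E|)%E.
  by apply: (@measurableT_comp _ _ _ _ _ _ (@abse R)) => //; exact/measurable_EFinP.
have eA0 : (0 <= (expR (- A))%:E)%E by rewrite lee_fin expR_ge0.
have Ey : (\int[P]_o `|(y o)%:E| <= A%:E)%E.
  apply: (@le_trans _ _ (\int[P]_o ((expR (a * avg j t o))%:E + (p * C)%:E))%E).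
    apply: ge0_le_integral => //.
    - exact: emeasurable_funD.
    - by move=> o _; rewrite -EFinD lee_fin yb.
  rewrite ge0_integralD//; last by move=> o _; rewrite lee_fin mulr_ge0.
  rewrite integral_cst//= probability_setT mule1 /A EFinD; apply: leeD => //.
  exact: (avg_exp_moment gf).
have A0 : 0 <= A by rewrite addr_ge0 ?mulr_ge0// expR_ge0.
have I2 : (\int[P]_o ((expR (- A))%:E * `|(y o)%:E|) <= (expR (- A) * A)%:E)%E.
  rewrite ge0_integralZl//.
  by rewrite EFinM; apply: lee_wpmul2l => //; rewrite lee_fin expR_ge0.
have pc o : (0 <= (chaos j o t `^ p)%:E)%E by rewrite lee_fin powR_ge0.
have mc := measurable_chaos_powR t j0.
have pya o : (0 <= (expR (- A))%:E * `|(y o)%:E|)%E by rewrite mule_ge0.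
have I3 : ((expR (- A) * (1 + A))%:E <=
   \int[P]_o ((chaos j o t `^ p)%:E + (expR (- A))%:E * `|(y o)%:E|))%E.
  have -> : ((expR (- A) * (1 + A))%:E = \int[P]_o (cst (expR (- A) * (1 + A))%:E o : \bar R))%E.
    by rewrite integral_cst//= probability_setT mule1.
  apply: ge0_le_integral => //.
  - by move=> o _; rewrite /= lee_fin mulr_ge0 ?expR_ge0// addr_ge0.
  - apply: emeasurable_funD; first exact: measurable_chaos_powR.
    exact: emeasurable_funM.
  - move=> o _ /=; rewrite -EFinM -EFinD lee_fin chaos_powR -/(y o).
    rewrite -lerBlDr -mulrBr.
    apply: (@le_trans _ _ (expR (- A) * (1 + (y o + A)))).
      rewrite ler_wpM2l ?expR_ge0//; have := ler_norm (- y o); rewrite normrN; lra.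
    apply: (@le_trans _ _ (expR (- A) * expR (y o + A))); last by rewrite -expRD addrC addrK.
    by rewrite ler_wpM2l ?expR_ge0// expR_ge1Dx.
have : ((expR (- A) * (1 + A))%:E <= \int[P]_o (chaos j o t `^ p)%:E + (expR (- A) * A)%:E)%E.
  apply: le_trans I3 _; rewrite ge0_integralD//=.
  - by apply: leeD.
  - exact: emeasurable_funM.
by rewrite mulrDr mulr1 EFinD leeD2rE.
Qed.

Lemma tame_log_chaos i j o : (0 < j)%N -> tame i (fun t => gamma * smoothed j o t - drift j).
Proof.
move=> j0; apply: (@tameD _ _ i (cst gamma \* smoothed j o) (cst (- drift j))); last exact: tame_cst.
by apply: tameM; [exact: tame_cst|exact: (tame_smoothed aQ gf)].
Qed.

Lemma tame_chaos i j o : (0 < j)%N -> tame i (chaos j o).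
Proof. by move=> j0; apply: tame_exp; exact: tame_log_chaos. Qed.

(** In the sum of jnorm_exp the term of order c is at most a multiple of
    (eps_j^-1 / M)^c avg, and as eps_j^-1 / M <= 1 one power can be kept.
    This one power is what makes the corrections summable over j. *)
Lemma chaos_jnorm (N : nat) : exists2 K, 0 <= K & forall i j o t M, (0 < j)%N -> (eps j)^-1 <= M ->
  jnorm i M N (chaos j o) t <= chaos j o t * (1 + K * ((eps j)^-1 / M) * avg j t o) ^+ N.
Proof.
have [K K0 HK] := smoothed_jet_bound aQ gf N.
exists (N%:R * (gamma * K)); first by rewrite !mulr_ge0// ltW.
move=> i j o t M j0 eM; have e0 : 0 < (eps j)^-1 :> R by rewrite invr_gt0 eps_gt0.
have M0 : 0 < M := lt_le_trans e0 eM.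
have tp := tame_smoothed aQ gf i o j0.
have a0 := avg_ge0 xi t o j0.
pose S t := gamma * smoothed j o t - drift j.
have tS : tame i S by exact: tame_log_chaos.
have dS c u : dn i c.+1 S u = gamma * dn i c.+1 (smoothed j o) u.
  have -> : S = (gamma \*: smoothed j o) \+ cst (- drift j) by [].
  rewrite dnD; last exact: tame_cst; last first.
    rewrite (_ : _ \*: _ = cst gamma \* smoothed j o)//.
    by apply: tameM => //; exact: tame_cst.
  by rewrite dn_cst dnZ//= addr0.
set dl := (eps j)^-1 / M.
have dl01 : 0 <= dl <= 1.
  apply/andP; split; first by rewrite /dl divr_ge0// ltW.
  by rewrite /dl ler_pdivrMr// mul1r.
move: dl01 => /andP[dl0 dl1].
have dlE n : dl ^+ n = (eps j) ^- n * M ^- n by rewrite /dl exprMn -!exprVn.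
clearbody dl.
apply: le_trans (jnorm_exp N t M0 tS) _.
rewrite -[S t]/(gamma * smoothed j o t - drift j) -/(chaos j o t) ler_wpM2l ?(ltW (chaos_gt0 _ _ _))//.
have s0 : 0 <= \sum_(c < N) c.+1%:R * `|tc i c.+1 S t| / M ^+ c.+1.
  by apply: sumr_ge0 => c _; rewrite !mulr_ge0// invr_ge0 exprn_ge0// ltW.
have u0 : 0 <= N%:R * (gamma * K) * dl * avg j t o.
  by apply: mulr_ge0 => //; apply: mulr_ge0 => //; rewrite !mulr_ge0// ltW.
rewrite lerXn2r ?nnegrE ?addr_ge0// lerD2l.
apply: (@le_trans _ _ (\sum_(c < N) (gamma * K * dl * avg j t o))); last first.
  rewrite sumr_const card_ord -[_ *+ N]mulr_natl le_eqVlt; apply/orP; left; apply/eqP.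
  by ring.
apply: ler_sum => -[c cN] _ /=.
rewrite /tc normrM dS normrM (gtr0_norm gamma0).
have f1 : 0 < (c.+1)`!%:R :> R by rewrite ltr0n fact_gt0.
rewrite (@gtr0_norm _ ((c.+1)`!%:R^-1)) ?invr_gt0//.
apply: (@le_trans _ _ (gamma * `|dn i c.+1 (smoothed j o) t| / M ^+ c.+1)).
  rewrite ler_wpM2r ?invr_ge0 ?exprn_ge0 ?(ltW M0)//.
  rewrite mulrCA -[leRHS]mulr1 ler_wpM2l// ?mulr_ge0 ?(ltW gamma0)//.
  by rewrite ler_pdivrMr// mul1r ler_nat -{1}[c.+1]muln1 factS leq_mul ?fact_gt0.
rewrite -!mulrA ler_wpM2l ?(ltW gamma0)//.
apply: (@le_trans _ _ (K * (eps j) ^- c.+1 * avg j t o / M ^+ c.+1)).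
  by rewrite ler_wpM2r ?invr_ge0 ?exprn_ge0 ?(ltW M0)// HK.
have -> : K * (eps j) ^- c.+1 * avg j t o / M ^+ c.+1 = K * (dl ^+ c.+1 * avg j t o).
  rewrite dlE.
  by move: ((eps j) ^- c.+1) (M ^- c.+1) => x y; ring.
rewrite ler_wpM2l// ler_wpM2r// exprS ler_piMr//.
by rewrite exprn_ile1.
Qed.

End chaos_factors.

Section chaos_moments.
Context {R : realType} {d : nat}.
Local Notation E := 'rV[R]_d.
Local Notation T := (torus R d).
Context {disp : measure_display} {Omega : measurableType disp}.
Variables (P : probability Omega R) (Phi Q : E -> R) (xi : nat -> T -> {RV P >-> R}).
Hypothesis aQ : admissible_Q Q.
Variable i0 : 'I_d.
Hypothesis gf : gaussian_fields Phi xi.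
Variables (gamma p : R).
Hypothesis gamma0 : 0 < gamma.
Hypothesis p12 : 1 < p <= 2.
Local Notation avg := (avg xi).
Local Notation chaos := (chaos Q xi gamma).
Local Notation var0 := (@var0 R d Phi).

Let p_ge0 : 0 <= p. Proof. by move: p12 => /andP[h _]; lra. Qed.

Definition chaos_moment (j : nat) (t : E) : \bar R := (\int[P]_o (chaos j o t `^ p)%:E)%E.

Lemma powR_le_sqr (a : R) : 1 <= a -> a `^ p <= a ^+ 2.
Proof.
move=> a1; have a0 : 0 <= a by lra.
by rewrite -powR_mulrn//; apply: ler_powR => //; move: p12 => /andP[].
Qed.

(** Convexity in dl of the left-hand side: the chord between dl = 0 and dl = 1. *)
Lemma expr_interpolate (dl x : R) n : 0 <= dl <= 1 -> 0 <= x ->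
  (1 + dl * x) ^+ n <= 1 + dl * ((1 + x) ^+ n - 1).
Proof.
move=> /andP[d0 d1] x0; elim: n => [|n IH]; first by rewrite !expr0 subrr mulr0 addr0.
have A1 : 1 <= (1 + x) ^+ n by rewrite exprn_ege1// lerDl.
rewrite exprS [(1 + x) ^+ n.+1]exprS.
apply: (@le_trans _ _ ((1 + dl * x) * (1 + dl * ((1 + x) ^+ n - 1)))).
  by rewrite ler_wpM2l// addr_ge0// mulr_ge0.
move: ((1 + x) ^+ n) A1 => A A1; rewrite -subr_ge0.
have -> : 1 + dl * ((1 + x) * A - 1) - (1 + dl * x) * (1 + dl * (A - 1)) =
   dl * (1 - dl) * (x * (A - 1)) by ring.
by rewrite mulr_ge0 ?mulr_ge0 ?subr_ge0.
Qed.

Lemma chaos_upper : exists2 K, 0 <= K & forall j o t, (0 < j)%N ->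
  chaos j o t <= expR (K * avg j t o).
Proof.
have [K K0 HK] := chaos_le_avg aQ i0 gf; have [C C0 HC] := drift_bound aQ i0 gf gamma.
exists (gamma * K); first by rewrite mulr_ge0// ltW.
move=> j o t j0; rewrite ler_expR lerBlDr -mulrA.
apply: (@le_trans _ _ (gamma * (K * avg j t o))); last by rewrite lerDl; have /andP[] := HC j j0.
by rewrite ler_wpM2l ?(ltW gamma0)// (le_trans (ler_norm _))// HK.
Qed.

Lemma exp_avg_moment a : 0 <= a -> exists2 C, 0 <= C & forall j t, (0 < j)%N ->
  (\int[P]_o (expR (a * avg j t o))%:E <= C%:E)%E.
Proof.
move=> a0; exists (2 * expR (a ^+ 2 * var0)); first by rewrite mulr_ge0// expR_ge0.
by move=> j t j0; exact: (avg_exp_moment gf).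
Qed.

Lemma measurable_exp_avg a j t : (0 < j)%N ->
  measurable_fun setT (fun o => (expR (a * avg j t o))%:E).
Proof.
move=> j0; apply/measurable_EFinP; apply: measurableT_comp => //; apply: measurable_funM => //.
exact: (measurable_avg_omega gf).
Qed.

(** The bound of chaos_jnorm for the level j, with dl = eps_k / eps_j. *)
Definition factor (kp dl : R) (N : nat) (j : nat) (o : Omega) (t : E) : R :=
  chaos j o t * (1 + kp * dl * avg j t o) ^+ N.

Lemma factor_ge0 kp dl N j o t : (0 < j)%N -> 0 <= kp -> 0 <= dl -> 0 <= factor kp dl N j o t.
Proof.
move=> j0 k0 d0; rewrite mulr_ge0 ?(ltW (chaos_gt0 _ _ _ _ _ _))// exprn_ge0// addr_ge0//.
by apply: mulr_ge0; [exact: mulr_ge0|exact: avg_ge0].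
Qed.

Lemma measurable_factor kp dl N j t : (0 < j)%N ->
  measurable_fun setT (fun o => factor kp dl N j o t).
Proof.
move=> j0; apply: measurable_funM; first exact: (measurable_chaos aQ gf).
apply: measurable_funX; apply: measurable_funD => //; apply: measurable_funM => //.
exact: (measurable_avg_omega gf).
Qed.

(** Since p <= 2, the p-th power of the polynomial factor is at most its square,
    which exceeds 1 by at most dl times an exponential of avg. The excess has
    expectation O(dl), hence O(dl) E[X_j^p] as E[X_j^p] is bounded below. *)
Lemma factor_moment kp N : 0 <= kp -> exists2 C, 0 <= C & forall j t dl, (0 < j)%N -> 0 <= dl <= 1 ->
  (\int[P]_o (factor kp dl N j o t `^ p)%:E <= chaos_moment j t * (1 + C * dl)%:E)%E.
Proof.
move=> kp0; have [K K0 HK] := chaos_upper.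
have [c c0 Hc] := chaos_moment_lower aQ i0 gf gamma0 p12.
(* exp (a avg) dominates X^2 (1 + kp avg)^(2 N). *)
pose a := 2 * K + (2 * N)%:R * kp.
have a0 : 0 <= a by rewrite addr_ge0 ?mulr_ge0.
have [C1 C10 HC1] := exp_avg_moment a0.
exists (C1 / c); first by rewrite divr_ge0// ltW.
move=> j t dl j0 /andP[d0 d1].
have mX := measurable_chaos_powR aQ gf gamma p t j0.
have mE := measurable_exp_avg a t j0.
have pX o : (0 <= (chaos j o t `^ p)%:E)%E by rewrite lee_fin powR_ge0.
have pE o : (0 <= (expR (a * avg j t o))%:E)%E by rewrite lee_fin expR_ge0.
apply: (@le_trans _ _ (\int[P]_o ((chaos j o t `^ p)%:E + dl%:E * (expR (a * avg j t o))%:E))%E).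
  apply: ge0_le_integral => //.
  - by move=> o _; rewrite lee_fin powR_ge0.
  - apply/measurable_EFinP; apply: (measurableT_comp (measurable_powR p)).
    exact: measurable_factor.
  - by apply: emeasurable_funD => //; exact: emeasurable_funM.
  - move=> o _; rewrite -EFinM -EFinD lee_fin /factor.
    have av0 := avg_ge0 xi t o j0.
    set x := kp * avg j t o; have x0 : 0 <= x by exact: mulr_ge0.
    have -> : 1 + kp * dl * avg j t o = 1 + dl * x by rewrite /x; ring.
    have Y1 : 1 <= 1 + dl * x by rewrite lerDl mulr_ge0.
    have YN : 1 <= (1 + dl * x) ^+ N by exact: exprn_ege1.
    have X0 : 0 <= chaos j o t by exact: expR_ge0.
    rewrite powRM//; last by lra.
    apply: (@le_trans _ _ (chaos j o t `^ p * (1 + dl * ((1 + x) ^+ (2 * N) - 1)))).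
      rewrite ler_wpM2l ?powR_ge0// (le_trans (powR_le_sqr YN))//.
      by rewrite -exprM mulnC; apply: expr_interpolate => //; apply/andP.
    rewrite mulrDr mulr1 lerD2l mulrCA ler_wpM2l//.
    apply: (@le_trans _ _ (expR (K * avg j t o) ^+ 2 * expR x ^+ (2 * N))).
      apply: ler_pM; rewrite ?powR_ge0//.
      + by rewrite subr_ge0 exprn_ege1// lerDl.
      + apply: (@le_trans _ _ (expR (K * avg j t o) `^ p)).
          by apply: ge0_ler_powR; rewrite ?nnegrE ?expR_ge0//; exact: HK.
        apply: powR_le_sqr; rewrite -expR0 ler_expR; exact: mulr_ge0.
      + apply: (@le_trans _ _ ((1 + x) ^+ (2 * N))); first by rewrite lerBlDr lerDl.
        by rewrite lerXn2r ?nnegrE ?addr_ge0 ?expR_ge0// expR_ge1Dx.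
    rewrite -!expRM_natl -expRD ler_expR /a /x le_eqVlt; apply/orP; left; apply/eqP.
    by ring.
rewrite ge0_integralD//=; last 2 first.
- by move=> o _; rewrite mule_ge0.
- exact: emeasurable_funM.
have Cd0 : 0 <= C1 / c * dl by rewrite mulr_ge0// divr_ge0// ltW.
rewrite ge0_integralZl// -/(chaos_moment j t) EFinD [leRHS]ge0_muleDr//.
rewrite mule1; apply: leeD => //.
apply: (@le_trans _ _ (dl%:E * C1%:E)%E).
  by apply: lee_wpmul2l => //; exact: HC1.
have -> : (dl%:E * C1%:E = c%:E * (C1 / c * dl)%:E)%E.
  by rewrite -!EFinM; congr EFin; field; rewrite gt_eqF.
apply: lee_wpmul2r => //.
exact: Hc.
Qed.

(** The last level carries X_k - 1, whose jet is bounded by that of X_k plus 1. *)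
Lemma last_factor_moment kp N : 0 <= kp -> exists2 C, 0 <= C & forall j t, (0 < j)%N ->
  (\int[P]_o ((factor kp 1 N j o t + 1) `^ p)%:E <= chaos_moment j t * C%:E)%E.
Proof.
move=> kp0; have [K K0 HK] := chaos_upper.
have [c c0 Hc] := chaos_moment_lower aQ i0 gf gamma0 p12.
pose b := K + N%:R * kp; have b0 : 0 <= b by rewrite addr_ge0 ?mulr_ge0.
pose a := 2 * b; have a0 : 0 <= a by rewrite mulr_ge0.
have [C1 C10 HC1] := exp_avg_moment a0.
exists (4 * C1 / c); first by rewrite divr_ge0 ?mulr_ge0// ltW.
move=> j t j0.
have mE := measurable_exp_avg a t j0.
have pE o : (0 <= (expR (a * avg j t o))%:E)%E by rewrite lee_fin expR_ge0.
apply: (@le_trans _ _ (\int[P]_o (4%:E * (expR (a * avg j t o))%:E))%E).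
  apply: ge0_le_integral => //.
  - by move=> o _; rewrite lee_fin powR_ge0.
  - apply/measurable_EFinP; apply: (measurableT_comp (measurable_powR p)).
    by apply: measurable_funD => //; exact: measurable_factor.
  - exact: emeasurable_funM.
  - move=> o _; rewrite -EFinM lee_fin.
    have av0 := avg_ge0 xi t o j0.
    have f0 : 0 <= factor kp 1 N j o t by exact: factor_ge0.
    have le1 : 1 <= expR (b * avg j t o) by rewrite -[leLHS]expR0 ler_expR mulr_ge0.
    have fb : factor kp 1 N j o t <= expR (b * avg j t o).
      rewrite /b mulrDl expRD /factor; apply: ler_pM.
      + exact: expR_ge0.
      + by rewrite exprn_ge0// addr_ge0//; apply: mulr_ge0 => //; rewrite mulr1.
      + exact: HK.
      + rewrite mulr1 -mulrA expRM_natl lerXn2r ?nnegrE ?expR_ge0//; last exact: expR_ge1Dx.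
        by apply: addr_ge0 => //; exact: mulr_ge0.
    apply: le_trans (powR_le_sqr _) _; first by rewrite lerDr.
    apply: (@le_trans _ _ ((2 * expR (b * avg j t o)) ^+ 2)).
      rewrite lerXn2r ?nnegrE ?mulr_ge0 ?expR_ge0//; last by lra.
      by apply: addr_ge0.
    rewrite exprMn -expRM_natl /a mulrA le_eqVlt; apply/orP; left; apply/eqP.
    by congr (_ * _); rewrite expr2; ring.
rewrite ge0_integralZl//.
apply: (@le_trans _ _ (4%:E * C1%:E)%E); first by apply: lee_wpmul2l => //; exact: HC1.
have -> : (4%:E * C1%:E = c%:E * (4 * C1 / c)%:E :> \bar R)%E.
  by rewrite -!EFinM; congr EFin; field; rewrite gt_eqF.
apply: lee_wpmul2r; first by rewrite lee_fin divr_ge0 ?mulr_ge0// ltW.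
exact: Hc.
Qed.

Lemma chaos_moment_fin j t : (0 < j)%N -> chaos_moment j t \is a fin_num.
Proof.
move=> j0; have [K K0 HK] := chaos_upper.
have a0 : 0 <= 2 * K by rewrite mulr_ge0.
have [C1 C10 HC1] := exp_avg_moment a0.
rewrite ge0_fin_numE; last by apply: integral_ge0 => o _; rewrite lee_fin powR_ge0.
apply: le_lt_trans (ltry C1); apply: le_trans (HC1 j t j0).
apply: ge0_le_integral => //.
- by move=> o _; rewrite lee_fin powR_ge0.
- exact: (measurable_chaos_powR aQ gf).
- exact: measurable_exp_avg.
- move=> o _; rewrite lee_fin.
  apply: (@le_trans _ _ (expR (K * avg j t o) `^ p)).
    by apply: ge0_ler_powR; rewrite ?nnegrE ?expR_ge0//; exact: HK.
  rewrite -mulrA expRM_natl; apply: powR_le_sqr.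
  by rewrite -[leLHS]expR0 ler_expR mulr_ge0// avg_ge0.
Qed.

End chaos_moments.

(** * The product over all scales *)

Lemma powR_prod {R : realType} (I : eqType) (l : seq I) (F : I -> R) (p : R) :
  (forall j, j \in l -> 0 <= F j) -> (\prod_(j <- l) F j) `^ p = \prod_(j <- l) F j `^ p.
Proof.
elim: l => [|j l IH] F0; first by rewrite !big_nil powR1.
have F0l k : k \in l -> 0 <= F k by move=> kl; apply: F0; rewrite inE kl orbT.
rewrite !big_cons powRM ?IH//; first by apply: F0; rewrite mem_head.
by rewrite big_seq; exact: prodr_ge0.
Qed.

Section product_moments.
Context {R : realType} {d : nat}.
Local Notation E := 'rV[R]_d.
Local Notation T := (torus R d).
Local Notation leb := (@lebesgue_power R d).
Local Notation vec := (@vec_of_tuple R d).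
Local Notation Tup := (d.-tuple (measurableTypeR R)).
Context {disp : measure_display} {Omega : measurableType disp}.
Variables (P : probability Omega R) (Phi Q : E -> R) (xi : nat -> T -> {RV P >-> R}).
Hypothesis aQ : admissible_Q Q.
Variable i0 : 'I_d.
Hypothesis gf : gaussian_fields Phi xi.
Variables (gamma p : R).
Hypothesis gamma0 : 0 < gamma.
Hypothesis p12 : 1 < p <= 2.
Local Notation avg := (avg xi).
Local Notation factor := (factor Q xi gamma).
Local Notation chaos_moment := (chaos_moment Q xi gamma p).
Local Notation chaos := (chaos Q xi gamma).

Definition scale (k : nat) : R := k%:R ^+ 2 * 2 ^+ k.

Lemma scale_gt0 k : (0 < k)%N -> 0 < scale k.
Proof. by move=> k0; rewrite mulr_gt0// exprn_gt0// ltr0n. Qed.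

Lemma scaleE k : (eps k)^-1 = scale k.
Proof. by rewrite epsE invrK. Qed.

Definition ratio (j k : nat) : R := scale j / scale k.

Lemma ratio_ge0 j k : 0 <= ratio j k.
Proof. by rewrite divr_ge0// mulr_ge0// exprn_ge0. Qed.

Lemma ratio_le j k : (0 < k)%N -> (j <= k)%N -> ratio j k <= 2 ^+ j / 2 ^+ k.
Proof.
move=> k0 jk; rewrite /ratio /scale.
have kk : 0 < k%:R :> R by rewrite ltr0n.
have x0 : 0 < 2 ^+ k :> R by rewrite exprn_gt0.
rewrite invfM mulrACA ler_piMl//.
by rewrite ler_pdivrMr ?exprn_gt0// mul1r lerXn2r ?nnegrE// ler_nat.
Qed.

Lemma ratio_le1 j k : (0 < k)%N -> (j <= k)%N -> ratio j k <= 1.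
Proof.
move=> k0 jk; apply: le_trans (ratio_le k0 jk) _.
by rewrite ler_pdivrMr ?exprn_gt0// mul1r ler_eXn2l// ltr1n.
Qed.

Lemma ratio_id k : (0 < k)%N -> ratio k k = 1.
Proof. by move=> k0; rewrite /ratio mulfV// gt_eqF// scale_gt0. Qed.

Lemma sum_ratio k : (0 < k)%N -> \sum_(1 <= j < k) ratio j k <= 1.
Proof.
move=> k0.
have S m : \sum_(1 <= j < m) 2 ^+ j <= 2 ^+ m :> R.
  elim: m => [|m IH]; first by rewrite big_geq.
  case: m IH => [|m] IH; first by rewrite big_geq// exprn_ge0.
  rewrite big_nat_recr//= (exprS _ m.+1); lra.
apply: (@le_trans _ _ (\sum_(1 <= j < k) 2 ^+ j / 2 ^+ k)).
  rewrite big_nat [leRHS]big_nat; apply: ler_sum => j /andP[_ jk].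
  by apply: ratio_le => //; exact: ltnW.
by rewrite -mulr_suml ler_pdivrMr ?exprn_gt0// mul1r.
Qed.

(** The extra term 1 at j = k accounts for X_k - 1. *)
Definition level_factor (kp : R) (N k j : nat) (o : Omega) (t : E) : R :=
  factor kp (ratio j k) N j o t + (j == k)%:R.

Lemma level_factor_ge0 kp N k j o t : (0 < j)%N -> 0 <= kp -> 0 <= level_factor kp N k j o t.
Proof. by move=> j0 kp0; rewrite addr_ge0// factor_ge0// ratio_ge0. Qed.

Section joint.
Context {d1 d2} {S : measurableType d1} {A : measurableType d2}.
Variables (j : nat) (f : S -> Omega) (pr : A -> S) (w : A -> E).
Hypothesis j0 : (0 < j)%N.
Hypothesis mf : forall x, measurable_fun setT (fun s => path xi j (f s) x).
Hypothesis mpr : measurable_fun setT pr.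
Hypothesis mw : forall i, measurable_fun setT (fun a => w a 0 i).

Lemma measurable_level_factor kp N k : measurable_fun setT (fun a => level_factor kp N k j (f (pr a)) (w a)).
Proof.
apply: measurable_funD => //; apply: measurable_funM.
  apply: measurableT_comp => //; apply: measurable_funB => //; apply: measurable_funM => //.
  exact: (measurable_smoothed aQ gf).
apply: measurable_funX; apply: measurable_funD => //; apply: measurable_funM => //.
exact: (measurable_avg gf).
Qed.

End joint.

Definition growth (kp : R) (N k : nat) (o : Omega) (t : E) : R :=
  \prod_(1 <= j < k.+1) level_factor kp N k j o t.

Lemma growth_ge0 kp N k o t : 0 <= kp -> 0 <= growth kp N k o t.
Proof.
move=> kp0; rewrite /growth big_nat; apply: prodr_ge0 => j /andP[j0 _]; exact: level_factor_ge0.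
Qed.

Lemma measurable_growth kp N k :
  measurable_fun setT (fun a : Tup * Omega => growth kp N k a.2 (vec a.1)).
Proof.
apply: (measurable_prod_mem (f := fun j (a : Tup * Omega) => level_factor kp N k j a.2 (vec a.1))).
move=> j; rewrite mem_index_iota => /andP[j0 _].
apply: (@measurable_level_factor _ _ Omega (Tup * Omega)%type j id snd (fun a => vec a.1) j0) => //.
by move=> i; apply: measurable_vec_coord; exact: measurable_fst.
Qed.

(** Independence turns the moment of the product into the product of moments, and
    prod_(j < k) (1 + C r_j) <= exp (C sum_j r_j) <= exp C. *)
Lemma growth_moment kp N : 0 <= kp -> exists2 C, 0 <= C & forall k t, (0 < k)%N ->
  (\int[P]_o (growth kp N k o t `^ p)%:E <= C%:E * \prod_(1 <= j < k.+1) chaos_moment j t)%E.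
Proof.
move=> kp0.
have [C1 C10 H1] := factor_moment aQ i0 gf gamma0 p12 N kp0.
have [C2 C20 H2] := last_factor_moment aQ i0 gf gamma0 p12 N kp0.
exists (expR C1 * C2); first by rewrite mulr_ge0// expR_ge0.
move=> k t k0.
pose f j o := level_factor kp N k j o t `^ p.
pose c j := if j == k then C2 else 1 + C1 * ratio j k.
have c0 j : 0 <= c j.
  by rewrite /c; case: ifP => // _; rewrite addr_ge0// mulr_ge0// ratio_ge0.
have fc j : (0 < j)%N -> (j <= k)%N ->
    (\int[P]_o (f j o)%:E <= chaos_moment j t * (c j)%:E)%E.
  move=> j0 jk; rewrite /f /c /level_factor; case: eqP => [->|_].
    by rewrite ratio_id//; exact: H2.
  under eq_integral do rewrite addr0.
  by apply: H1; rewrite // ratio_ge0 ratio_le1.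
have f0 j : (0 <= \int[P]_o (f j o)%:E)%E by apply: integral_ge0 => o _; rewrite lee_fin powR_ge0.
have mfin j : (0 < j)%N -> chaos_moment j t \is a fin_num.
  by move=> j0; exact: (chaos_moment_fin aQ i0 gf gamma0 p12).
have ffin j : (0 < j)%N -> (j <= k)%N -> (\int[P]_o (f j o)%:E)%E \is a fin_num.
  move=> j0 jk; rewrite ge0_fin_numE//; apply: le_lt_trans (fc j j0 jk) _.
  by rewrite -(fineK (mfin j j0)) -EFinM ltry.
have IP : (\int[P]_o (\prod_(1 <= j < k.+1) f j o)%:E =
    (\prod_(1 <= j < k.+1) fine (\int[P]_o (f j o)%:E))%:E)%E.
  apply: (independent_prod (fields_independent gf) (iota_uniq _ _)).
  - by move=> j; rewrite mem_index_iota => /andP[].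
  - move=> j; rewrite mem_index_iota => /andP[j0 _].
    apply: (measurableT_comp (measurable_powR p)).
    apply: (@measurable_level_factor _ _ (g_sigma_algebraType (generators xi j))
      (g_sigma_algebraType (generators xi j)) j id id (fun=> t) j0) => //.
    by move=> x; exact: measurable_path_sigma.
  - by move=> j _ o; exact: powR_ge0.
  - by move=> j; rewrite mem_index_iota => /andP[j0 jk]; rewrite fineK// ffin.
rewrite (eq_integral (fun o => (\prod_(1 <= j < k.+1) f j o)%:E)); last first.
  move=> o _; congr EFin; rewrite /growth powR_prod// => j.
  by rewrite mem_index_iota => /andP[j0 _]; exact: level_factor_ge0.
have cm : (\prod_(1 <= j < k.+1) chaos_moment j t =
    (\prod_(1 <= j < k.+1) fine (chaos_moment j t))%:E)%E.
  by rewrite -prodEFin; apply: eq_big_nat => j /andP[j0 _]; rewrite fineK// mfin.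
have m0 j : 0 <= fine (chaos_moment j t).
  by apply: fine_ge0; apply: integral_ge0 => o _; rewrite lee_fin powR_ge0.
rewrite IP cm -EFinM lee_fin.
apply: (@le_trans _ _ (\prod_(1 <= j < k.+1) (fine (chaos_moment j t) * c j))).
  rewrite big_nat [leRHS]big_nat; apply: ler_prod => j /andP[j0 jk].
  rewrite fine_ge0//= -lee_fin fineK; last exact: ffin.
  by rewrite EFinM fineK ?mfin//; exact: fc.
rewrite big_split/= mulrC ler_wpM2r ?prodr_ge0//.
rewrite big_nat_recr//= /c eqxx ler_wpM2r//.
apply: (@le_trans _ _ (\prod_(1 <= j < k) expR (C1 * ratio j k))).
  rewrite big_nat [leRHS]big_nat; apply: ler_prod => j /andP[j0 jk].
  have r0 : 0 <= C1 * ratio j k by rewrite mulr_ge0// ratio_ge0.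
  by rewrite ltn_eqF// addr_ge0//=; exact: expR_ge1Dx.
rewrite -expR_sum ler_expR -mulr_sumr -[leRHS]mulr1 ler_wpM2l//.
exact: sum_ratio.
Qed.

End product_moments.

(** * Bumps of the partition of unity *)

Section shifted_derivatives.
Context {R : realType} {d : nat}.
Local Notation E := 'rV[R]_d.
Variable i : 'I_d.

Lemma shift_quotient (f : E -> R) (c t v : E) :
  (fun h : R => h^-1 *: (((fun u => f (u - c)) \o shift t) (h *: v) - f (t - c))) =
  (fun h : R => h^-1 *: ((f \o shift (t - c)) (h *: v) - f (t - c))).
Proof. by apply/funext => h /=; rewrite addrA. Qed.

Lemma dn_shift b (f : E -> R) (c : E) :
  dn i b (fun u => f (u - c)) = (fun u => dn i b f (u - c)).
Proof.
elim: b => [//|b IH]; rewrite !dnS IH; apply/funext => t.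
by rewrite /pderiv /derive shift_quotient.
Qed.

Lemma derivable_shift (f : E -> R) (c t v : E) : derivable f (t - c) v ->
  derivable (fun u => f (u - c)) t v.
Proof. by rewrite /derivable shift_quotient. Qed.

Lemma multi_deriv_dir b (f : E -> R) :
  multi_deriv (fun j => if j == i then b else 0%N) f = dn i b f.
Proof.
rewrite /multi_deriv; have : i \in enum 'I_d by rewrite mem_enum.
have := enum_uniq 'I_d; elim: (enum 'I_d) => //= j l IH /andP[jl ul].
rewrite inE; have [ij _|ij /= il] := eqVneq i j; last by rewrite IH.
rewrite -ij in jl *; congr (iter b _ _).
elim: l jl {IH ul} => //= j' l IH; rewrite inE negb_or => /andP[ij' il].
by rewrite eq_sym (negPf ij') /= IH.
Qed.

End shifted_derivatives.

Section bumps.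
Context {R : realType} {d : nat}.
Local Notation E := 'rV[R]_d.
Local Notation T := (torus R d).
Local Notation leb := (@lebesgue_power R d).
Local Notation vec := (@vec_of_tuple R d).
Local Notation Tup := (d.-tuple (measurableTypeR R)).
Variable phi : nat -> T -> R[i].
Hypothesis pou : partition_of_unity phi.
Implicit Types (k : nat).

Definition bump_re k (c t : E) : R := complex.Re (phi k (texp (t - c))).
Definition bump_im k (c t : E) : R := complex.Im (phi k (texp (t - c))).

Lemma phi_cube_texp k (I : dyadic d k) t :
  phi_cube phi I (texp t) = bump_re k (Defs.center I) t +i* bump_im k (Defs.center I) t.
Proof.
rewrite /phi_cube /bump_re /bump_im; have [m ->] := tlog_texp t.
by rewrite addrAC texp_periodic; case: (phi k _).
Qed.

Lemma smooth_periodic_tame i (f : E -> R) c : smooth f -> periodic_fun f ->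
  tame i (fun t => f (t - c)).
Proof.
move=> sf pf b; rewrite dn_shift; have [cf df] := dn_smooth i b sf.
split=> [t|]; first exact: derivable_shift.
have pd : periodic_fun (dn i b f).
  move=> t m; rewrite -[intvec m]opprK.
  have -> : t - - intvec m = t - intvec (- m) by rewrite intvecN.
  rewrite -(congr1 (@^~ t) (dn_shift i b f (intvec (- m)))); congr (dn i b _ t).
  by apply/funext => u; rewrite intvecN opprK.
apply: continuous_periodic_nice.
  move=> t; apply: (@continuous_comp _ _ _ (fun t : E => t - c) (dn i b f)); last exact: cf.
  by apply: (@continuousB _ _ _ id (cst c)) => //; exact: cst_continuous.
by move=> t m; rewrite addrAC pd.
Qed.

Lemma tame_bump i k c : (0 < k)%N -> tame i (bump_re k c) /\ tame i (bump_im k c).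
Proof.
move=> k0; have [sr si] := pou_smooth pou k0.
split.
  by apply: (@smooth_periodic_tame i (@complex.Re R \o phi k \o texp) c) => // t m /=; rewrite texp_periodic.
by apply: (@smooth_periodic_tame i (@complex.Im R \o phi k \o texp) c) => // t m /=; rewrite texp_periodic.
Qed.

(** The support of phi_k is transported to angles through the continuity of
    texp; the integer vector m is the ambiguity of the angle. *)
Lemma bump_support i b k c t : (0 < k)%N ->
  dn i b (bump_re k c) t != 0 \/ dn i b (bump_im k c) t != 0 ->
  exists m : 'rV[int]_d, forall j, `|t 0 j - c 0 j - (m 0 j)%:~R| <= 2 ^- k.
Proof.
move=> k0 H.
have C : closure [set z | phi k z != 0] (texp (t - c)).
  have cl (f : E -> R) : (forall u, phi k (texp (u - c)) = 0 -> f u = 0) ->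
      dn i b f t != 0 -> closure [set z | phi k z != 0] (texp (t - c)).
    move=> f0 /dn_support cf A nA.
    have cg : {for t, continuous (fun u : E => texp (u - c))}.
      apply: (@continuous_comp _ _ _ (fun u : E => u - c) (@texp R d)); last exact: continuous_texp.
      by apply: (@continuousB _ _ _ id (cst c)) => //; exact: cst_continuous.
    have [u [fu Au]] := cf _ (cg _ nA).
    exists (texp (u - c)); split => //=.
    by apply: contraNneq fu => /f0 ->.
  by case: H; apply: cl => u; rewrite /bump_re /bump_im => ->.
have [s Hs /texp_eq[m sm]] := pou_support pou k0 C.
exists (- m) => j; have := Hs j; rewrite sm !mxE mulrNz opprK => /andP[h1 h2].
by rewrite ler_norml h1 h2.
Qed.

Lemma bump_bound : exists K : nat -> R, forall i b k c t, (0 < k)%N ->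
  `|dn i b (bump_re k c) t| <= K b * 2 ^+ (k * b) /\
  `|dn i b (bump_im k c) t| <= K b * 2 ^+ (k * b).
Proof.
have [K HK] := pou_bound pou; exists K => i b k c t k0.
have := HK k k0 (fun j => if j == i then b else 0%N) (t - c).
rewrite !multi_deriv_dir /= -big_mkcond/= big_pred1_eq => H.
have -> : dn i b (bump_re k c) t = dn i b (@complex.Re R \o phi k \o texp) (t - c).
  by rewrite -(congr1 (@^~ t) (dn_shift i b (@complex.Re R \o phi k \o texp) c)).
have -> : dn i b (bump_im k c) t = dn i b (@complex.Im R \o phi k \o texp) (t - c).
  by rewrite -(congr1 (@^~ t) (dn_shift i b (@complex.Im R \o phi k \o texp) c)).
move: (dn _ _ _ _) (dn _ _ _ _) H => x y H.
by split; apply: le_trans H; rewrite /= -sqrtr_sqr ler_wsqrtr// ?lerDl ?lerDr sqr_ge0.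
Qed.

Definition cover_box k (c : E) (m : {ffun 'I_d -> 'I_3}) : set Tup :=
  tbox (fun i => c 0 i + (m i)%:R - 1 - 2 ^- k) (fun i => c 0 i + (m i)%:R - 1 + 2 ^- k).

(** Seen from the fundamental cube, the support of the bump at c can wrap around
    the faces, so it is covered by the translates of a box by the vectors with
    coordinates in {-1, 0, 1}. *)
Definition cover k (c : E) : set Tup := \big[setU/set0]_m cover_box k c m.

Lemma measurable_cover k c : measurable (cover k c).
Proof. by apply: bigsetU_measurable => m _; exact: measurable_tbox. Qed.

Lemma lebesgue_cover k c : (leb (cover k c) <= (6 ^+ d * 2 ^- (k * d))%:E)%E.
Proof.
pose x : R := (2 * 2 ^- k) ^+ d.
have B (l : seq {ffun 'I_d -> 'I_3}) :
    (leb (\big[setU/set0]_(m <- l) cover_box k c m) <= ((size l)%:R * x)%:E)%E.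
  elim: l => [|m l IH]; first by rewrite big_nil measure0 mul0r.
  rewrite big_cons (le_trans (measureU2 _ _ _))//.
  - exact: measurable_tbox.
  - by apply: bigsetU_measurable => j _; exact: measurable_tbox.
  rewrite /= -natr1 mulrDl mul1r addrC EFinD; apply: leeD => //.
  rewrite lebesgue_power_tbox => [|j]; last by rewrite lerD2l (@le_trans _ _ 0)// oppr_le0.
  rewrite lee_fin (eq_bigr (fun=> 2 * 2 ^- k)); last by move=> j _; ring.
  by rewrite prodr_const card_ord.
apply: le_trans (B _) _.
rewrite -sum1_size sum1_card card_ffun !card_ord natrX /x exprMn mulrA -exprMn -natrM lee_fin.
by rewrite exprVn -exprM.
Qed.

Lemma cover_cube k (c : E) (m : 'rV[int]_d) (s : Tup) : (forall j, `|c 0 j| <= 2^-1) -> (0 < k)%N ->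
  tcube s -> (forall j, `|vec s 0 j - c 0 j - (m 0 j)%:~R| <= 2 ^- k) -> cover k c s.
Proof.
move=> cb k0 cs H.
have k2 : 2 ^- k <= 2^-1 :> R.
  by rewrite lef_pV2 ?posrE ?exprn_gt0// -{1}[2]expr1 ler_eXn2l ?ltr1n.
have mb j : exists a : 'I_3, (m 0 j)%:~R = a%:R - 1 :> R.
  have := H j; have := cb j; have := cs j; rewrite !ler_norml => /andP[a1 a2] /andP[a3 a4] /andP[a5 a6].
  have /andP[b1 b2] : (-2 < (m 0 j)%:~R :> R) && ((m 0 j)%:~R < 2 :> R).
    by apply/andP; split; lra.
  have b3 : (-2 < m 0 j) by rewrite -(ltr_int R).
  have b4 : (m 0 j < 2) by rewrite -(ltr_int R).
  have [e|[e|e]] : m 0 j = -1 \/ m 0 j = 0 \/ m 0 j = 1.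
    by move: (m 0 j) b3 b4 => [[|[|n]]|[|n]] // _ _; [right; left|right; right|left].
  - by exists (Ordinal (isT : (0 < 3)%N)); rewrite e /=; ring.
  - by exists (Ordinal (isT : (1 < 3)%N)); rewrite e /=; ring.
  - by exists (Ordinal (isT : (2 < 3)%N)); rewrite e /=; ring.
have [a Ha] : exists a : {ffun 'I_d -> 'I_3}, forall j, (m 0 j)%:~R = (a j)%:R - 1 :> R.
  exists [ffun j => xget ord0 [set a : 'I_3 | (m 0 j)%:~R = a%:R - 1 :> R]] => j.
  by rewrite ffunE; have [a ?] := mb j; case: xgetP => [|/(_ a)//].
rewrite /cover (bigD1 a)//=; left => j.
have := H j; rewrite Ha mxE ler_norml => /andP[h1 h2].
by apply/andP; split; lra.
Qed.

Lemma center_le k (I : dyadic d k) j : (0 < k)%N -> `|(Defs.center I : E) 0 j| <= 2^-1.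
Proof.
move=> k0; rewrite mxE.
have h0 : 0 <= (I j)%:R :> R by [].
have h1 : (I j)%:R + 1 <= 2 ^+ k :> R by rewrite natr1 -natrX ler_nat.
have e : 2 ^+ k = 2 * 2 ^+ k.-1 :> R by rewrite -exprS prednK.
have x0 : 0 < 2 ^+ k :> R by rewrite exprn_gt0.
rewrite normrM ger0_norm ?invr_ge0 ?(ltW x0)// mulrC ler_pdivrMr// ler_norml.
by apply/andP; split; lra.
Qed.

(** The derivatives of order b are O(2^(kb)) and 2^k <= scale k. *)
Lemma bump_jnorm N : exists2 K, 0 <= K & forall i k (c : E) (s : Tup), (0 < k)%N ->
  (forall j, `|c 0 j| <= 2^-1) -> tcube s ->
  jnorm i (scale k) N (bump_re k c) (vec s) <= K * \1_(cover k c) s /\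
  jnorm i (scale k) N (bump_im k c) (vec s) <= K * \1_(cover k c) s.
Proof.
have [K HK] := bump_bound.
exists (\sum_(b < N.+1) `|K b|); first exact: sumr_ge0.
move=> i k c s k0 cb cs.
have sk : 0 < scale k :> R by exact: scale_gt0.
have J (f : E -> R) : (forall b, `|dn i b f (vec s)| <= K b * 2 ^+ (k * b)) ->
    (forall b, dn i b f (vec s) != 0 -> cover k c s) ->
    jnorm i (scale k) N f (vec s) <= (\sum_(b < N.+1) `|K b|) * \1_(cover k c) s.
  move=> fb fs; rewrite indicE; have [sc|nsc] := boolP (s \in cover k c).
    rewrite mulr1; apply: ler_sum => b _.
    rewrite ler_pdivrMr ?exprn_gt0// /tc normrM.
    apply: (@le_trans _ _ (`|dn i b f (vec s)|)).
      rewrite ler_piMr// ger0_norm ?invr_ge0// invf_le1 ?ltr0n ?fact_gt0//.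
      by rewrite ler1n fact_gt0.
    apply: le_trans (fb b) _; rewrite exprM.
    apply: (@le_trans _ _ (`|K b| * 2 ^+ k ^+ b)).
      by rewrite ler_wpM2r ?ler_norm// exprn_ge0// exprn_ge0.
    rewrite ler_wpM2l// lerXn2r ?nnegrE ?(ltW sk) ?exprn_ge0//.
    by rewrite /scale ler_peMl ?exprn_ge0// exprn_ege1// ler1n.
  have d0 b : dn i b f (vec s) = 0.
    by apply: contraNeq nsc => /fs; rewrite inE.
  rewrite mulr0 /jnorm big1// => b _.
  by rewrite /tc d0 mul0r normr0 mul0r.
have C b : dn i b (bump_re k c) (vec s) != 0 \/ dn i b (bump_im k c) (vec s) != 0 ->
    cover k c s.
  by move=> /(bump_support k0)[m Hm]; exact: (cover_cube cb k0 cs Hm).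
split; apply: J => b.
- by have [] := HK i b k c (vec s) k0.
- by move=> H; apply: C; left; exact: H.
- by have [] := HK i b k c (vec s) k0.
- by move=> H; apply: C; right; exact: H.
Qed.

End bumps.

(** * A lattice sum *)

Section lattice_sum.
Context {R : realType} {d : nat}.

(** The inverse of min (1, M / x). *)
Definition excess (M x : R) : R := Num.max 1 (x / M).

Lemma excess_ge1 M x : 1 <= excess M x. Proof. by rewrite le_max lexx. Qed.

Lemma excess_gt0 M x : 0 < excess M x. Proof. exact: lt_le_trans ltr01 (excess_ge1 _ _). Qed.

(** Compare with the telescoping sum of 1 / ((M + m) (M + m + 1)), using
    1 + m / M <= 2 excess M m. *)
Lemma sum_excess M n : 1 <= M -> \sum_(m < n) (excess M m%:R) ^- 2 <= 5 * M.
Proof.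
move=> M1; have M0 : 0 < M by lra.
(* The subtracted term is the tail of the telescoping sum; at k = 0 the bound
   reads 1 <= M. *)
have H k : \sum_(m < k.+1) (excess M m%:R) ^- 2 <= 5 * M - 4 * M ^+ 2 / (M + k%:R).
  elim: k => [|k IH].
    have -> : 5 * M - 4 * M ^+ 2 / (M + 0%:R) = M by field; rewrite gt_eqF.
    rewrite big_ord1 (le_trans _ M1)//.
    by rewrite invf_le1 ?exprn_gt0 ?excess_gt0// exprn_ege1// excess_ge1.
  rewrite big_ord_recr/=; apply: le_trans (lerD IH (lexx _)) _.
  have k0 : 0 <= k%:R :> R by [].
  have E1 : 1 + (k.+1%:R / M) <= 2 * excess M k.+1%:R.
    have := excess_ge1 M k.+1%:R; have : k.+1%:R / M <= excess M k.+1%:R by rewrite le_max lexx orbT.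
    lra.
  have E2 : (excess M k.+1%:R) ^- 2 <= 4 * M ^+ 2 / ((M + k%:R) * (M + k%:R + 1)).
    have x0 := excess_gt0 M k.+1%:R.
    have p1 : 0 < (M + k%:R) * (M + k%:R + 1) by apply: mulr_gt0; lra.
    rewrite -[leLHS]mul1r ler_pdivrMr ?exprn_gt0// mulrAC ler_pdivlMr// mul1r.
    have E3 : M + k%:R + 1 <= 2 * M * excess M k.+1%:R.
      have -> : M + k%:R + 1 = M * (1 + k.+1%:R / M) by rewrite -natr1; field; rewrite gt_eqF.
      by rewrite -mulrA mulrCA ler_pM2l.
    apply: (@le_trans _ _ ((M + k%:R + 1) ^+ 2)).
      by rewrite expr2 ler_wpM2r//; lra.
    have -> : 4 * M ^+ 2 * excess M k.+1%:R ^+ 2 = (2 * M * excess M k.+1%:R) ^+ 2 by ring.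
    by rewrite lerXn2r ?nnegrE ?mulr_ge0//; lra.
  apply: le_trans (lerD (lexx _) E2) _.
  rewrite le_eqVlt; apply/orP; left; apply/eqP.
  by rewrite -natr1; field; apply/andP; split; rewrite gt_eqF//; lra.
case: n => [|n]; first by rewrite big_ord0; lra.
have n0 : 0 <= n%:R :> R by [].
have : 0 <= 4 * M ^+ 2 / (M + n%:R) by rewrite mulr_ge0 ?invr_ge0//; [exact: mulr_ge0 (sqr_ge0 _)|lra].
by have := H n; lra.
Qed.

Definition lattice_weight (M : R) (n : 'rV[int]_d) : R :=
  \prod_i (excess M (absz (n ord0 i))%:R) ^- 2.

Lemma lattice_weight_ge0 M n : 0 <= lattice_weight M n.
Proof. by apply: prodr_ge0 => i _; rewrite invr_ge0 exprn_ge0// ltW// excess_gt0. Qed.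

Lemma lattice_weight_le1 M n : lattice_weight M n <= 1.
Proof.
apply: prodr_ile1 => i _; apply/andP; split.
  by rewrite invr_ge0 exprn_ge0// ltW// excess_gt0.
by rewrite invf_le1 ?exprn_gt0 ?excess_gt0// exprn_ege1// excess_ge1.
Qed.

(** Coordinates are encoded by a sign and an absolute value, so that the sum over
    a finite set of lattice points is at most a product of d one-dimensional
    sums. *)
Lemma sum_lattice_weight M (s : seq 'rV[int]_d) : 1 <= M -> uniq s ->
  \sum_(n <- s) lattice_weight M n <= (10 * M) ^+ d.
Proof.
move=> M1 us.
have [B HB] : exists B, forall n, n \in s -> forall i, (absz (n ord0 i) < B.+1)%N.
  exists (\max_(n <- s) \max_i absz (n ord0 i)) => n ns i; rewrite ltnS.
  apply: (@leq_trans (\max_i absz (n ord0 i))); first exact: (leq_bigmax i).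
  apply: (leq_bigmax_seq (F := fun n : 'rV[int]_d => (\max_i absz (n ord0 i))%N)) => //.
pose K : finType := (bool * 'I_B.+1)%type.
pose h (n : 'rV[int]_d) : {ffun 'I_d -> K} := [ffun i => (n ord0 i < 0, inord (absz (n ord0 i)))].
pose w (f : {ffun 'I_d -> K}) : R := \prod_i (excess M ((f i).2 : nat)%:R) ^- 2.
have w0 f : 0 <= w f by apply: prodr_ge0 => i _; rewrite invr_ge0 exprn_ge0// ltW// excess_gt0.
have wh n : n \in s -> lattice_weight M n = w (h n).
  by move=> ns; apply: eq_bigr => i _; rewrite /h ffunE /= inordK// HB.
have hinj : {in s &, injective h}.
  move=> m n ms ns /ffunP mn; apply/rowP => i; have := mn i; rewrite !ffunE => -[sg].
  move=> /(congr1 val); rewrite /= !inordK ?HB// => ab.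
  by rewrite [LHS]intEsign [RHS]intEsign sg ab.
apply: (@le_trans _ _ (\sum_(f <- map h s) w f)).
  by rewrite big_map big_seq [leRHS]big_seq; apply: ler_sum => n /wh ->.
rewrite big_uniq/=; last by rewrite map_inj_in_uniq.
apply: (@le_trans _ _ (\sum_f w f)); first by rewrite [leRHS](bigID [in map h s])/= lerDl sumr_ge0.
rewrite /w -(bigA_distr_bigA (fun _ (x : K) => (excess M (x.2 : nat)%:R) ^- 2))/=.
rewrite prodr_const card_ord lerXn2r ?nnegrE//.
- by apply: sumr_ge0 => i _; rewrite invr_ge0 exprn_ge0// ltW// excess_gt0.
- by rewrite mulr_ge0//; lra.
rewrite -(pair_bigA _ (fun (_ : bool) (x : 'I_B.+1) => (excess M (x : nat)%:R) ^- 2))/=.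
by rewrite big_bool/=; have := sum_excess B.+1 M1; lra.
Qed.

End lattice_sum.

(** * From directional to isotropic decay *)

Section coefficient_decay.
Context {R : realType} {d : nat}.
Local Notation E := 'rV[R]_d.
Local Notation leb := (@lebesgue_power R d).
Local Notation vec := (@vec_of_tuple R d).
Local Notation Tup := (d.-tuple (measurableTypeR R)).

(** A real substitute for the modulus of the Fourier coefficient of f. *)
Definition amplitude (n : 'rV[int]_d) (f : E -> R) : R :=
  `|wcoef n f 1 0| + `|wcoef n f 0 1|.

Lemma amplitude_ge0 n f : 0 <= amplitude n f. Proof. by rewrite addr_ge0. Qed.

Lemma Rd_integral_le (f : E -> R) (F : Tup -> R) c y : nice f -> 0 <= c ->
  measurable_fun setT F -> (forall s, 0 <= F s) ->
  (forall s, tcube s -> `|f (vec s)| <= c * F s) ->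
  (\int[leb]_(s in tcube) (F s)%:E <= y%:E)%E ->
  Rd_integral (@cube R d) (fun t => `|f t|) <= c * y.
Proof.
move=> nf c0 mF F0 fF Fy.
have ni := nice_integrable nf.
have mcF : measurable_fun (@tcube R d) (EFin \o F).
  exact/measurable_EFinP/measurable_funTS.
have le : (\int[leb]_(s in tcube) `|f (vec s)|%:E <= (c * y)%:E)%E.
  apply: (@le_trans _ _ (\int[leb]_(s in tcube) (c%:E * (F s)%:E))%E); last first.
    rewrite ge0_integralZl//; [|exact: measurable_tcube|by move=> s _; rewrite lee_fin].
    by rewrite EFinM; apply: lee_wpmul2l => //; rewrite lee_fin.
  apply: ge0_le_integral => //.
  - exact: measurable_tcube.
  - have [_ mf _] := nf; apply/measurable_EFinP; apply: measurable_funTS.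
    exact: measurableT_comp.
  - exact: emeasurable_funM.
rewrite /Rd_integral /Rintegral -lee_fin fineK// ge0_fin_numE.
  exact: le_lt_trans le (ltry _).
by apply: integral_ge0 => s _; rewrite lee_fin.
Qed.

(** Without integration by parts one gets the case excess = 1, and N integrations
    by parts give the other case. *)
Lemma amplitude_decay N M (f : E -> R) (F : Tup -> R) y n i : 0 < M ->
  tame i f -> measurable_fun setT F -> (forall s, 0 <= F s) ->
  (forall s, tcube s -> jnorm i M N f (vec s) <= F s) ->
  (\int[leb]_(s in tcube) (F s)%:E <= y%:E)%E ->
  amplitude n f * (excess M (absz (n ord0 i))%:R) ^+ N <= 2 * N`!%:R * y.
Proof.
move=> M0 tf mF F0 jF Fy.
have nf := nice_tame tf.
have f1 : 1 <= N`!%:R :> R by rewrite ler1n fact_gt0.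
have y0 : 0 <= y by rewrite -lee_fin (le_trans _ Fy)// integral_ge0// => s _; rewrite lee_fin.
have A0 := amplitude_ge0 n f.
have I0 : Rd_integral (@cube R d) (fun t => `|f t|) <= 1 * y.
  apply: (Rd_integral_le nf _ mF F0 _ Fy) => // s cs; rewrite mul1r (le_trans _ (jF s cs))//.
  exact: norm_le_jnorm.
have IN : Rd_integral (@cube R d) (fun t => `|dn i N f t|) <= N`!%:R * M ^+ N * y.
  have [_ nN] := tf N.
  apply: (Rd_integral_le nN _ mF F0 _ Fy); first by rewrite mulr_ge0// exprn_ge0// ltW.
  move=> s cs; apply: le_trans (dn_le_jnorm i N f (vec s) M0) _.
  by rewrite ler_wpM2l ?jF// mulr_ge0// exprn_ge0// ltW.
have D := fourier_decay n N tf.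
rewrite /excess maxEle; case: ifP => _; last first.
  rewrite expr1n mulr1 (@le_trans _ _ (2 * (1 * y)))//; last first.
    by rewrite mul1r -mulrA ler_wpM2l// ler_peMl.
  have W a b : `|a| + `|b| <= 1 -> `|wcoef n f a b| <= 1 * y.
    by move=> ab; apply: le_trans I0; exact: wcoef_le.
  have := W 1 0; have := W 0 1; rewrite !normr0 !normr1 addr0 add0r /amplitude.
  by move=> /(_ (lexx _)) h1 /(_ (lexx _)) h2; lra.
rewrite expr_div_n mulrA ler_pdivrMr ?exprn_gt0//.
have -> : (absz (n ord0 i))%:R = `|(n 0 i)%:~R| :> R by rewrite natr_absz intr_norm.
rewrite mulrC; apply: (le_trans D).
rewrite (_ : _ * M ^+ N = 2 * (N`!%:R * M ^+ N * y)); first by rewrite ler_wpM2l.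
by move: (N`!%:R) (M ^+ N) => u v; ring.
Qed.

Lemma excess_argmax (i0 : 'I_d) (M : R) (n : 'rV[int]_d) : exists i, forall j,
  excess M (absz (n ord0 j))%:R <= excess M (absz (n ord0 i))%:R.
Proof.
case: (@Order.TotalTheory.arg_maxP _ _ _ i0 xpredT (fun i => excess M (absz (n ord0 i))%:R)) => // i _ H.
by exists i => j; exact: H.
Qed.

Lemma japanese_le (M : R) (n : 'rV[int]_d) (r : R) : 1 <= M -> 1 <= r ->
  (forall j, excess M (absz (n ord0 j))%:R <= r) ->
  japanese n <= Num.sqrt (1 + d%:R) * M * r.
Proof.
move=> M1 r1 H; have M0 : 0 < M by lra.
have Mr : 0 <= M * r by rewrite mulr_ge0; lra.
rewrite -mulrA -(ger0_norm Mr) -sqrtr_sqr -sqrtrM ?addr_ge0// /japanese ler_wsqrtr//.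
rewrite mulrDl mul1r; apply: lerD.
  rewrite exprMn -[leLHS]mulr1; apply: ler_pM => //; exact: exprn_ege1.
rewrite (@le_trans _ _ (\sum_(i < d) (M * r) ^+ 2))//; last first.
  by rewrite sumr_const card_ord mulr_natl.
apply: ler_sum => i _; rewrite -[leLHS]ger0_norm ?sqr_ge0// normrX lerXn2r ?nnegrE//.
have := H i; rewrite natr_absz intr_norm /excess ge_max => /andP[_].
by rewrite ler_pdivrMr// mulrC.
Qed.

(** Take i where the excess r is largest. Then <n> <= sqrt (1 + d) M r, so the
    weight costs at most r^d, and of the gain r^(-3d) the part r^(-2d) remains. *)
Lemma weighted_decay (i0 : 'I_d) (s M : R) (n : 'rV[int]_d) (a y : R) : 1 <= M -> 0 <= s <= d%:R ->
  0 <= a -> (forall i, a * (excess M (absz (n ord0 i))%:R) ^+ (3 * d) <= y) ->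
  japanese n `^ s * a <= Num.sqrt (1 + d%:R) `^ s * M `^ s * y * lattice_weight M n.
Proof.
move=> M1 /andP[s0 sd] a0 H; have [i Hi] := excess_argmax i0 M n.
set r := excess M (absz (n ord0 i))%:R in Hi.
have r1 : 1 <= r by exact: excess_ge1.
have r0 : 0 < r by lra.
have ay : a <= y * r ^- (3 * d) by rewrite ler_pdivlMr ?exprn_gt0// H.
have S0 : 0 <= Num.sqrt (1 + d%:R) :> R by [].
have M0 : 0 <= M by lra.
have J : japanese n `^ s <= Num.sqrt (1 + d%:R) `^ s * M `^ s * r ^+ d.
  apply: (@le_trans _ _ ((Num.sqrt (1 + d%:R) * M * r) `^ s)).
    apply: ge0_ler_powR => //; rewrite ?nnegrE ?sqrtr_ge0//.
      by rewrite !mulr_ge0// ltW.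
    exact: japanese_le.
  rewrite powRM ?mulr_ge0//; last exact: ltW.
  rewrite powRM// ler_wpM2l ?mulr_ge0 ?powR_ge0//.
  by rewrite -powR_mulrn ?(ltW r0)//; exact: ler_powR.
have y0 : 0 <= y by apply: le_trans (H i); rewrite mulr_ge0// exprn_ge0// ltW.
have L : r ^- (2 * d) <= lattice_weight M n.
  rewrite exprM -exprVn; apply: (@le_trans _ _ (\prod_(j < d) r ^- 2)).
    by rewrite prodr_const card_ord.
  apply: ler_prod => j _; rewrite invr_ge0 exprn_ge0 ?(ltW r0)//=.
  have e0 := excess_gt0 M (absz (n ord0 j))%:R.
  by rewrite lef_pV2 ?posrE ?exprn_gt0// lerXn2r ?nnegrE ?(ltW r0) ?(ltW e0).
apply: (le_trans (ler_pM _ a0 J ay)); first exact: powR_ge0.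
rewrite -!mulrA; do 2 (rewrite ler_wpM2l ?powR_ge0//).
rewrite mulrCA ler_wpM2l// (le_trans _ L)// le_eqVlt; apply/orP; left; apply/eqP.
rewrite [in LHS](_ : 3 * d = d + 2 * d)%N; last by rewrite mulSn.
by rewrite exprD; field; rewrite !expf_neq0// gt_eqF.
Qed.

End coefficient_decay.

Section sequence_norm.
Context {R : realType} {d : nat}.

(** The weights are at most 1 and q >= 1, so that their q-th powers are summed
    like the weights themselves. *)
Lemma lq_norm_le (q L M : R) (a : 'rV[int]_d -> R[i]) : 1 <= q -> 0 <= L -> 1 <= M ->
  (forall n, Normc.normc (a n) <= L * lattice_weight M n) ->
  (lq_norm q a <= (L * ((10 * M) ^+ d) `^ q^-1)%:E)%E.
Proof.
move=> q1 L0 M1 H; have q0 : 0 < q by lra.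
have p0 : 0 <= (10 * M) ^+ d by rewrite exprn_ge0//; lra.
have nn n : 0 <= Normc.normc (a n) by rewrite /Normc.normc; case: (a n) => x y; exact: sqrtr_ge0.
have S : (\esum_(n in [set: 'rV[int]_d]) (Normc.normc (a n) `^ q)%:E
    <= (L `^ q * (10 * M) ^+ d)%:E)%E.
  apply: ge_ereal_sup => _ [A [fA _] <-].
  rewrite fsbig_finite//= sumEFin lee_fin.
  apply: (@le_trans _ _ (\sum_(n <- fset_set A) L `^ q * lattice_weight M n)); last first.
    by rewrite -mulr_sumr ler_wpM2l ?powR_ge0// sum_lattice_weight// fset_uniq.
  apply: ler_sum => n _; have w0 := lattice_weight_ge0 M n.
  apply: (@le_trans _ _ ((L * lattice_weight M n) `^ q)).
    by apply: ge0_ler_powR; rewrite ?nnegrE ?mulr_ge0// ltW.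
  rewrite powRM// ler_wpM2l ?powR_ge0//.
  move: w0; rewrite le_eqVlt => /predU1P[<-|w0]; first by rewrite powR0// gt_eqF.
  have w1 := lattice_weight_le1 M n.
  by apply: ge1r_powR => //; rewrite w0.
have E0 : (0 <= \esum_(n in [set: 'rV[int]_d]) (Normc.normc (a n) `^ q)%:E)%E.
  by apply: esum_ge0 => n _; rewrite lee_fin powR_ge0.
rewrite /lq_norm.
apply: (@le_trans _ _ ((L `^ q * (10 * M) ^+ d)%:E `^ q^-1)%E).
  apply: gt0_ler_poweR => //; first by rewrite invr_ge0 ltW.
    by rewrite in_itv/= E0 leey.
  by rewrite in_itv/= leey lee_fin mulr_ge0// powR_ge0.
rewrite poweR_EFin lee_fin powRM ?powR_ge0// -powRrM mulfV ?gt_eqF// powRr1//.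
Qed.

End sequence_norm.

(** * The pathwise bound *)

Section cascade.
Context {R : realType} {d : nat}.
Local Notation E := 'rV[R]_d.
Local Notation T := (torus R d).
Local Notation leb := (@lebesgue_power R d).
Local Notation vec := (@vec_of_tuple R d).
Local Notation Tup := (d.-tuple (measurableTypeR R)).
Context {disp : measure_display} {Omega : measurableType disp}.
Variables (P : probability Omega R) (Phi Q : E -> R) (xi : nat -> T -> {RV P >-> R}).
Variable phi : nat -> T -> R[i].
Hypothesis aQ : admissible_Q Q.
Variable i0 : 'I_d.
Hypothesis gf : gaussian_fields Phi xi.
Hypothesis pou : partition_of_unity phi.
Variable gamma : R.
Hypothesis gamma0 : 0 < gamma.
Local Notation chaos := (chaos Q xi gamma).

(** What multiplies the bump in the definition of the coefficients. *)
Definition cascade k (o : Omega) (t : E) : R :=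
  (\prod_(1 <= j < k) chaos j o t) * (chaos k o t - 1).

Lemma tame_cascade i k o : (0 < k)%N -> tame i (cascade k o).
Proof.
move=> k0; apply: (@tameM _ _ i (fun t => \prod_(1 <= j < k) chaos j o t)
  (chaos k o \+ cst (-1))).
  under eq_fun do rewrite big_add1.
  by apply: tame_prod => j; exact: (tame_chaos aQ gf).
by apply: tameD; [exact: (tame_chaos aQ gf)|exact: tame_cst].
Qed.

Lemma cascade_jnorm N : exists2 K, 0 <= K & forall i k o t, (0 < k)%N ->
  jnorm i (scale k) N (cascade k o) t <= growth Q xi gamma K N k o t.
Proof.
have [K K0 HK] := chaos_jnorm aQ gf gamma0 N.
exists K => // i k o t k0; have sk : 0 < scale k :> R by exact: scale_gt0.
have J j : (0 < j)%N -> (j <= k)%N ->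
    jnorm i (scale k) N (chaos j o) t <= factor Q xi gamma K (ratio j k) N j o t.
  move=> j0 jk; rewrite /factor /ratio -[scale j]scaleE; apply: HK => //.
  rewrite scaleE; have := @ratio_le1 R j k k0 jk.
  by rewrite /ratio ler_pdivrMr// mul1r.
have tc j : (0 < j)%N -> tame i (chaos j o) by move=> j0; exact: (tame_chaos aQ gf).
have tp : tame i (fun t => \prod_(1 <= j < k) chaos j o t).
  under eq_fun do rewrite big_add1.
  by apply: tame_prod => j; exact: tc.
have tl : tame i (chaos k o \+ cst (-1)) by apply: tameD; [exact: tc|exact: tame_cst].
apply: le_trans (jnormM N t sk tp tl) _.
rewrite /growth big_nat_recr//=; apply: ler_pM; rewrite ?jnorm_ge0//.
  rewrite (_ : (fun t => _) = (fun t => \prod_(0 <= j < k.-1) chaos j.+1 o t)); last first.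
    by apply/funext => u; rewrite big_add1.
  apply: le_trans (jnorm_prod N _ t sk (fun j => tc j.+1 isT)) _.
  rewrite big_add1 big_nat [leRHS]big_nat; apply: ler_prod => j /andP[_ jk].
  have jk' : (j.+1 < k)%N by rewrite -ltn_predRL.
  rewrite jnorm_ge0//= /level_factor (ltn_eqF jk') addr0; apply: J => //; exact: ltnW.
rewrite /level_factor eqxx; apply: le_trans (jnormD N t sk (tc k k0) (tame_cst i (-1))) _.
by rewrite jnorm_cst normrN1 lerD2r J.
Qed.

Lemma normc_le (z : R[i]) : Normc.normc z <= `|complex.Re z| + `|complex.Im z|.
Proof.
case: z => x y /=; rewrite -[leRHS]ger0_norm ?addr_ge0// -sqrtr_sqr ler_wsqrtr//.
rewrite sqrrD -!normrX !(ger0_norm (sqr_ge0 _)) -addrA lerD2l lerDr.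
by rewrite mulrn_wge0// mulr_ge0.
Qed.

(** Real and imaginary parts of the bump and of z^n are separated; each of the
    four integrals is a wave coefficient. *)
Lemma frakD_le tau k (I : dyadic d k) o (n : 'rV[int]_d) : (0 < k)%N ->
  Normc.normc (frakD tau phi (fun j z => X_ gamma Q xi j z o) I n) <=
  japanese n `^ (tau / 2) *
  (amplitude n (bump_re phi k (Defs.center I) \* cascade k o) +
   amplitude n (bump_im phi k (Defs.center I) \* cascade k o)).
Proof.
move=> k0; rewrite /frakD.
set fr := bump_re _ _ _ \* _; set fi := bump_im _ _ _ \* _.
have [tr ti] := tame_bump pou i0 (Defs.center I) k0.
have nr : nice fr by apply: (nice_tame (i := i0)); apply: tameM => //; exact: tame_cascade.
have ni : nice fi by apply: (nice_tame (i := i0)); apply: tameM => //; exact: tame_cascade.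
have nx : 0 <= japanese n `^ (tau / 2) by exact: powR_ge0.
have -> (x : R) (z : R[i]) : Normc.normc (x%:C * z) = `|x| * Normc.normc z.
  by rewrite Normc.normcM /= expr0n addr0 sqrtr_sqr.
rewrite (ger0_norm nx) ler_wpM2l//; apply: (le_trans (normc_le _)) => /=.
have V t : phi_cube phi I (texp t) * ((\prod_(1 <= j < k) X_ gamma Q xi j (texp t) o) *
     (X_ gamma Q xi k (texp t) o - 1))%:C * monomial (texp t) n =
   (fr t * cos (phase n t) - fi t * sin (phase n t)) +i*
   (fr t * sin (phase n t) + fi t * cos (phase n t)).
  have -> : \prod_(1 <= j < k) X_ gamma Q xi j (texp t) o = \prod_(1 <= j < k) chaos j o t.
    by apply: eq_big_nat => j /andP[j0 _]; rewrite (X_chaos aQ i0 gf).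
  rewrite (X_chaos aQ i0 gf)// monomial_texp phi_cube_texp -/(cascade k o t) /fr /fi /=.
  move: (bump_re _ _ _ _) (bump_im _ _ _ _) (cascade _ _ _) (cos _) (sin _) => a b c u v.
  by apply/eqP; rewrite eq_complex /=; apply/andP; split; apply/eqP; ring.
have nw a b : nice (wave n (a : R) b) by exact: nice_wave.
set F := (fun z : T => phi_cube phi I z * _ * _).
have IR : torus_integral (@complex.Re R \o F) = wcoef n fr 1 0 + -1 * wcoef n fi 0 1.
  rewrite -(wcoef_scale n (-1) 0 1 ni) mulr0 mulr1 /torus_integral.
  rewrite (_ : _ \o texp = (fr \* wave n 1 0) \+ (fi \* wave n 0 (-1))).
    by rewrite Rd_integral_cubeD//; exact: niceM.
  by apply/funext => t; rewrite /= /F V/= /wave; ring.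
have II : torus_integral (@complex.Im R \o F) = wcoef n fr 0 1 + wcoef n fi 1 0.
  rewrite /torus_integral.
  rewrite (_ : _ \o texp = (fr \* wave n 0 1) \+ (fi \* wave n 1 0)).
    by rewrite Rd_integral_cubeD//; exact: niceM.
  by apply/funext => t; rewrite /= /F V/= /wave; ring.
rewrite IR II /amplitude mulN1r.
have := ler_normB (wcoef n fr 1 0) (wcoef n fi 0 1).
by have := ler_normD (wcoef n fr 0 1) (wcoef n fi 1 0); lra.
Qed.

End cascade.

Section pathwise_bound.
Context {R : realType} {d : nat}.
Local Notation E := 'rV[R]_d.
Local Notation T := (torus R d).
Local Notation leb := (@lebesgue_power R d).
Local Notation vec := (@vec_of_tuple R d).
Local Notation Tup := (d.-tuple (measurableTypeR R)).
Context {disp : measure_display} {Omega : measurableType disp}.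
Variables (P : probability Omega R) (Phi Q : E -> R) (xi : nat -> T -> {RV P >-> R}).
Variable phi : nat -> T -> R[i].
Hypothesis aQ : admissible_Q Q.
Variable i0 : 'I_d.
Hypothesis gf : gaussian_fields Phi xi.
Hypothesis pou : partition_of_unity phi.
Variable gamma : R.
Hypothesis gamma0 : 0 < gamma.
Local Notation growth := (growth Q xi gamma).

(** The random variable through which the realization enters the pathwise bound. *)
Definition mass K k (c : E) (o : Omega) : \bar R :=
  (\int[leb]_(s in cover k c) (growth K (3 * d) k o (vec s))%:E)%E.

Lemma measurable_growth_path K N k o : measurable_fun setT (fun s : Tup => growth K N k o (vec s)).
Proof.
apply: (measurableT_comp (measurable_growth aQ gf gamma K N k)
  (g := fun s : Tup => (s, o))).
exact: measurable_pair2.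
Qed.

Lemma mass_ge0 K k c o : 0 <= K -> (0 <= mass K k c o)%E.
Proof. by move=> K0; apply: integral_ge0 => s _; rewrite lee_fin growth_ge0. Qed.

(** The case of infinite mass is trivial; otherwise the integral over the cube of
    the jet bound of bump times cascade is at most a multiple of the mass, and
    weighted_decay followed by lq_norm_le applies. *)
Lemma lq_norm_mass (tau q : R) : 0 <= tau <= 2 * d%:R -> 1 <= q ->
  exists2 K, 0 <= K & exists2 C, 0 < C & forall k (I : dyadic d k) o, (0 < k)%N ->
  (lq_norm q (frakD tau phi (fun j z => X_ gamma Q xi j z o) I) <=
   (C * (scale k `^ (tau / 2) * (scale k ^+ d) `^ q^-1))%:E * mass K k (Defs.center I) o)%E.
Proof.
move=> /andP[tau0 taud] q1.
have [K K0 HK] := cascade_jnorm aQ gf gamma0 (3 * d).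
have [B B0 HB] := bump_jnorm pou (3 * d).
exists K => //.
pose A := Num.sqrt (1 + d%:R) `^ (tau / 2) * (4 * ((3 * d)`!)%:R * B) * ((10 ^+ d) `^ q^-1).
have A0 : 0 <= A by rewrite !mulr_ge0// powR_ge0.
exists (A + 1); first by rewrite ltr_wpDl.
move=> k I o k0; set c := Defs.center I.
have cb j : `|c 0 j| <= 2^-1 by exact: center_le.
have sk : 0 < scale k :> R by exact: scale_gt0.
have s1 : 1 <= scale k :> R.
  have h1 : 1 <= k%:R ^+ 2 :> R by rewrite exprn_ege1// ler1n.
  have h2 : 1 <= 2 ^+ k :> R by rewrite exprn_ege1// ler1n.
  by apply: le_trans h1 _; rewrite /scale ler_peMr// exprn_ge0.
have D0 : 0 < scale k `^ (tau / 2) * (scale k ^+ d) `^ q^-1.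
  by rewrite mulr_gt0// powR_gt0// exprn_gt0.
set D := scale k `^ _ * _ in D0 *.
have Y0 := mass_ge0 k c o K0.
have [Yoo|Yfin] := eqVneq (mass K k c o) +oo%E.
  by rewrite Yoo gt0_muley ?leey// lte_fin mulr_gt0// ltr_wpDl.
have /fineK Yr : mass K k c o \is a fin_num by rewrite ge0_fin_numE// lt_neqAle Yfin leey.
set y := fine (mass K k c o) in Yr.
have y0 : 0 <= y by rewrite fine_ge0.
have mG := measurable_growth_path K (3 * d) k o.
have G0 s : 0 <= growth K (3 * d) k o (vec s) by exact: growth_ge0.
pose F s := B * \1_(cover k c) s * growth K (3 * d) k o (vec s).
have mC := measurable_cover k c.
have mF : measurable_fun setT F.
  by apply: measurable_funM => //; apply: measurable_funM => //; exact: measurable_indic.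
have F0 s : 0 <= F s by rewrite !mulr_ge0.
have Fy : (\int[leb]_(s in @tcube R d) (F s)%:E <= (B * y)%:E)%E.
  apply: (@le_trans _ _ (\int[leb]_s (F s)%:E)%E).
    apply: ge0_subset_integral => //; [exact: measurable_tcube|exact/measurable_EFinP|].
    by move=> s _; rewrite lee_fin.
  rewrite (eq_integral (fun s => B%:E * ((\1_(cover k c) s)%:E * (growth K (3 * d) k o (vec s))%:E))%E); last first.
    by move=> s _; rewrite /F -mulrA !EFinM.
  rewrite ge0_integralZl//.
  - by rewrite ge0_integral_indicM// -/(mass K k c o) -Yr EFinM.
  - by apply: emeasurable_funM; apply/measurable_EFinP => //; exact: measurable_indic.
  - by move=> s _; rewrite -EFinM lee_fin mulr_ge0.
have Amp f : (forall i, tame i f) ->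
    (forall i s, tcube s -> jnorm i (scale k) (3 * d) f (vec s) <= B * \1_(cover k c) s) ->
    forall n i, amplitude n (f \* cascade Q xi gamma k o) *
      (excess (scale k) (absz (n ord0 i))%:R) ^+ (3 * d) <= 2 * ((3 * d)`!)%:R * (B * y).
  move=> tf jf n i; have tc := tame_cascade aQ gf gamma i o k0.
  apply: (amplitude_decay n sk (tameM (tf i) tc) mF F0) => // s cs.
  apply: le_trans (jnormM _ _ sk (tf i) tc) _.
  by apply: ler_pM; rewrite ?jnorm_ge0// ?jf// HK.
have Are := Amp _ (fun i => (tame_bump pou i c k0).1) (fun i s cs => (HB i k c s k0 cb cs).1).
have Aim := Amp _ (fun i => (tame_bump pou i c k0).2) (fun i s cs => (HB i k c s k0 cb cs).2).
have L0 : 0 <= Num.sqrt (1 + d%:R) `^ (tau / 2) * scale k `^ (tau / 2) * (4 * ((3 * d)`!)%:R * (B * y)).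
  by rewrite !mulr_ge0// powR_ge0.
have H n : Normc.normc (frakD tau phi (fun j z => X_ gamma Q xi j z o) I n) <=
   Num.sqrt (1 + d%:R) `^ (tau / 2) * scale k `^ (tau / 2) * (4 * ((3 * d)`!)%:R * (B * y)) *
   lattice_weight (scale k) n.
  apply: le_trans (frakD_le aQ i0 gf pou gamma tau I o n k0) _.
  apply: (weighted_decay i0) => //.
  - by apply/andP; split; lra.
  - by rewrite addr_ge0// amplitude_ge0.
  - by move=> i; rewrite mulrDl; have := Are n i; have := Aim n i; lra.
apply: le_trans (lq_norm_le q1 L0 s1 H) _.
have e10 (x : R) : 0 <= x -> ((10 * x) ^+ d) `^ q^-1 = (10 ^+ d) `^ q^-1 * (x ^+ d) `^ q^-1.
  by move=> x0; rewrite exprMn powRM// exprn_ge0.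
rewrite -Yr -EFinM lee_fin (e10 _ (ltW sk)).
rewrite [leLHS](_ : _ = A * D * y); last first.
  rewrite /A /D; move: (_ `^ _) (_ `^ _) (_ `^ _) (_ `^ _) ((3 * d)`!%:R) => u v w x z; ring.
by rewrite ler_wpM2r// ler_wpM2r ?(ltW D0)// lerDl.
Qed.

End pathwise_bound.

(** * The moment bound *)

Section holder_power.
Context {dT : measure_display} {T : measurableType dT} {R : realType}.
Variable mu : {measure set T -> \bar R}.
Local Open Scope ereal_scope.

(** The integral of a nonnegative function is a supremum over the simple functions
    below it, so f and g may be arbitrary; f will be a power of the l^q norm. *)
Lemma ge0_le_integral_upper (f g : T -> \bar R) : (forall x, 0 <= f x) ->
  (forall x, f x <= g x) -> \int[mu]_x f x <= \int[mu]_x g x.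
Proof.
move=> f0 fg; have g0 x : 0 <= g x by exact: le_trans (f0 x) (fg x).
rewrite !ge0_integralTE//; apply: le_ereal_sup => _ [h hf <-].
by exists h => //= x; exact: le_trans (hf x) (fg x).
Qed.

(** Hoelder between g and the indicator of A. *)
Lemma integral_power_le (p : R) (A : set T) (g : T -> R) : (1 < p)%R -> measurable A ->
  measurable_fun setT g -> (forall x, 0 <= g x)%R ->
  (\int[mu]_(x in A) (g x)%:E) `^ p <= mu A `^ (p - 1) * \int[mu]_(x in A) (g x `^ p)%:E.
Proof.
move=> p1 mA mg g0; have p0 : (0 < p)%R by lra.
pose q := (p / (p - 1))%R; have q0 : (0 < q)%R by rewrite divr_gt0//; lra.
have pq : (p^-1 + q^-1 = 1)%R by rewrite /q; field; rewrite !gt_eqF//; lra.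
have m1 : measurable_fun setT (\1_A : T -> R) by exact: measurable_indic.
have mf : measurable_fun setT (g \* \1_A)%R by exact: measurable_funM.
have := @hoelder _ T R mu (g \* \1_A)%R (\1_A)%R p q mf m1 p0 q0 pq.
have -> : Lnorm mu 1 (EFin \o ((g \* \1_A) \* \1_A)%R) = \int[mu]_(x in A) (g x)%:E.
  rewrite Lnorm1 -[RHS]ge0_integral_indicM//; apply: eq_integral => x _ /=.
  rewrite -EFinM; congr EFin; rewrite ger0_norm ?mulr_ge0//.
  by rewrite indicE; case: (x \in A); rewrite ?mulr1 ?mul1r ?mulr0 ?mul0r.
have Ep : Lnorm mu p%:E (EFin \o (g \* \1_A)%R) `^ p = \int[mu]_(x in A) (g x `^ p)%:E.
  rewrite poweR_Lnorm; last by rewrite gt_eqF.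
  rewrite -[RHS]ge0_integral_indicM//; apply: eq_integral => x _ /=.
  rewrite -EFinM; congr EFin; rewrite ger0_norm ?mulr_ge0// powRM//.
  rewrite mulrC indicE; case: (x \in A); first by rewrite powR1.
  by rewrite powR0 ?gt_eqF.
have Eq : Lnorm mu q%:E (EFin \o (\1_A : T -> R)) `^ p = mu A `^ (p - 1).
  have -> : p = (q * (p - 1))%R by rewrite /q divfK// subr_eq0 gt_eqF.
  rewrite poweRrM poweR_Lnorm; last by rewrite gt_eqF.
  congr (_ `^ _).
    rewrite -[X in mu X]setIT -integral_indic//; apply: eq_integral => x _ /=.
    congr EFin; rewrite indicE ger0_norm//.
    by case: (x \in A); rewrite ?powR1// powR0 ?gt_eqF.
  by rewrite /q divfK// subr_eq0 gt_eqF.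
move=> H; rewrite muleC -Ep -Eq -poweRM ?Lnorm_ge0//.
apply: gt0_ler_poweR => //; first exact: ltW.
  by rewrite in_itv/= leey integral_ge0// => x _; rewrite lee_fin.
by rewrite in_itv/= leey mule_ge0// Lnorm_ge0.
Qed.

End holder_power.

Section moment_of_mass.
Context {R : realType} {d : nat}.
Local Notation E := 'rV[R]_d.
Local Notation T := (torus R d).
Local Notation leb := (@lebesgue_power R d).
Local Notation vec := (@vec_of_tuple R d).
Local Notation Tup := (d.-tuple (measurableTypeR R)).
Context {disp : measure_display} {Omega : measurableType disp}.
Variables (P : probability Omega R) (Phi Q : E -> R) (xi : nat -> T -> {RV P >-> R}).
Hypothesis aQ : admissible_Q Q.
Variable i0 : 'I_d.
Hypothesis gf : gaussian_fields Phi xi.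
Variables (gamma p : R).
Hypothesis gamma0 : 0 < gamma.
Hypothesis p12 : 1 < p <= 2.
Local Notation chaos_moment := (chaos_moment Q xi gamma p).
Local Notation growth := (growth Q xi gamma).
Local Notation mass := (mass Q xi gamma).

(** The function f stands for the l^q norm. Its p-th power is dominated by a
    measurable function, to which Tonelli applies. *)
Lemma mass_moment K : 0 <= K -> exists2 C, 0 < C &
  forall k (c : E) (S : \bar R) (L : R) (f : Omega -> \bar R), (0 < k)%N -> 0 <= L ->
  (forall t, (\prod_(1 <= j < k.+1) chaos_moment j t <= S)%E) ->
  (forall o, (0 <= f o)%E) -> (forall o, (f o <= L%:E * mass K k c o)%E) ->
  (\int[P]_o (f o `^ p) <= (C * (L * (6 ^+ d * 2 ^- (k * d))) `^ p)%:E * S)%E.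
Proof.
move=> K0; have p1 : 1 < p by case/andP: p12.
have p0 : 0 < p by lra.
have [C0 C00 HC] := growth_moment aQ i0 gf gamma0 p12 (3 * d) K0.
exists (C0 + 1); first by rewrite ltr_wpDl.
move=> k c S L f k0 L0 HS f0 fL.
set V := 6 ^+ d * 2 ^- (k * d); have V0 : 0 < V.
  by rewrite mulr_gt0 ?invr_gt0 ?exprn_gt0//.
have AV : (leb (cover k c) <= V%:E)%E by exact: lebesgue_cover.
have mA := measurable_cover k c.
pose g (a : Tup * Omega) : \bar R :=
  ((\1_(cover k c) a.1 : R)%:E * (growth K (3 * d) k a.2 (vec a.1) `^ p)%:E)%E.
have g0 a : (0 <= g a)%E by rewrite mule_ge0// lee_fin ?powR_ge0.
have mg : measurable_fun setT g.
  apply: emeasurable_funM; apply/measurable_EFinP.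
    by apply: (measurableT_comp _ measurable_fst); exact: measurable_indic.
  apply: (measurableT_comp (measurable_powR p)).
  exact: (measurable_growth aQ gf gamma K (3 * d) k).
(* What remains after Hoelder: the missing factor V comes from the outer
   integral over the cover. *)
pose W := L `^ p * V `^ (p - 1); have W0 : 0 <= W by rewrite mulr_ge0// powR_ge0.
have S0 : (0 <= S)%E.
  apply: le_trans (HS 0); apply: prode_ge0 => j _; apply: integral_ge0 => o _.
  by rewrite lee_fin powR_ge0.
have fW o : (f o `^ p <= W%:E * \int[leb]_s g (s, o))%E.
  apply: (@le_trans _ _ ((L%:E * mass K k c o) `^ p)%E).
    apply: gt0_ler_poweR => //; first exact: ltW.
      by rewrite in_itv/= f0 leey.
    by rewrite in_itv/= leey mule_ge0// mass_ge0.
  rewrite poweRM//; last exact: mass_ge0.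
  rewrite poweR_EFin /W EFinM -muleA; apply: lee_wpmul2l; first by rewrite lee_fin powR_ge0.
  have mG := measurable_growth_path aQ gf gamma K (3 * d) k o.
  have G0 s : 0 <= growth K (3 * d) k o (vec s) by exact: growth_ge0.
  rewrite /mass; apply: le_trans (integral_power_le leb p1 mA mG G0) _.
  rewrite /g/= ge0_integral_indicM//; apply: lee_wpmul2r.
    by apply: integral_ge0 => s _; rewrite lee_fin powR_ge0.
  rewrite -poweR_EFin; apply: gt0_ler_poweR => //; first by rewrite subr_ge0 ltW.
    by rewrite in_itv/= leey measure_ge0.
  by rewrite in_itv/= leey lee_fin ltW.
have CW : (C0 + 1) * (L * V) `^ p = W * V * (C0 + 1).
  have VV : V `^ p = V `^ (p - 1) * V.
    rewrite -[in LHS](subrK 1 p) [LHS]powRD; last by apply/implyP => _; rewrite gt_eqF.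
    by rewrite powRr1// ltW.
  by rewrite powRM ?(ltW V0)// VV /W; ring.
clearbody W V.
have [Soo|Sfin] := eqVneq S +oo%E.
  have [L00|L1] := eqVneq L 0.
    rewrite [X in (X <= _)%E](_ : _ = 0%E).
      by rewrite mule_ge0// lee_fin mulr_ge0 ?powR_ge0// addr_ge0.
    apply: integral0_eq => o _.
    have : (f o <= 0)%E by apply: le_trans (fL o) _; rewrite L00 mul0e.
    move=> fo; have -> : f o = 0%E by apply/eqP; rewrite eq_le fo f0.
    by rewrite poweR0r ?gt_eqF.
  rewrite Soo gt0_muley ?leey// lte_fin mulr_gt0 ?ltr_wpDl//.
  by rewrite powR_gt0// mulr_gt0// lt_neqAle eq_sym L1.
have /fineK Sr : S \is a fin_num by rewrite ge0_fin_numE// lt_neqAle Sfin leey.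
set s := fine S in Sr; have s0 : 0 <= s by rewrite fine_ge0.
apply: (@le_trans _ _ (\int[P]_o (W%:E * \int[leb]_s g (s, o)))%E).
  by apply: ge0_le_integral_upper => // o; exact: poweR_ge0.
have mF : measurable_fun setT (fun o => \int[leb]_s g (s, o))%E.
  exact: measurable_fun_fubini_tonelli_G.
rewrite ge0_integralZl//; last by move=> o _; exact: integral_ge0.
rewrite -(@fubini_tonelli _ _ Tup Omega R leb P)// CW -mulrA EFinM -muleA.
apply: lee_wpmul2l => //.
apply: (@le_trans _ _ (\int[leb]_u ((\1_(cover k c) u)%:E * ((C0 * s)%:E : \bar R)))%E).
  apply: ge0_le_integral_upper => u; first exact: integral_ge0.
  rewrite /g/= ge0_integralZl//.
  - apply: lee_wpmul2l => //; apply: le_trans (HC k (vec u) k0) _.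
    by rewrite EFinM Sr; apply: lee_wpmul2l.
  - apply/measurable_EFinP; apply: (measurableT_comp (measurable_powR p)).
    apply: (measurableT_comp (measurable_growth aQ gf gamma K (3 * d) k)
      (g := fun o => (u, o))).
    exact: measurable_pair1.
  - by move=> o _; rewrite lee_fin powR_ge0.
rewrite ge0_integral_indicM// integral_cst// -Sr -EFinM muleC.
apply: (@le_trans _ _ (V%:E * (C0 * s)%:E)%E).
  by apply: lee_wpmul2r => //; rewrite lee_fin mulr_ge0.
by rewrite -EFinM lee_fin -mulrA ler_wpM2l ?(ltW V0)// ler_wpM2r// lerDl.
Qed.

End moment_of_mass.

Lemma D_exponent_le (R : realType) (d : nat) (gamma : R) :
  0 < gamma < Num.sqrt (2 * d%:R) -> D_exponent (d := d) gamma <= d%:R.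
Proof.
move=> /andP[g0 gd]; rewrite /D_exponent; case: ltP => H.
  by rewrite gerBl sqr_ge0.
have S : Num.sqrt (2 * d%:R) ^+ 2 = 2 * d%:R :> R by rewrite sqr_sqrtr.
have s0 : 0 <= Num.sqrt (2 * d%:R) :> R by [].
apply: (@le_trans _ _ ((Num.sqrt (2 * d%:R) / 2) ^+ 2)).
  by rewrite lerXn2r ?nnegrE; lra.
by rewrite expr_div_n S; have : 0 <= d%:R :> R by []; lra.
Qed.

Lemma scale_powR (R : realType) (k : nat) (e : R) : (0 < k)%N ->
  scale k `^ e = k%:R `^ (2 * e) * 2 `^ (k%:R * e).
Proof.
move=> k0; rewrite powRM ?exprn_ge0// -!powR_mulrn// -!powRrM.
by [].
Qed.

(** The exponent of k^2 is p (tau/2 + d/q) <= 2dp because tau <= 2d and q >= 2. *)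
Lemma scale_cover_power (R : realType) (d k : nat) (tau p q : R) : (0 < k)%N ->
  0 <= tau <= 2 * d%:R -> 1 < p -> 2 <= q ->
  (scale k `^ (tau / 2) * (scale k ^+ d) `^ q^-1 * (6 ^+ d * 2 ^- (k * d))) `^ p <=
  (6 ^+ d) `^ p * (k%:R `^ (4 * d%:R * p) *
   2 `^ (k%:R * (- (d%:R * p) + d%:R * p / q + tau * p / 2))).
Proof.
move=> k0 /andP[t0 td] p1 q2; have p0 : 0 < p by lra.
have sk : 0 < scale k :> R by exact: scale_gt0.
have k1 : 1 <= k%:R :> R by rewrite ler1n.
have d0 : 0 <= d%:R :> R by [].
have q0 : 0 < q by lra.
have -> : scale k `^ (tau / 2) * (scale k ^+ d) `^ q^-1 = scale k `^ (tau / 2 + d%:R / q) :> R.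
  rewrite powRD; last by apply/implyP => _; rewrite gt_eqF.
  by rewrite -powR_mulrn ?(ltW sk)// -powRrM.
have -> : 2 ^- (k * d) = 2 `^ (- (k * d)%:R) :> R by rewrite powRN powR_mulrn.
rewrite mulrCA powRM ?mulr_ge0 ?exprn_ge0 ?powR_ge0// ler_wpM2l ?powR_ge0//.
rewrite powRM ?powR_ge0// -!powRrM scale_powR// -mulrA.
rewrite -powRD; last by apply/implyP => _; rewrite gt_eqF.
apply: ler_pM; rewrite ?powR_ge0//.
  apply: ler_powR => //.
  have dq : d%:R / q <= d%:R / 2.
    by rewrite ler_wpM2l// lef_pV2 ?posrE//; lra.
  rewrite mulrA ler_wpM2r ?(ltW p0)//; lra.
rewrite natrM le_eqVlt; apply/orP; left; apply/eqP; congr (_ `^ _).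
by field; rewrite gt_eqF.
Qed.

Theorem proposition4p4 (R : realType) (d : nat) (gamma tau p q : R)
    (Phi Q : 'rV[R]_d -> R) (phi : nat -> torus R d -> R[i])
    (disp : measure_display) (Omega : measurableType disp)
    (P : probability Omega R) (xi : nat -> torus R d -> {RV P >-> R}) :
  (1 <= d)%N ->
  0 < gamma < Num.sqrt (2 * d%:R) ->
  0 < tau < D_exponent (d := d) gamma ->
  1 < p <= 2 ->
  2 <= q ->
  admissible_Phi Phi ->
  admissible_Q Q ->
  gaussian_fields Phi xi ->
  partition_of_unity phi ->
  let X := X_ gamma Q xi in
  exists2 C : R, 0 < C &
    forall (k : nat) (I : dyadic d k), (1 <= k)%N ->
      (\int[P]_o (lq_norm q (frakD tau phi (fun j z => X j z o) I) `^ p)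
       <= (C * k%:R `^ (4 * d%:R * p)
             * 2 `^ (k%:R * (- (d%:R * p) + d%:R * p / q + tau * p / 2)))%R%:E
          * ereal_sup
              [set \prod_(1 <= j < k.+1) 'E_P[fun o => (`|X j z o| `^ p)%R]
              | z in [set: torus R d]])%E.
Proof.
move=> d1 gd td p12 q2 aPhi aQ gf pou X.
have [gamma0 _] := andP gd; have [tau0 tauD] := andP td; have [p1 p2] := andP p12.
have i0 : 'I_d := Ordinal d1.
have t2 : 0 <= tau <= 2 * d%:R.
  have := D_exponent_le gd; have : 0 <= d%:R :> R by [].
  by move=> *; apply/andP; split; lra.
have q1 : 1 <= q by lra.
have [K K0 [C1 C10 H1]] := lq_norm_mass aQ i0 gf pou gamma0 t2 q1.
have [C2 C20 H2] := mass_moment aQ i0 gf gamma0 p12 K0.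
exists (C2 * (C1 `^ p * (6 ^+ d) `^ p)).
  by rewrite !mulr_gt0 ?powR_gt0 ?exprn_gt0.
move=> k I k0.
set S := ereal_sup _.
have HS t : (\prod_(1 <= j < k.+1) chaos_moment Q xi gamma p j t <= S)%E.
  apply: ereal_sup_ubound; exists (texp t) => //.
  apply: eq_big_nat => j /andP[j0 _]; rewrite unlock; apply: eq_integral => o _.
  by rewrite /= /X (X_chaos aQ i0 gf)// ger0_norm// ltW// chaos_gt0.
have D0 : 0 <= scale k `^ (tau / 2) * (scale k ^+ d) `^ q^-1 :> R.
  by rewrite mulr_ge0// powR_ge0.
have S0 : (0 <= S)%E.
  apply: le_trans (HS 0); apply: prode_ge0 => j _; apply: integral_ge0 => o _.
  by rewrite lee_fin powR_ge0.
apply: (le_trans (H2 k (Defs.center I) S _ _ k0 (mulr_ge0 (ltW C10) D0) HS _ (fun o => H1 k I o k0))).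
  by move=> o; exact: poweR_ge0.
apply: lee_wpmul2r => //; rewrite lee_fin.
have C1n : 0 <= C1 by exact: ltW.
have Bd := scale_cover_power k0 t2 p1 q2.
rewrite -[C1 * _ * _]mulrA powRM//; last first.
  have V0 : 0 <= 6 ^+ d * 2 ^- (k * d) :> R by rewrite mulr_ge0// ?invr_ge0 exprn_ge0.
  exact: mulr_ge0 D0 V0.
apply: (@le_trans _ _ (C2 * (C1 `^ p * ((6 ^+ d) `^ p * (k%:R `^ (4 * d%:R * p) *
   2 `^ (k%:R * (- (d%:R * p) + d%:R * p / q + tau * p / 2))))))).
  rewrite ler_wpM2l ?(ltW C20)// ler_wpM2l ?powR_ge0//.
rewrite le_eqVlt; apply/orP; left; apply/eqP.
move: (_ `^ _) (_ `^ _) (_ `^ _) (_ `^ _) => u v w x; ring.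
Qed.
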